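(* For $\theta\in\mathbb C$, $0<\alpha<1$ and $a\in\mathbb C^*$ with $$\arg a+\alpha\pi/2<\pi/2,\qquad \arg a-\alpha\pi/2>-\pi/2,$$ define an operator $\widetilde Q(\theta,\alpha,a)$ in $\mathcal P$ as follows. If $\operatorname{Re}\theta>-1$, then $$\widetilde Q(\theta,\alpha,a)f(x)=\int_0^\infty N(x,y)f(y)\,dy,\qquad N(x,y)=\frac1{2\pi i}\int_{-i\infty}^{i\infty}z^\theta\exp(-az^\alpha y+zx)\,dz .$$ If $\operatorname{Re}\theta\le-1$, then $\widetilde Q(\theta,\alpha,a)=J_n\circ\widetilde Q(\theta+n,\alpha,a)$ for a sufficiently large positive integer $n$. Then the operators $\widetilde Q(\theta,\alpha,a)$ are bounded in $\mathcal P$, and their product is given by $$\widetilde Q(\theta',\alpha',a')\,\widetilde Q(\theta,\alpha,a)=(a')^\theta\,\widetilde Q\bigl(\theta'+\theta\alpha',\,\alpha\alpha',\,a(a')^\alpha\bigr)$$ for all $\theta,\theta'\in\mathbb C$, $\alpha,\alpha'\in(0,1)$ and $a,a'\in\mathbb C^*$ with $\arg a+\alpha\pi/2<\pi/2$, $\arg a-\alpha\pi/2>-\pi/2$, $\arg a'+\alpha'\pi/2<\pi/2$, $\arg a'-\alpha'\pi/2>-\pi/2$.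
   Context: $\mathcal P$ is the space of $C^\infty$-functions $f$ on the half-line $x\ge0$ such that $f^{(k)}(0)=0$ for all $k\ge0$ and $\lim_{x\to+\infty}f^{(m)}(x)e^{-\varepsilon x}=0$ for all $\varepsilon>0$, $m\ge0$; it carries the Fréchet topology of the seminorms $\sup_{x\ge0}|f^{(m)}(x)|e^{-\varepsilon x}$, and ''bounded'' means continuous. Operators given by an integral formula for $x>0$ are extended to $x=0$ by continuity. $\arg a\in(-\pi,\pi]$, and all powers ($z^\theta$, $z^\alpha$ for $\operatorname{Re}z\ge0$, $z\ne0$, and $(a')^\theta,(a')^\alpha$) are principal branches. For a positive integer $n$, $J_n$ is the $n$-fold integration from $0$: $J_nf(x)=\frac1{(n-1)!}\int_0^xf(y)(x-y)^{n-1}\,dy$. *)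

(* Defs.v *)
From HB Require Import structures.
From mathcomp Require Import all_boot all_order all_algebra.
From mathcomp Require Import complex.
From mathcomp Require Import all_classical all_reals all_analysis.

Set Implicit Arguments.
Unset Strict Implicit.
Unset Printing Implicit Defensive.

Import Order.TTheory GRing.Theory Num.Theory.
Import numFieldNormedType.Exports.

Local Open Scope complex_scope.
Local Open Scope classical_set_scope.
Local Open Scope ring_scope.

Section ComplexFunctions.
Variable R : realType.
Implicit Types (z w theta : R[i]) (D : set R) (g : R -> R[i]).

Definition cmod z : R := ComplexField.Normc.normc z.

Definition cexp z : R[i] :=
  (expR (complex.Re z))%:C * (cos (complex.Im z) +i* sin (complex.Im z)).

(* The argument in ]-pi, pi]; carg 0 is a junk value. *)
Definition carg z : R :=
  if 0 <= complex.Im z then acos (complex.Re z / cmod z)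
  else - acos (complex.Re z / cmod z).

(* The principal branch exp (theta * (ln |z| + i arg z)), for z != 0. *)
Definition cpow z theta : R[i] := cexp (theta * (ln (cmod z) +i* carg z)).

Definition cintegrable D g : Prop :=
  (@lebesgue_measure R).-integrable D (EFin \o (fun t => complex.Re (g t))) /\
  (@lebesgue_measure R).-integrable D (EFin \o (fun t => complex.Im (g t))).

Definition cintegral D g : R[i] :=
  (\int[@lebesgue_measure R]_(t in D) complex.Re (g t)) +i*
  (\int[@lebesgue_measure R]_(t in D) complex.Im (g t)).

End ComplexFunctions.

(* A function on the half-line x >= 0 is encoded as a function R -> R[i] that
   is zero for x < 0, so that equality on the half-line is Leibniz equality.
   All derivatives are relative to the half-line, i.e. one-sided at 0. *)
Section SpaceP.
Variable R : realType.
Implicit Types (f g : R -> R[i]) (x e : R) (m : nat).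

(* R[i]^o is R[i] with the topology of its norm. *)
Definition hquot f x : R -> R[i]^o := fun y => (f y - f x) / (y - x)%:C.

Definition hderivable f x : Prop :=
  cvg (hquot f x y @[y --> within `[0, +oo[ x^']).

Definition hderiv f : R -> R[i] :=
  fun x => lim (hquot f x y @[y --> within `[0, +oo[ x^']).

Definition hderivn m f : R -> R[i] := iter m hderiv f.

Definition in_P f : Prop :=
  [/\ forall x, x < 0 -> f x = 0,
      forall m x, 0 <= x -> hderivable (hderivn m f) x,
      forall m, hderivn m f 0 = 0
    & forall e m, 0 < e ->
        (hderivn m f x * (expR (- (e * x)))%:C : R[i]^o) @[x --> +oo]
          --> (0 : R[i]^o)].

Record Pspace : Type := MkP { Pfun :> R -> R[i]; PfunP : in_P Pfun }.

HB.instance Definition _ := gen_eqMixin Pspace.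
HB.instance Definition _ := gen_choiceMixin Pspace.

Definition seminorm m e f : R :=
  sup [set cmod (hderivn m f x) * expR (- (e * x)) | x in `[0, +oo[].

(* The topology generated by the seminorms: U is open when it contains, around
   each of its points, a ball for finitely many seminorms. *)
Definition Popen : set_system Pspace := fun U => forall f : Pspace, U f ->
  exists (s : seq (nat * {posnum R})) (d : R), 0 < d /\
    forall g : Pspace,
      (forall p, p \in s ->
         seminorm p.1 (p.2)%:num (fun x => g x - f x) < d) -> U g.

Lemma PopenT : Popen setT.
Proof. by move=> f _; exists [::], 1; split. Qed.

Lemma PopenI : setI_closed Popen.
Proof.
move=> U V oU oV f [/oU[s [d [d0 sU]]] /oV[t [c [c0 tV]]]].
exists (s ++ t), (Num.min d c); split; first by rewrite lt_min d0 c0.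
move=> g gf; split; [apply: sU|apply: tV] => p ps.
  by have := gf p; rewrite mem_cat ps lt_min => /(_ isT)/andP[].
by have := gf p; rewrite mem_cat ps orbT lt_min => /(_ isT)/andP[].
Qed.

Lemma Popen_bigU (I : Type) (U : I -> set Pspace) :
  (forall i, Popen (U i)) -> Popen (\bigcup_i U i).
Proof.
move=> oU f [i _ /(oU i)[s [d [d0 sU]]]].
by exists s, d; split=> // g /sU; exists i.
Qed.

HB.instance Definition _ :=
  isOpenTopological.Build Pspace PopenT PopenI Popen_bigU.

End SpaceP.

Section Operators.
Variable R : realType.
Implicit Types (theta a z : R[i]) (alpha x y : R) (n : nat).
Implicit Types (f g : R -> R[i]).

Definition admissible alpha a : Prop :=
  [/\ 0 < alpha < 1, a != 0,
      carg a + alpha * pi / 2 < pi / 2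
    & - (pi / 2) < carg a - alpha * pi / 2].

Definition Nker_integrand theta alpha a x y z : R[i] :=
  cpow z theta * cexp (- (a * cpow z alpha%:C * y%:C) + z * x%:C).

(* The parametrization z = i t of the imaginary axis, with dz = i dt. *)
Definition on_imag_axis (h : R[i] -> R[i]) : R -> R[i] :=
  fun t => h ('i * t%:C) * 'i.

Definition Nker theta alpha a x y : R[i] :=
  (2 * pi%:C * 'i)^-1 *
  cintegral setT (on_imag_axis (Nker_integrand theta alpha a x y)).

(* A formula valid for x > 0, extended to x = 0 by continuity. *)
Definition extend_half_line g : R -> R[i] := fun x =>
  if x < 0 then 0
  else if x == 0 then lim ((g y : R[i]^o) @[y --> 0^'+])
  else g x.

Definition Qint theta alpha a f : R -> R[i] :=
  extend_half_line (fun x =>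
    cintegral `[0, +oo[ (fun y => Nker theta alpha a x y * f y)).

Definition Jint n f : R -> R[i] := fun x =>
  ((n.-1)`!%:R)^-1 *
  cintegral `[0, x] (fun y => f y * ((x - y) ^+ n.-1)%:C).

(* A positive n with - 1 < Re theta + n when Re theta <= - 1; the result does
   not depend on which such n is used. *)
Definition Jorder theta : nat := (Num.truncn `|complex.Re theta|).+1.

Definition Qtilde theta alpha a f : R -> R[i] :=
  if -1 < complex.Re theta then Qint theta alpha a f
  else Jint (Jorder theta) (Qint (theta + (Jorder theta)%:R) alpha a f).

End Operators.

(* Main.v *)
Require Import Defs.
From HB Require Import structures.
From mathcomp Require Import all_boot all_order all_algebra.
From mathcomp Require Import complex.
From mathcomp Require Import all_classical all_reals all_analysis.
From mathcomp Require Import measurable_realfun lebesgue_integral_under ring lra.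

Set Implicit Arguments.
Unset Strict Implicit.
Unset Printing Implicit Defensive.

Import Order.TTheory GRing.Theory Num.Theory.
Import numFieldNormedType.Exports.

Local Open Scope complex_scope.
Local Open Scope classical_set_scope.
Local Open Scope ring_scope.

Local Notation Re := complex.Re.
Local Notation Im := complex.Im.

(* Write L for the Laplace transform. The kernel N(., y) is the inverse Laplace
   transform of z^theta exp(- a z^alpha y), so that, whatever the real part of
   theta, the operator Q(theta, alpha, a) multiplies by z^theta after the change
   of variable w = a z^alpha:
     L (Q f) (z) = z^theta (L f)(a z^alpha),
   J_n being the multiplication by z^(-n). The composition rule is then the
   identity (a' z^alpha')^theta = a'^theta z^(theta alpha') of principal branches,
   valid because arg (a' z^alpha') stays in ]-pi/2, pi/2[.
   Since f is flat at 0, |f(y)| <= C y^n exp(eps y) for every n, which makes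
   (L f)(a z^alpha) decay faster than any power of z on every half-plane
   Re z >= sigma > 0. Hence Q f is given by a Bromwich integral on any line
   Re z = sigma, it can be differentiated under the integral sign, it is
   O(exp(sigma x)) for every sigma > 0, and it vanishes for x <= 0, as one sees by
   letting sigma tend to infinity; this gives membership in P and continuity.
   No complex analysis is needed to move the line: the sigma-derivative of the
   integral of an analytic function over Re z = sigma is the integral of a
   t-derivative. The identity L (Q f) (w) = w^theta (L f)(a w^alpha) is Fourier
   inversion on the line Re z = Re w, obtained by Abel summation. *)

(** * Complex exponential, argument and principal powers *)

(** The condition Re theta > -1 concerns the imaginary axis alone, where |z|^(Re theta) must be
    integrable at 0; on a line Re z = sigma > 0 every theta is treated alike. Hence [Qtilde] is
    identified, for all theta, with the Bromwich integral [Hop] on Re z = 1, and the rest of the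
    proof deals with [Hop]. Admissibility keeps the argument of a z^alpha in a compact part of
    ]-pi/2, pi/2[ for Re z >= 0, so that Re (a z^alpha) >= k |z|^alpha. The resulting decay exp (- k
    |z|^alpha y) degenerates as y tends to 0, which is why the flatness of f matters. For the
    inversion, the Cauchy kernel 1 / (z - w) is singular on the line through w. It is replaced by 1
    / (d - i s) and 1 / (d + i s) with d > 0, whose sum 2 d / (d^2 + s^2) is a Poisson kernel: one
    term gives the Laplace transform of Q f at w + d, the other gives 0 because Q f vanishes on the
    negative axis. Then d tends to 0. Complex integrals and derivatives are handled through real and
    imaginary parts, at the price of harmless factors 2. *)

Section ComplexNumbers.
Variable R : realType.
Implicit Types (z w s a : R[i]) (x y t alpha : R).

Lemma ReD z w : Re (z + w) = Re z + Re w. Proof. by case: z w => [a b] [c d]. Qed.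
Lemma ImD z w : Im (z + w) = Im z + Im w. Proof. by case: z w => [a b] [c d]. Qed.
Lemma ReN z : Re (- z) = - Re z. Proof. by case: z. Qed.
Lemma ImN z : Im (- z) = - Im z. Proof. by case: z. Qed.
Lemma ReM z w : Re (z * w) = Re z * Re w - Im z * Im w.
Proof. by case: z w => [a b] [c d]. Qed.
Lemma ImM z w : Im (z * w) = Re z * Im w + Im z * Re w.
Proof. by case: z w => [a b] [c d]. Qed.
Lemma ReC x : Re x%:C = x. Proof. by []. Qed.
Lemma ImC x : Im x%:C = 0. Proof. by []. Qed.
Lemma Rei : Re ('i : R[i]) = 0. Proof. by []. Qed.
Lemma Imi : Im ('i : R[i]) = 1. Proof. by []. Qed.

Lemma ReX x y : Re (x +i* y) = x. Proof. by []. Qed.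
Lemma ImX x y : Im (x +i* y) = y. Proof. by []. Qed.

Definition reimE := (ReX, ImX, ReD, ImD, ReN, ImN, ReM, ImM, ReC, ImC, Rei, Imi).

Lemma complex_eq z w : Re z = Re w -> Im z = Im w -> z = w.
Proof. by case: z w => [a b] [c d] /= -> ->. Qed.

Lemma cmodE z : cmod z = Num.sqrt (Re z ^+ 2 + Im z ^+ 2).
Proof. by case: z. Qed.

Lemma sqr_cmod z : cmod z ^+ 2 = Re z ^+ 2 + Im z ^+ 2.
Proof. by rewrite cmodE sqr_sqrtr// addr_ge0 ?sqr_ge0. Qed.

Lemma cmod_ge0 z : 0 <= cmod z. Proof. by rewrite cmodE sqrtr_ge0. Qed.

Lemma cmodM z w : cmod (z * w) = cmod z * cmod w.
Proof. exact: ComplexField.Normc.normcM. Qed.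

Lemma cmod_eq0 z : (cmod z == 0) = (z == 0).
Proof.
apply/eqP/eqP => [/ComplexField.Normc.eq0_normc//|->].
by rewrite /cmod ComplexField.Normc.normc0.
Qed.

Lemma cmod_gt0 z : (0 < cmod z) = (z != 0).
Proof. by rewrite lt_neqAle cmod_ge0 andbT eq_sym cmod_eq0. Qed.

Lemma cmodD z w : cmod (z + w) <= cmod z + cmod w.
Proof. exact: le_normcD. Qed.

Lemma cmodC x : cmod x%:C = `|x|.
Proof. by rewrite cmodE ReC ImC expr0n addr0 sqrtr_sqr. Qed.

Lemma norm_cmod z : `|z| = (cmod z)%:C. Proof. by []. Qed.

Lemma cmodN z : cmod (- z) = cmod z.
Proof. by rewrite !cmodE ReN ImN !sqrrN. Qed.

Lemma Re_le_cmod z : `|Re z| <= cmod z.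
Proof. by rewrite cmodE -sqrtr_sqr ler_sqrt ?lerDl ?sqr_ge0// addr_ge0 ?sqr_ge0. Qed.

Lemma Im_le_cmod z : `|Im z| <= cmod z.
Proof. by rewrite cmodE -sqrtr_sqr ler_sqrt ?lerDr ?sqr_ge0// addr_ge0 ?sqr_ge0. Qed.

Lemma cmod_le_ReIm z : cmod z <= `|Re z| + `|Im z|.
Proof.
rewrite -(@ler_pXn2r _ 2)// ?nnegrE ?cmod_ge0 ?addr_ge0// sqr_cmod.
rewrite -(real_normK (num_real (Re z))) -(real_normK (num_real (Im z))) sqrrD.
by rewrite lerD2r lerDl mulrn_wge0// mulr_ge0.
Qed.

Lemma cexpD z w : cexp (z + w) = cexp z * cexp w.
Proof.
rewrite /cexp ReD ImD expRD cosD sinD.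
by apply: complex_eq; rewrite !reimE; ring.
Qed.

Lemma cexp0 : cexp (0 : R[i]) = 1.
Proof. by rewrite /cexp/= expR0 cos0 sin0 mul1r. Qed.

Lemma cmod_cexp z : cmod (cexp z) = expR (Re z).
Proof.
rewrite /cexp cmodM cmodC gtr0_norm ?expR_gt0// cmodE/=.
by rewrite cos2Dsin2 sqrtr1 mulr1.
Qed.

Lemma Re_cexp z : Re (cexp z) = expR (Re z) * cos (Im z).
Proof. by rewrite /cexp !reimE mul0r subr0. Qed.

Lemma Im_cexp z : Im (cexp z) = expR (Re z) * sin (Im z).
Proof. by rewrite /cexp !reimE mul0r addr0. Qed.

Lemma cexp_neq0 z : cexp z != 0.
Proof. by rewrite -cmod_gt0 cmod_cexp expR_gt0. Qed.

Definition clog z : R[i] := ln (cmod z) +i* carg z.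

Lemma cpowE z s : cpow z s = cexp (s * clog z). Proof. by []. Qed.

Lemma Re_div_cmod z : z != 0 -> -1 <= Re z / cmod z <= 1.
Proof.
rewrite -cmod_gt0 => z0; rewrite -ler_norml normrM normfV (gtr0_norm z0).
by rewrite ler_pdivrMr// mul1r Re_le_cmod.
Qed.

Lemma sin_acos_Re z : z != 0 -> sin (acos (Re z / cmod z)) = `|Im z| / cmod z.
Proof.
move=> z0; rewrite sin_acos ?Re_div_cmod//.
have m0 : 0 < cmod z by rewrite cmod_gt0.
rewrite [X in Num.sqrt X](_ : _ = (Im z / cmod z) ^+ 2).
  by rewrite sqrtr_sqr normrM normfV (gtr0_norm m0).
have m2 : cmod z ^+ 2 != 0 by rewrite sqrf_eq0 gt_eqF.
by rewrite !expr_div_n -{1}(divff m2) -mulrBl {1}sqr_cmod addrC addKr.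
Qed.

Lemma cexp_clog z : z != 0 -> cexp (clog z) = z.
Proof.
move=> z0; have m0 : 0 < cmod z by rewrite cmod_gt0.
have zc := Re_div_cmod z0.
rewrite /cexp/= lnK//; apply: complex_eq; rewrite !reimE /carg mul0r ?subr0 ?addr0.
  by case: ifP => _; rewrite ?cosN acosK// mulrC mulfVK// gt_eqF.
case: ifPn => iz.
  by rewrite sin_acos_Re// ger0_norm// mulrC mulfVK// gt_eqF.
have {}iz : Im z < 0 by rewrite ltNge.
by rewrite sinN sin_acos_Re// ltr0_norm// mulNr opprK mulrC mulfVK// gt_eqF.
Qed.

(** The bound is strict: the value -pi would force Im z = 0, which belongs to the other branch of
    [carg]. *)
Lemma carg_gtNpi z : z != 0 -> - pi < carg z.
Proof.
move=> z0; have m0 : 0 < cmod z by rewrite cmod_gt0.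
have zc := Re_div_cmod z0.
rewrite /carg; case: ifPn => [_|iz].
  by rewrite (lt_le_trans _ (acos_ge0 zc))// oppr_lt0 pi_gt0.
rewrite ltrN2; apply: acos_ltpi; have /andP[zc1 ->] := zc.
rewrite andbT lt_neqAle zc1 andbT eq_sym; apply/eqP => E.
have := sin_acos_Re z0; rewrite E acosN1 sinpi => /esym/eqP.
rewrite mulf_eq0 invr_eq0 (gt_eqF m0) orbF normr_eq0 => /eqP iz0.
by rewrite iz0 lexx in iz.
Qed.

Lemma carg_le_pi z : z != 0 -> carg z <= pi.
Proof.
move=> z0; have zc := Re_div_cmod z0; rewrite /carg; case: ifPn => _.
  exact: acos_lepi.
by rewrite (le_trans _ (pi_ge0 _))// oppr_le0 acos_ge0.
Qed.

Lemma norm_carg_le z : z != 0 -> `|carg z| <= pi.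
Proof. by move=> z0; rewrite ler_norml carg_le_pi// ltW// carg_gtNpi. Qed.

Lemma clog_cexp s : - pi < Im s <= pi -> clog (cexp s) = s.
Proof.
move=> /andP[s1 s2]; rewrite /clog cmod_cexp expRK.
apply: complex_eq => //=; rewrite /carg cmod_cexp Re_cexp Im_cexp.
rewrite [X in acos X]mulrAC divff ?gt_eqF ?expR_gt0// mul1r.
rewrite pmulr_rge0 ?expR_gt0//; have [s0|s0] := leP 0 (Im s).
  by rewrite sin_ge0_pi ?s0// cosK// in_itv/= s0.
have : 0 < sin (- Im s) by rewrite sin_gt0_pi// oppr_gt0 s0 ltrNl.
rewrite sinN oppr_gt0 => /lt_geF ->.
by rewrite cosKN ?opprK// (ltW s1) ltW.
Qed.

Lemma carg_bound z : z != 0 -> 0 <= Re z -> - (pi / 2) <= carg z <= pi / 2.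
Proof.
move=> z0 rz; have m0 : 0 < cmod z by rewrite cmod_gt0.
have zc := Re_div_cmod z0.
have h : acos (Re z / cmod z) <= pi / 2.
  rewrite leNgt; apply/negP => h.
  have := h; rewrite -ltr_cos ?in_itv/= ?acos_ge0 ?acos_lepi//; last first.
    by rewrite divr_ge0 ?pi_ge0//= ler_pdivrMr// ler_peMr ?pi_ge0// ler1n.
  rewrite acosK// cos_pihalf ltNge.
  by rewrite divr_ge0// ltW.
have pi0 := pi_ge0 R; have a0 := acos_ge0 zc.
by rewrite /carg; case: ifPn => _; lra.
Qed.

Lemma cexp_carg z : z != 0 ->
  cos (carg z) = Re z / cmod z /\ sin (carg z) = Im z / cmod z.
Proof.
move=> z0; have m0 : cmod z != 0 by rewrite cmod_eq0.
have E := cexp_clog z0; split.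
  rewrite -[in RHS]E cmod_cexp Re_cexp/= lnK ?posrE ?cmod_gt0//.
  by rewrite mulrC mulKf// mulrC.
rewrite -[in RHS]E cmod_cexp Im_cexp/= lnK ?posrE ?cmod_gt0//.
by rewrite mulrAC mulfV// mul1r.
Qed.

(** On the open right half-plane the argument thus has a formula that can be differentiated in both
    coordinates. *)
Lemma carg_atan z : 0 < Re z -> carg z = atan (Im z / Re z).
Proof.
move=> rz; have z0 : z != 0 by apply: contraTneq rz => ->; rewrite ltxx.
have /andP[b1 b2] := carg_bound z0 (ltW rz).
have m0 : 0 < cmod z by rewrite cmod_gt0.
have [c s] := cexp_carg z0.
have cp : 0 < cos (carg z) by rewrite c divr_gt0.
have n1 : carg z != pi / 2 by apply: contraTneq cp => ->; rewrite cos_pihalf ltxx.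
have n2 : carg z != - (pi / 2).
  by apply: contraTneq cp => ->; rewrite cosN cos_pihalf ltxx.
have <- : tan (carg z) = Im z / Re z.
  by rewrite /tan c s invf_div mulrA mulfVK// gt_eqF.
by rewrite tanK// in_itv/= !lt_neqAle b1 b2 n1 eq_sym n2.
Qed.

Lemma cmod_cpow z s : cmod (cpow z s) = expR (Re s * ln (cmod z) - Im s * carg z).
Proof. by rewrite cpowE cmod_cexp ReM. Qed.

Lemma cmod_cpow_le z s : z != 0 ->
  cmod (cpow z s) <= expR (`|Im s| * pi) * cmod z `^ Re s.
Proof.
move=> z0; rewrite cmod_cpow /powR cmod_eq0 (negbTE z0) -expRD ler_expR.
rewrite addrC lerD2r (le_trans (ler_norm _))// normrN normrM.
by rewrite ler_wpM2l// norm_carg_le.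
Qed.

Lemma cpowD z s w : cpow z (s + w) = cpow z s * cpow z w.
Proof. by rewrite !cpowE mulrDl cexpD. Qed.

Lemma cpow_neq0 z s : cpow z s != 0. Proof. exact: cexp_neq0. Qed.

Lemma cpow1 z : z != 0 -> cpow z 1 = z.
Proof. by move=> z0; rewrite cpowE mul1r cexp_clog. Qed.

Lemma cpowB1 z s : z != 0 -> cpow z (s - 1) = cpow z s / z.
Proof.
move=> z0; apply: (mulIf z0); rewrite divfK// -{2}(cpow1 z0) -cpowD.
by rewrite subrK.
Qed.

(** Cosine increases up to 0 and decreases after it, so on a segment inside ]-pi/2, pi/2[ its least
    value is at an end. *)
Lemma cos_ge_min (u v x : R) : - (pi / 2) < u -> v < pi / 2 -> u <= x <= v ->
  Num.min (cos u) (cos v) <= cos x.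
Proof.
move=> u1 v1 /andP[ux xv]; have pi0 := pi_ge0 R; rewrite ge_min.
have mono (p q : R) : 0 <= p -> p <= q -> q <= pi -> cos q <= cos p.
  move=> p0 pq qpi; rewrite le_eqVlt; move: pq; rewrite le_eqVlt.
  case/orP => [/eqP ->|pq]; first by rewrite eqxx.
  by apply/orP; right; rewrite ltr_cos// in_itv/=; apply/andP; split; lra.
have [x0|x0] := leP 0 x; apply/orP; [right|left].
  by apply: mono; lra.
by rewrite -(cosN u) -(cosN x); apply: mono; lra.
Qed.

Lemma admissible_carg alpha a z : admissible alpha a -> z != 0 -> 0 <= Re z ->
  carg a - alpha * pi / 2 <= carg a + alpha * carg z <= carg a + alpha * pi / 2.
Proof.
move=> [/andP[al0 al1] _ _ _] z0 rz; have /andP[b1 b2] := carg_bound z0 rz.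
rewrite !lerD2l -!mulrA -mulrN.
by rewrite !ler_wpM2l// ltW.
Qed.

Lemma admissible_argD alpha a z : admissible alpha a -> z != 0 -> 0 <= Re z ->
  - (pi / 2) < carg a + alpha * carg z < pi / 2.
Proof.
move=> adm z0 rz; have /andP[b1 b2] := admissible_carg adm z0 rz.
have [_ _ h1 h2] := adm.
by rewrite (le_lt_trans b2 h1) (lt_le_trans h2 b1).
Qed.

Lemma mul_cpow_cexp alpha a z : a != 0 ->
  a * cpow z alpha%:C = cexp (clog a + alpha%:C * clog z).
Proof. by move=> a0; rewrite cexpD cexp_clog. Qed.

(** No multiple of 2 i pi appears because the sum of the arguments stays in ]-pi/2, pi/2[. This is
    what lets principal powers split in the composition rule. *)
Lemma clog_mul_cpow alpha a z : admissible alpha a -> z != 0 -> 0 <= Re z ->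
  clog (a * cpow z alpha%:C) = clog a + alpha%:C * clog z.
Proof.
move=> adm z0 rz; have /andP[b1 b2] := admissible_argD adm z0 rz.
have [_ a0 _ _] := adm; rewrite mul_cpow_cexp// clog_cexp// !reimE.
have pi0 := pi_ge0 R; rewrite mul0r addr0.
by apply/andP; split; lra.
Qed.

(** The argument of a z^alpha runs through a fixed compact segment of ]-pi/2, pi/2[, where the
    cosine has a positive minimum. The decay of the kernel in [z] comes from this [k]. *)
Lemma admissible_sector alpha a : admissible alpha a ->
  exists2 k : R, 0 < k & forall z, z != 0 -> 0 <= Re z ->
    k * cmod z `^ alpha <= Re (a * cpow z alpha%:C).
Proof.
move=> adm; have [/andP[al0 al1] a0 h1 h2] := adm; have pi0 := pi_gt0 R.
have al2 : 0 < alpha * pi by rewrite mulr_gt0.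
have ca x : - (pi / 2) < x < pi / 2 -> 0 < cos x by exact: cos_gt0_pihalf.
exists (cmod a * Num.min (cos (carg a - alpha * pi / 2))
                         (cos (carg a + alpha * pi / 2))).
  rewrite mulr_gt0 ?cmod_gt0// lt_min; apply/andP; split; apply: ca; apply/andP.
  - by split; lra.
  - by split; lra.
move=> z z0 rz; rewrite mul_cpow_cexp// Re_cexp.
rewrite !reimE !mul0r !subr0 !addr0 expRD lnK ?posrE ?cmod_gt0//.
rewrite -[X in _ <= _ * X * _](_ : cmod z `^ alpha = _).
  rewrite mulrAC ler_wpM2l ?mulr_ge0 ?cmod_ge0 ?powR_ge0//.
  by apply: cos_ge_min => //; exact: admissible_carg.
by rewrite /powR cmod_eq0 (negbTE z0).
Qed.

(** Here arg (a a'^alpha) = arg a + alpha arg a'. Multiplying the inequalities on [a'] by alpha and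
    adding those on [a] gives the inequalities for alpha alpha'. *)
Lemma admissible_comp alpha a alpha' a' :
  admissible alpha a -> admissible alpha' a' ->
  admissible (alpha * alpha') (a * cpow a' alpha%:C).
Proof.
move=> adm adm'; have [/andP[al0 al1] a0 h1 h2] := adm.
have [/andP[al'0 al'1] a'0 h1' h2'] := adm'; have pi0 := pi_gt0 R.
have E : carg (a * cpow a' alpha%:C) = carg a + alpha * carg a'.
  rewrite (_ : carg _ = Im (clog (a * cpow a' alpha%:C)))//.
  rewrite mul_cpow_cexp// clog_cexp !reimE mul0r addr0//.
  have p1 : 0 < alpha * (pi / 2 - alpha' * pi / 2 - carg a').
    by rewrite mulr_gt0//; lra.
  have p2 : 0 < alpha * (carg a' - alpha' * pi / 2 + pi / 2).
    by rewrite mulr_gt0//; lra.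
  have p3 : 0 < alpha * alpha' * pi by rewrite !mulr_gt0.
  by apply/andP; split; nra.
split.
- by rewrite mulr_gt0//= mulr_ilt1// ltW.
- by rewrite mulf_neq0// cpow_neq0.
- rewrite E; have : 0 < alpha * (pi / 2 - alpha' * pi / 2 - carg a').
    by rewrite mulr_gt0//; lra.
  by nra.
- rewrite E; have : 0 < alpha * (carg a' - alpha' * pi / 2 + pi / 2).
    by rewrite mulr_gt0//; lra.
  by nra.
Qed.

End ComplexNumbers.

(** * Measurability and integration of complex-valued functions *)

Section ComplexMeasurability.
Context {R : realType} d (T : measurableType d).
Implicit Types (f g : T -> R[i]) (h : T -> R).

Definition cmeas f : Prop :=
  measurable_fun setT (fun t => Re (f t)) /\ measurable_fun setT (fun t => Im (f t)).

Lemma cmeas_cst (c : R[i]) : cmeas (fun=> c).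
Proof. by split; exact: measurable_cst. Qed.

Lemma cmeas_real h : measurable_fun setT h -> cmeas (fun t => (h t)%:C).
Proof. by split => //; exact: measurable_cst. Qed.

Lemma cmeasN f : cmeas f -> cmeas (fun t => - f t).
Proof.
move=> [f1 f2]; split.
  by under eq_fun do rewrite ReN; exact: measurableT_comp.
by under eq_fun do rewrite ImN; exact: measurableT_comp.
Qed.

Lemma cmeasM f g : cmeas f -> cmeas g -> cmeas (fun t => f t * g t).
Proof.
move=> [f1 f2] [g1 g2]; split.
  under eq_fun do rewrite ReM.
  by apply: measurable_funB; exact: measurable_funM.
under eq_fun do rewrite ImM.
by apply: measurable_funD; exact: measurable_funM.
Qed.

Lemma cmeas_cexp f : cmeas f -> cmeas (fun t => cexp (f t)).
Proof.
move=> [f1 f2].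
have m1 : measurable_fun setT (fun t => expR (Re (f t))).
  by apply: measurableT_comp => //; exact: measurable_expR.
split.
  under eq_fun do rewrite Re_cexp.
  apply: measurable_funM => //; apply: measurableT_comp => //.
  by apply: continuous_measurable_fun; exact: continuous_cos.
under eq_fun do rewrite Im_cexp.
apply: measurable_funM => //; apply: measurableT_comp => //.
by apply: continuous_measurable_fun; exact: continuous_sin.
Qed.

End ComplexMeasurability.

Lemma cmeas_comp {R : realType} d d' (T : measurableType d) (T' : measurableType d')
    (f : T -> R[i]) (h : T' -> T) :
  cmeas f -> measurable_fun setT h -> cmeas (fun t => f (h t)).
Proof. move=> [f1 f2] mh; split.
  exact: (measurableT_comp f1 mh).
exact: (measurableT_comp f2 mh). Qed.

Section RealIntegrals.
Variable R : realType.
Local Notation mu := (@lebesgue_measure R).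
Implicit Types (f g : R -> R).

Definition rintegrable f := mu.-integrable setT (EFin \o f).

Lemma le_rintegrable f g : measurable_fun setT f -> rintegrable g ->
  (forall t, `|f t| <= g t) -> rintegrable f.
Proof.
move=> mf ig fg; apply: (le_integrable measurableT _ _ ig).
  exact/measurable_EFinP.
move=> t _ /=; rewrite lee_fin (le_trans (fg t))//.
by rewrite ler_norm.
Qed.

Lemma rintegrable_meas f : rintegrable f -> measurable_fun setT f.
Proof. by move=> /(measurable_int mu)/measurable_EFinP. Qed.

Lemma rintegrableZl (k : R) f : rintegrable f -> rintegrable (fun t => k * f t).
Proof. exact: integrableZl. Qed.

Lemma rintegrableD f g : rintegrable f -> rintegrable g ->
  rintegrable (fun t => f t + g t).
Proof. exact: integrableD. Qed.

Lemma rintegrableB f g : rintegrable f -> rintegrable g ->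
  rintegrable (fun t => f t - g t).
Proof. exact: integrableB. Qed.

(** Tonelli's theorem with a majorant in separated variables, the form in which the double integrals
    of the proof are dominated. *)
Lemma rintegrable_pair (F : R -> R -> R) g1 g2 :
  measurable_fun setT (fun p : R * R => F p.1 p.2) ->
  rintegrable g1 -> rintegrable g2 ->
  (forall t y, `|F t y| <= g1 t * g2 y) ->
  (mu \x mu)%E.-integrable setT (fun p : R * R => (F p.1 p.2)%:E).
Proof.
move=> mF ig1 ig2 FG.
apply/integrable12ltyP; first exact/measurable_EFinP.
have mg1 := rintegrable_meas ig1; have mg2 := rintegrable_meas ig2.
have ia1 : mu.-integrable setT (fun t => `|(g1 t)%:E|)%E by exact: integrable_abse.
have ia2 : mu.-integrable setT (fun t => `|(g2 t)%:E|)%E by exact: integrable_abse.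
set M := (\int[mu]_y `|(g2 y)%:E|)%E.
have Mfin : M \is a fin_num by exact: integrable_fin_num.
apply: (@le_lt_trans _ _ (\int[mu]_x (M * `|(g1 x)%:E|))%E).
  apply: ge0_le_integral => //.
  - by move=> x _; exact: integral_ge0.
  - apply: (@measurable_fun_fubini_tonelli_F _ _ _ _ _ mu
      (fun p : R * R => `|(F p.1 p.2)%:E|)%E) => //.
    by apply: measurableT_comp => //; exact/measurable_EFinP.
  - apply: emeasurable_funM; first exact: measurable_cst.
    by apply: measurableT_comp => //; exact/measurable_EFinP.
  - move=> x _.
    rewrite muleC -ge0_integralZl//; last first.
      by apply: measurableT_comp => //; exact/measurable_EFinP.
    apply: ge0_le_integral => //.
    + apply: measurableT_comp => //; apply/measurable_EFinP.
      exact: (measurableT_comp mF (pair1_measurable x)).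
    + by apply: emeasurable_funM; [exact: measurable_cst|
        apply: measurableT_comp => //; exact/measurable_EFinP].
    + move=> y _; rewrite /= -EFinM lee_fin (le_trans (FG x y))//.
      by rewrite -normrM ler_norm.
rewrite ge0_integralZl//; last 2 first.
- by apply: measurableT_comp => //; exact/measurable_EFinP.
- exact: integral_ge0.
apply: lte_mul_pinfty => //; first exact: integral_ge0.
by rewrite -ge0_fin_numE ?integral_ge0//; exact: integrable_fin_num.
Qed.

Lemma rintegral_exchange (F : R -> R -> R) g1 g2 :
  measurable_fun setT (fun p : R * R => F p.1 p.2) ->
  rintegrable g1 -> rintegrable g2 ->
  (forall t y, `|F t y| <= g1 t * g2 y) ->
  rintegrable (fun t => \int[mu]_y F t y) /\
  \int[mu]_t (\int[mu]_y F t y) = \int[mu]_y (\int[mu]_t F t y).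
Proof.
move=> mF ig1 ig2 FG.
have iF := rintegrable_pair mF ig1 ig2 FG.
have mF1 t : measurable_fun setT (F t).
  exact: (measurableT_comp mF (pair1_measurable t)).
have mF2 y : measurable_fun setT (F ^~ y).
  exact: (measurableT_comp mF (pair2_measurable y)).
have iF1 t : rintegrable (F t).
  by apply: (@le_rintegrable _ (fun y => g1 t * g2 y)) => //; exact: rintegrableZl.
have iF2 y : rintegrable (F ^~ y).
  apply: (@le_rintegrable _ (fun t => g2 y * g1 t)) => //; first exact: rintegrableZl.
  by move=> t; rewrite mulrC.
have E1 t : (\int[mu]_y F t y)%:E = (\int[mu]_y (F t y)%:E)%E.
  by rewrite /Rintegral fineK//; exact: (integrable_fin_num _ (iF1 t)).
have E2 y : (\int[mu]_t F t y)%:E = (\int[mu]_t (F t y)%:E)%E.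
  by rewrite /Rintegral fineK//; exact: (integrable_fin_num _ (iF2 y)).
split.
  rewrite /rintegrable (_ : EFin \o _ =
    fubini_F mu (fun p : R * R => (F p.1 p.2)%:E)); last exact/funext.
  exact: integrable_fubini_F.
rewrite /Rintegral; congr fine.
under eq_integral do rewrite E1.
under [RHS]eq_integral do rewrite E2.
exact: (Fubini iF).
Qed.

End RealIntegrals.

Section ComplexIntegrals.
Variable R : realType.
Local Notation mu := (@lebesgue_measure R).
Implicit Types (f g : R -> R[i]) (h : R -> R) (c : R[i]).

Lemma cintegrable_le f h : cmeas f -> rintegrable h ->
  (forall t, cmod (f t) <= h t) -> cintegrable setT f.
Proof.
move=> [m1 m2] ih fh; split; apply: (le_rintegrable _ ih) => // t.
  exact: le_trans (Re_le_cmod _) (fh t).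
exact: le_trans (Im_le_cmod _) (fh t).
Qed.

Lemma cintegrable_cmeas f : cintegrable setT f -> cmeas f.
Proof. by move=> [/rintegrable_meas ? /rintegrable_meas]. Qed.

Lemma cintegrableD f g : cintegrable setT f -> cintegrable setT g ->
  cintegrable setT (fun t => f t + g t).
Proof.
move=> [f1 f2] [g1 g2]; split.
  by under eq_fun do rewrite ReD; exact: rintegrableD.
by under eq_fun do rewrite ImD; exact: rintegrableD.
Qed.

Lemma cintegrableZ c f : cintegrable setT f -> cintegrable setT (fun t => c * f t).
Proof.
move=> [f1 f2]; split.
  by under eq_fun do rewrite ReM; apply: rintegrableB; exact: rintegrableZl.
by under eq_fun do rewrite ImM; apply: rintegrableD; exact: rintegrableZl.
Qed.

Lemma eq_cintegral D f g : (forall t, D t -> f t = g t) ->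
  cintegral D f = cintegral D g.
Proof.
move=> fg; rewrite /cintegral; congr (_ +i* _);
  by apply: eq_Rintegral => t /set_mem Dt; rewrite fg.
Qed.

Lemma cintegralD f g : cintegrable setT f -> cintegrable setT g ->
  cintegral setT (fun t => f t + g t) = cintegral setT f + cintegral setT g.
Proof.
move=> [f1 f2] [g1 g2]; apply: complex_eq; rewrite !reimE -RintegralD//.
  by apply: eq_Rintegral => t _; rewrite ReD.
by apply: eq_Rintegral => t _; rewrite ImD.
Qed.

Lemma cintegral0 : cintegral setT (fun=> 0 : R[i]) = 0.
Proof. by apply: complex_eq; rewrite /= Rintegral_cst// mul0r. Qed.

Lemma cintegralZ c f : cintegrable setT f ->
  cintegral setT (fun t => c * f t) = c * cintegral setT f.
Proof.
move=> [f1 f2]; apply: complex_eq; rewrite !reimE.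
  rewrite -!RintegralZl// -RintegralB//; try exact: rintegrableZl.
  by apply: eq_Rintegral => t _; rewrite ReM.
rewrite -!RintegralZl// -RintegralD//; try exact: rintegrableZl.
by apply: eq_Rintegral => t _; rewrite ImM.
Qed.

Lemma cintegralB f g : cintegrable setT f -> cintegrable setT g ->
  cintegral setT (fun t => f t - g t) = cintegral setT f - cintegral setT g.
Proof.
move=> fi gi; rewrite -mulN1r -cintegralZ// -cintegralD//.
  by apply: eq_cintegral => t _; rewrite mulN1r.
exact: cintegrableZ.
Qed.

(** The factor 2 comes from bounding the real and imaginary parts separately. *)
Lemma cmod_cintegral_le f h : cmeas f -> rintegrable h ->
  (forall t, cmod (f t) <= h t) ->
  cmod (cintegral setT f) <= 2 * \int[mu]_t h t.
Proof.
move=> mf ih fh; have [f1 f2] := cintegrable_le mf ih fh.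
rewrite (le_trans (cmod_le_ReIm _))// mulr_natl mulr2n lerD//=.
  rewrite (le_trans (le_normr_Rintegral _ f1))//.
  apply: le_Rintegral => //; first exact: (integrable_norm f1).
  by move=> t _; exact: le_trans (Re_le_cmod _) (fh t).
rewrite (le_trans (le_normr_Rintegral _ f2))//.
apply: le_Rintegral => //; first exact: (integrable_norm f2).
by move=> t _; exact: le_trans (Im_le_cmod _) (fh t).
Qed.

Lemma cintegral_exchange (F : R -> R -> R[i]) (g1 g2 : R -> R) :
  cmeas (fun p : R * R => F p.1 p.2) ->
  rintegrable g1 -> rintegrable g2 ->
  (forall t y, cmod (F t y) <= g1 t * g2 y) ->
  cintegrable setT (fun t => cintegral setT (F t)) /\
  cintegral setT (fun t => cintegral setT (F t)) =
  cintegral setT (fun y => cintegral setT (F ^~ y)).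
Proof.
move=> [m1 m2] ig1 ig2 FG.
have [|i1 e1] := @rintegral_exchange _ (fun t y => Re (F t y)) _ _ m1 ig1 ig2.
  by move=> t y; exact: le_trans (Re_le_cmod _) (FG t y).
have [|i2 e2] := @rintegral_exchange _ (fun t y => Im (F t y)) _ _ m2 ig1 ig2.
  by move=> t y; exact: le_trans (Im_le_cmod _) (FG t y).
by split; [split|apply: complex_eq].
Qed.

Lemma rintegral_dominated (u : nat -> R -> R) (v h : R -> R) :
  (forall n, measurable_fun setT (u n)) -> rintegrable h ->
  (forall n t, `|u n t| <= h t) ->
  (forall t, u n t @[n --> \oo] --> v t) ->
  rintegrable v /\ \int[mu]_t u n t @[n --> \oo] --> \int[mu]_t v t.
Proof.
move=> mu_ ih uh uv.
have mv : measurable_fun setT v.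
  by apply: (@measurable_fun_cvg _ _ R setT u) => // t _; exact: uv.
have [||||iv _ cv] := @dominated_convergence _ _ R mu setT measurableT
  (fun n t => (u n t)%:E) (EFin \o v) (EFin \o h) _ _ _ ih.
- by move=> n; apply/measurable_EFinP; exact: mu_.
- exact/measurable_EFinP.
- by apply: aeW => t _; apply: cvg_EFin; [exact: nearW|exact: uv].
- by apply: aeW => t n _; rewrite /= lee_fin.
split=> //; apply: fine_cvg; rewrite fineK//.
exact: (integrable_fin_num _ iv).
Qed.

Lemma cintegral_dominated (u : nat -> R -> R[i]) (v : R -> R[i]) h :
  (forall n, cmeas (u n)) -> rintegrable h ->
  (forall n t, cmod (u n t) <= h t) ->
  (forall t, Re (u n t) @[n --> \oo] --> Re (v t)) ->
  (forall t, Im (u n t) @[n --> \oo] --> Im (v t)) ->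
  [/\ cintegrable setT v,
      Re (cintegral setT (u n)) @[n --> \oo] --> Re (cintegral setT v) &
      Im (cintegral setT (u n)) @[n --> \oo] --> Im (cintegral setT v)].
Proof.
move=> mu_ ih uh v1 v2.
have [||i1 c1] := rintegral_dominated (u := fun n t => Re (u n t)) _ ih _ v1.
- by move=> n; case: (mu_ n).
- by move=> n t; exact: le_trans (Re_le_cmod _) (uh n t).
have [||i2 c2] := rintegral_dominated (u := fun n t => Im (u n t)) _ ih _ v2.
- by move=> n; case: (mu_ n).
- by move=> n t; exact: le_trans (Im_le_cmod _) (uh n t).
by [].
Qed.

End ComplexIntegrals.

(** * Differentiation and the fundamental theorem on the real line *)

Section FTC.
Variable R : realType.
Local Notation mu := (@lebesgue_measure R).
Implicit Types (u v : R -> R) (a b : nat -> R) (P : pred R).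

Lemma Rintegral_FTC u v (p q : R) : p < q ->
  (forall t, p <= t <= q -> is_derive t 1 u (v t)) ->
  (forall t, p <= t <= q -> {for t, continuous v}) ->
  \int[mu]_(t in `[p, q]) v t = u q - u p.
Proof.
move=> pq du cv; rewrite /Rintegral (@continuous_FTC2 _ v u)//.
- apply: continuous_in_subspaceT => t /set_mem /=; rewrite in_itv/=.
  exact: cv.
- have cu t : p <= t <= q -> {for t, continuous u}.
    move=> /du [? _]; exact/differentiable_continuous/derivable1_diffP.
  have c1 : {within `[p, q], continuous u}.
    by apply: continuous_in_subspaceT => t /set_mem /=; rewrite in_itv/=; exact: cu.
  have /(continuous_within_itvP _ pq)[_ c2 c3] := c1.
  split=> // t; rewrite in_itv/= => /andP[/ltW pt /ltW tq].
  by have [] := du t; rewrite ?pt.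
- move=> t; rewrite in_itv/= => /andP[/ltW pt /ltW tq].
  by rewrite derive1E; have [|_ ->] := du t; rewrite ?pt.
Qed.

(** Truncation to a segment: along segments exhausting a domain it turns an improper integral into a
    limit of proper ones. *)
Let cut (p q : R) v t := if p <= t <= q then v t else 0.

Let measurable_cut (p q : R) v : (forall t, p <= t <= q -> {for t, continuous v}) ->
  measurable_fun setT (cut p q v).
Proof.
move=> cv; rewrite (_ : cut p q v = v \_ `[p, q]).
  apply/(measurable_restrictT _ _).1 => //.
  apply: subspace_continuous_measurable_fun => //.
  apply: continuous_in_subspaceT => t /set_mem /=; rewrite in_itv/=.
  exact: cv.
by apply/funext => t; rewrite /cut patchE mem_setE in_itv.
Qed.

Let Rintegral_cut p q v : \int[mu]_t (cut p q v t) = \int[mu]_(t in `[p, q]) v t.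
Proof.
rewrite [RHS]Rintegral_mkcond; apply: eq_Rintegral => t _.
by rewrite /cut patchE mem_setE in_itv.
Qed.

Let integrable_cut (p q : R) v : p < q ->
  (forall t, p <= t <= q -> {for t, continuous v}) -> rintegrable (cut p q v).
Proof.
move=> pq cv; rewrite /rintegrable (_ : EFin \o _ = (EFin \o v) \_ `[p, q]).
  apply/integrable_restrict => //; rewrite setTI.
  apply: continuous_compact_integrable; first exact: segment_compact.
  apply: continuous_in_subspaceT => t /set_mem /=; rewrite in_itv/=.
  exact: cv.
by apply/funext => t; rewrite /= /cut patchE mem_setE in_itv/=; case: ifP.
Qed.

(** Improper form: the segments [a n, b n] exhaust the set [P], off which [v] is 0, and dominated
    convergence applies to the truncations. In the applications [P] is the line or an open
    half-line. *)
Lemma rintegral_FTC P u v a b l : rintegrable v ->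
  (forall n, a n < b n) ->
  (forall n t, a n <= t <= b n -> P t) ->
  (forall t, P t -> \forall n \near \oo, a n <= t <= b n) ->
  (forall t, ~~ P t -> v t = 0) ->
  (forall t, P t -> is_derive t 1 u (v t)) ->
  (forall n t, a n <= t <= b n -> {for t, continuous v}) ->
  u (b n) - u (a n) @[n --> \oo] --> l ->
  \int[mu]_t v t = l.
Proof.
move=> iv ab abP Pab v0 du cv ul.
have [||||_] := @rintegral_dominated _ (fun n => cut (a n) (b n) v) v
  (fun t => `|v t|).
- by move=> n; apply: measurable_cut; exact: cv.
- exact: (integrable_norm iv).
- by move=> n t; rewrite /cut; case: ifP => // _; rewrite normr0.
- move=> t; apply: (cvg_near_cst (v t)); have [Pt|nPt] := boolP (P t).
    by apply: filterS (Pab _ Pt) => n; rewrite /cut => ->.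
  by apply: nearW => n; rewrite /cut v0//; case: ifP.
move=> /[dup] /cvg_lim <-// c; apply: cvg_lim => //.
rewrite (_ : (fun n => _) = (fun n => u (b n) - u (a n)))//.
apply/funext => n; rewrite Rintegral_cut; apply: Rintegral_FTC => // t abt.
  by apply: du; exact: abP abt.
exact: cv abt.
Qed.

(** Integrability itself follows from a primitive with bounded increments, by Fatou's lemma applied
    to the truncations. *)
Lemma rintegrable_FTC P u v a b (M : R) :
  (forall t, 0 <= v t) ->
  (forall n, a n < b n) ->
  (forall n t, a n <= t <= b n -> P t) ->
  (forall t, P t -> \forall n \near \oo, a n <= t <= b n) ->
  (forall t, ~~ P t -> v t = 0) ->
  (forall t, P t -> is_derive t 1 u (v t)) ->
  (forall n t, a n <= t <= b n -> {for t, continuous v}) ->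
  (forall n, u (b n) - u (a n) <= M) ->
  rintegrable v.
Proof.
move=> v_ge0 ab abP Pab v0 du cv uM.
have mc n : measurable_fun setT (cut (a n) (b n) v).
  by apply: measurable_cut; exact: cv.
have cvc t : cut (a n) (b n) v t @[n --> \oo] --> v t.
  apply: (cvg_near_cst (v t)); have [Pt|nPt] := boolP (P t).
    by apply: filterS (Pab _ Pt) => n; rewrite /cut => ->.
  by apply: nearW => n; rewrite /cut v0//; case: ifP.
have mv : measurable_fun setT v.
  by apply: (@measurable_fun_cvg _ _ R setT (fun n => cut (a n) (b n) v)).
apply/integrableP; split; first exact/measurable_EFinP.
have c0 n t : 0 <= cut (a n) (b n) v t by rewrite /cut; case: ifP.
have mce n : measurable_fun setT (fun t => (cut (a n) (b n) v t)%:E).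
  by apply/measurable_EFinP; exact: mc.
have fat := @fatou _ _ R mu setT measurableT
  (fun n t => (cut (a n) (b n) v t)%:E)
  mce (fun n t _ => ltac:(by rewrite lee_fin)).
apply: (@le_lt_trans _ _ M%:E); last exact: ltry.
apply: (le_trans (le_trans _ fat)).
  rewrite le_eqVlt; apply/orP; left; apply/eqP; apply: eq_integral => t _.
  rewrite is_cvg_limn_einfE; last first.
    by apply/cvg_ex; exists (v t)%:E; apply: cvg_EFin; [exact: nearW|exact: cvc].
  rewrite /= ger0_norm//; apply/esym/cvg_lim => //.
  by apply: cvg_EFin; [exact: nearW|exact: cvc].
rewrite limn_einf_lim; apply: lime_le; first exact: is_cvg_einfs.
apply: nearW => n; apply: (@le_trans _ _ (\int[mu]_t (cut (a n) (b n) v t)%:E)%E).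
  by apply: ereal_inf_lbound; exists n => //=.
have icut : rintegrable (cut (a n) (b n) v).
  by apply: integrable_cut => //; exact: cv.
rewrite -[leLHS]fineK; last exact: (integrable_fin_num _ icut).
rewrite lee_fin (_ : fine _ = \int[mu]_t cut (a n) (b n) v t)//.
rewrite Rintegral_cut; have -> // : \int[mu]_(t in `[a n, b n]) v t = u (b n) - u (a n).
apply: Rintegral_FTC => // t abt; last exact: cv abt.
by apply: du; exact: abP abt.
Qed.

End FTC.

Section ComplexDerivative.
Variable R : realType.
Local Notation mu := (@lebesgue_measure R).
Implicit Types (f g : R -> R[i]) (x t : R) (l m c : R[i]).

Definition cder f x l : Prop :=
  is_derive x 1 (fun t => Re (f t)) (Re l) /\ is_derive x 1 (fun t => Im (f t)) (Im l).

Lemma cder_eq f x l m : cder f x l -> l = m -> cder f x m.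
Proof. by move=> fl <-. Qed.

Lemma cder_cst c x : cder (fun=> c) x 0.
Proof. by split; exact: is_derive_cst. Qed.

Lemma cder_real (h : R -> R) x (d : R) :
  is_derive x 1 h d -> cder (fun t => (h t)%:C) x d%:C.
Proof. by move=> hd; split => //; exact: is_derive_cst. Qed.

Lemma cder_id x : cder (fun t => t%:C) x 1.
Proof. by apply: cder_real; exact: is_derive_id. Qed.

Lemma cderD f g x l m : cder f x l -> cder g x m ->
  cder (fun t => f t + g t) x (l + m).
Proof.
move=> [f1 f2] [g1 g2]; split.
  by under eq_fun do rewrite ReD; rewrite ReD; exact: is_deriveD.
by under eq_fun do rewrite ImD; rewrite ImD; exact: is_deriveD.
Qed.

Lemma cderN f x l : cder f x l -> cder (fun t => - f t) x (- l).
Proof.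
move=> [f1 f2]; split.
  by under eq_fun do rewrite ReN; rewrite ReN; exact: is_deriveN.
by under eq_fun do rewrite ImN; rewrite ImN; exact: is_deriveN.
Qed.

Lemma cderM f g x l m : cder f x l -> cder g x m ->
  cder (fun t => f t * g t) x (l * g x + f x * m).
Proof.
move=> [f1 f2] [g1 g2]; split.
  under eq_fun do rewrite ReM.
  apply: is_derive_eq; rewrite !reimE /GRing.scale/=; ring.
under eq_fun do rewrite ImM.
by apply: is_derive_eq; rewrite !reimE /GRing.scale/=; ring.
Qed.

Lemma cderMl c f x l : cder f x l -> cder (fun t => c * f t) x (c * l).
Proof.
by move=> fl; apply: cder_eq (cderM (cder_cst c x) fl) _; rewrite mul0r add0r.
Qed.

Lemma cder_cexp f x l : cder f x l -> cder (fun t => cexp (f t)) x (l * cexp (f x)).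
Proof.
move=> [f1 f2]; split.
  under eq_fun do rewrite Re_cexp.
  by apply: is_derive_eq; rewrite reimE Re_cexp Im_cexp /GRing.scale/=; ring.
under eq_fun do rewrite Im_cexp.
by apply: is_derive_eq; rewrite reimE Re_cexp Im_cexp /GRing.scale/=; ring.
Qed.

Lemma cder_near f g x l : (\near x, f x = g x) -> cder f x l -> cder g x l.
Proof.
move=> fg [f1 f2]; split.
  by apply: near_eq_is_derive f1; apply: filterS fg => y ->.
by apply: near_eq_is_derive f2; apply: filterS fg => y ->.
Qed.

Definition ccont f x : Prop :=
  {for x, continuous (fun t => Re (f t))} /\ {for x, continuous (fun t => Im (f t))}.

Lemma cder_ccont f x l : cder f x l -> ccont f x.
Proof.
by move=> [[f1 _] [f2 _]]; split;
  exact/differentiable_continuous/derivable1_diffP.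
Qed.

Lemma ccont_cmeas f : (forall x, ccont f x) -> cmeas f.
Proof.
by move=> cf; split; apply: continuous_measurable_fun => x; case: (cf x).
Qed.

Lemma cder0_cst f : (forall x, cder f x 0) -> forall x y, f x = f y.
Proof.
move=> df x y; apply: complex_eq.
  by apply: (@is_derive_0_is_cst _ (fun t => Re (f t))) => t; case: (df t).
by apply: (@is_derive_0_is_cst _ (fun t => Im (f t))) => t; case: (df t).
Qed.

Lemma cder_under_integral (F F' : R -> R -> R[i]) (h : R -> R) (a u v : R) :
  a \in `]u, v[ ->
  (forall x, x \in `]u, v[ -> cintegrable setT (F x)) ->
  (forall x t, x \in `]u, v[ -> cder (F ^~ t) x (F' x t)) ->
  rintegrable h ->
  (forall x t, x \in `]u, v[ -> cmod (F' x t) <= h t) ->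
  cder (fun x => cintegral setT (F x)) a (cintegral setT (F' a)).
Proof.
move=> auv iF dF ih F'h.
have h0 t : 0 <= h t by apply: le_trans (F'h a t auv); exact: cmod_ge0.
split.
- have E x t : x \in `]u, v[ -> partial1of2 (fun x t => Re (F x t)) x t = Re (F' x t).
    by move=> xuv; rewrite partial1of2E; have [[_ ->]] := dF x t xuv.
  rewrite (_ : Re _ = \int[mu]_t partial1of2 (fun x t => Re (F x t)) a t); last first.
    by apply: eq_Rintegral => t _; rewrite E.
  have H1 x : `]u, v[%classic x -> mu.-integrable setT (EFin \o (fun t => Re (F x t))).
    by move=> /= xuv; case: (iF x xuv).
  have H2 x t : `]u, v[%classic x -> setT t -> derivable (fun x => Re (F x t)) x 1.
    by move=> /= xuv _; have [[]] := dF x t xuv.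
  have H3 x t : `]u, v[%classic x -> setT t ->
      `|partial1of2 (fun x t => Re (F x t)) x t| <= h t.
    by move=> /= xuv _; rewrite E// (le_trans (Re_le_cmod _))// F'h.
  have d1 := derivable_under_integral measurableT auv H1 H2 h0 ih H3.
  have d2 := differentiation_under_integral measurableT auv H1 H2 h0 ih H3.
  by split=> //; rewrite -derive1E d2.
- have E x t : x \in `]u, v[ -> partial1of2 (fun x t => Im (F x t)) x t = Im (F' x t).
    by move=> xuv; rewrite partial1of2E; have [_ [_ ->]] := dF x t xuv.
  rewrite (_ : Im _ = \int[mu]_t partial1of2 (fun x t => Im (F x t)) a t); last first.
    by apply: eq_Rintegral => t _; rewrite E.
  have H1 x : `]u, v[%classic x -> mu.-integrable setT (EFin \o (fun t => Im (F x t))).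
    by move=> /= xuv; case: (iF x xuv).
  have H2 x t : `]u, v[%classic x -> setT t -> derivable (fun x => Im (F x t)) x 1.
    by move=> /= xuv _; have [_ []] := dF x t xuv.
  have H3 x t : `]u, v[%classic x -> setT t ->
      `|partial1of2 (fun x t => Im (F x t)) x t| <= h t.
    by move=> /= xuv _; rewrite E// (le_trans (Im_le_cmod _))// F'h.
  have d1 := derivable_under_integral measurableT auv H1 H2 h0 ih H3.
  have d2 := differentiation_under_integral measurableT auv H1 H2 h0 ih H3.
  by split=> //; rewrite -derive1E d2.
Qed.

Lemma near_ninfty_itv t : \forall n \near \oo, (- n.+1%:R : R) <= t <= n.+1%:R.
Proof.
near=> n; have : `|t| <= n.+1%:R.
  rewrite (@le_trans _ _ n%:R)// ?ler_nat//.
  by near: n; exact: nbhs_infty_ger.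
by rewrite ler_norml.
Unshelve. all: by end_near. Qed.

(** The increments of [f] over [- n - 1, n + 1] tend to 0. This stands in for Cauchy's theorem when
    the contour is moved. *)
Lemma cintegral_derivative_eq0 f g (h : R -> R) :
  (forall t, cder f t (g t)) -> (forall t, ccont g t) -> cintegrable setT g ->
  (forall t, cmod (f t) <= h t) ->
  h n.+1%:R @[n --> \oo] --> 0 -> h (- n.+1%:R) @[n --> \oo] --> 0 ->
  cintegral setT g = 0.
Proof.
move=> df cg [g1 g2] fh h1 h2.
have lt_nn n : - n.+1%:R < n.+1%:R :> R by rewrite gtrN.
have to0 (u : R -> R) : (forall t, `|u t| <= h t) ->
    u n.+1%:R - u (- n.+1%:R) @[n --> \oo] --> 0.
  move=> uh; rewrite -[X in _ --> X](subr0 0).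
  have aux (s : nat -> R) : h (s n) @[n --> \oo] --> 0 -> u (s n) @[n --> \oo] --> 0.
    move=> hs; apply/norm_cvg0P.
    apply: (@squeeze_cvgr _ _ _ _ (fun=> 0) (fun n => h (s n))) => //.
      by apply: nearW => n; rewrite normr_ge0 uh.
    exact: cvg_cst.
  by apply: cvgB; exact: aux.
apply: complex_eq.
  apply: (@rintegral_FTC _ predT (fun t => Re (f t)) (fun t => Re (g t))
    (fun n => - n.+1%:R) (fun n => n.+1%:R)) => //.
  - by move=> t _; exact: near_ninfty_itv.
  - by move=> t _; case: (df t).
  - by move=> n t _; case: (cg t).
  - by apply: (to0 (fun t => Re (f t))) => t; exact: le_trans (Re_le_cmod _) (fh t).
apply: (@rintegral_FTC _ predT (fun t => Im (f t)) (fun t => Im (g t))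
  (fun n => - n.+1%:R) (fun n => n.+1%:R)) => //.
- by move=> t _; exact: near_ninfty_itv.
- by move=> t _; case: (df t).
- by move=> n t _; case: (cg t).
- by apply: (to0 (fun t => Im (f t))) => t; exact: le_trans (Im_le_cmod _) (fh t).
Qed.

End ComplexDerivative.

(** * Integrable majorants *)

Section Dominators.
Variable R : realType.
Implicit Types (p q k s r t x : R).

(** exp (k x) is at least the term (k x)^n / n! of its series. *)
Lemma pow_expR_le k n x : 0 < k -> 0 <= x ->
  x ^+ n * expR (- (k * x)) <= n`!%:R / k ^+ n.
Proof.
move=> k0 x0; rewrite expRN ler_pdivrMr ?expR_gt0// mulrAC ler_pdivlMr ?exprn_gt0//.
rewrite -exprMn [x * k]mulrC; have kx0 : 0 <= k * x by rewrite mulr_ge0// ltW.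
case: n => [|n].
  by rewrite expr0 fact0 mul1r -expR0 ler_expR.
rewrite -ler_pdivrMl ?ltr0n ?fact_gt0//.
rewrite (le_trans _ (expR_ge1Dxn n kx0))// [_^-1 * _]mulrC.
by rewrite lerDr.
Qed.

Lemma powR_expR_bounded s k (alpha : R) : 0 <= s -> 0 < k -> 0 < alpha ->
  exists2 C, 0 <= C & forall r, 0 < r -> r `^ s * expR (- (k * r `^ alpha)) <= C.
Proof.
(* With alpha n >= s one has r^s <= 1 + (r^alpha)^n for every r > 0, which reduces real exponents to
   natural ones. *)
move=> s0 k0 al0; pose n := (Num.truncn (s / alpha)).+1.
exists (1 + n`!%:R / k ^+ n).
  by rewrite addr_ge0// divr_ge0// exprn_ge0// ltW.
move=> r r0; have sn : s <= alpha * n%:R.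
  rewrite mulrC -ler_pdivrMr// ltW// truncnS_gt//.
have : r `^ s <= 1 + (r `^ alpha) ^+ n.
  have [r1|r1] := leP r 1.
    rewrite (@le_trans _ _ 1)// ?lerDl ?exprn_ge0 ?powR_ge0//.
    by rewrite -(powRr0 r) ger_powR// r0.
  rewrite -powR_mulrn ?powR_ge0// -powRrM.
  apply: (@le_trans _ _ (r `^ (alpha * n%:R))); last by rewrite lerDr.
  by rewrite ler_powR// ltW.
move=> /(ler_wpM2r (expR_ge0 (- (k * r `^ alpha)))) /le_trans; apply.
rewrite mulrDl mul1r lerD//.
  by rewrite -expR0 ler_expR oppr_le0 mulr_ge0 ?powR_ge0// ltW.
by rewrite pow_expR_le// powR_ge0.
Qed.

(** A negative [p] is allowed because [r] stays away from 0: the factor r^(p - |p|) has exponent at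
    most 0 and is largest at sigma. *)
Lemma powR_expR_bounded_away p k (alpha sigma : R) :
  0 < k -> 0 < alpha -> 0 < sigma ->
  exists2 C, 0 <= C &
    forall r, sigma <= r -> r `^ p * expR (- (k * r `^ alpha)) <= C.
Proof.
move=> k0 al0 si0.
have [C C0 HC] := powR_expR_bounded (normr_ge0 p) k0 al0.
exists (sigma `^ (p - `|p|) * C); first by rewrite mulr_ge0// powR_ge0.
move=> r sr; have r0 : 0 < r by exact: lt_le_trans sr.
have -> : r `^ p = r `^ (p - `|p|) * r `^ `|p|.
  by rewrite -powRD ?subrK// (gt_eqF r0) implybT.
rewrite -mulrA.
rewrite ler_pM ?mulr_ge0 ?powR_ge0 ?expR_ge0 ?HC//.
have pp : 0 <= `|p| - p by rewrite subr_ge0 ler_norm.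
have E (a : R) : a `^ (p - `|p|) = (a `^ (`|p| - p))^-1 by rewrite -powRN opprB.
by rewrite !E lef_pV2 ?posrE ?powR_gt0// ge0_ler_powR// nnegrE ltW.
Qed.

Definition cauchy t : R := (1 + t ^+ 2)^-1.

Lemma cauchy_gt0 t : 0 < cauchy t.
Proof. by rewrite invr_gt0 ltr_pwDl// sqr_ge0. Qed.

Lemma continuous_cauchy t : {for t, continuous cauchy}.
Proof.
apply: continuousV; first by rewrite gt_eqF// ltr_pwDl// sqr_ge0.
by apply: continuousD; [exact: cst_continuous|exact: exprn_continuous].
Qed.

Lemma rintegrable_cauchy : rintegrable cauchy.
Proof.
apply: (@rintegrable_FTC _ predT atan cauchy (fun n => - n.+1%:R)
  (fun n => n.+1%:R) (pi / 2 - - (pi / 2))) => //.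
- by move=> t; rewrite ltW// cauchy_gt0.
- by move=> n; rewrite gtrN.
- by move=> t _; exact: near_ninfty_itv.
- by move=> n t _; exact: continuous_cauchy.
- by move=> n; rewrite lerB// ltW// ?atan_ltpi2// atan_gtNpi2.
Qed.

(** Since 1 + t^2 <= 1 + r^2, it suffices to bound the product for the exponents p and p + 2. *)
Lemma le_cauchy (p : R) k alpha sigma : 0 < k -> 0 < alpha -> 0 < sigma ->
  exists2 C, 0 <= C & forall r t, sigma <= r -> `|t| <= r ->
    r `^ p * expR (- (k * r `^ alpha)) <= C * cauchy t.
Proof.
move=> k0 al0 si0.
have [C C0 HC] := powR_expR_bounded_away p k0 al0 si0.
have [D D0 HD] := powR_expR_bounded_away (p + 2) k0 al0 si0.
exists (C + D); first exact: addr_ge0.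
move=> r t sr tr; have r0 : 0 < r by exact: lt_le_trans sr.
rewrite ler_pdivlMr; last by rewrite ltr_pwDl// sqr_ge0.
rewrite mulrDr mulr1 lerD ?HC//.
rewrite (le_trans _ (HD r sr))//.
have -> : r `^ (p + 2) = r `^ p * r ^+ 2.
  by rewrite powRD ?(gt_eqF r0) ?implybT// powR_mulrn// ltW.
rewrite mulrAC ler_wpM2r ?expR_ge0//.
rewrite ler_wpM2l ?powR_ge0//.
by rewrite -(real_normK (num_real t)) lerXn2r ?nnegrE ?normr_ge0// ltW.
Qed.

(** The derivative of q^-1 atan (t^q): of order t^(q - 1) at 0 and t^(- q - 1) at infinity, with a
    bounded primitive for every q > 0. *)
Definition half_density q t : R :=
  if 0 < t then t `^ (q - 1) / (1 + (t `^ q) ^+ 2) else 0.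

Definition density q t : R := half_density q t + half_density q (- t).

Lemma half_density_ge0 q t : 0 <= half_density q t.
Proof.
rewrite /half_density; case: ifP => // _.
by rewrite divr_ge0 ?powR_ge0// addr_ge0// sqr_ge0.
Qed.

Lemma densityE q t : t != 0 ->
  density q t = `|t| `^ (q - 1) / (1 + (`|t| `^ q) ^+ 2).
Proof.
move=> t0; rewrite /density /half_density oppr_gt0.
have [tp|tn|t00] := ltgtP 0 t; last by rewrite -t00 eqxx in t0.
  by rewrite addr0 gtr0_norm.
by rewrite add0r ltr0_norm.
Qed.

Let deriv_half q t : 0 < q -> 0 < t ->
  is_derive t 1 (fun t => q^-1 * atan (t `^ q)) (half_density q t).
Proof.
move=> q0 t0; rewrite /half_density t0.
have d1 := is_derive1_powR q t0.
have d2 : is_derive t 1 (atan \o (fun s : R => s `^ q))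
    ((1 + (t `^ q) ^+ 2)^-1 * (q * t `^ (q - 1))).
  exact: is_derive1_comp.
have d3 := @is_deriveZ _ _ _ _ (q^-1 : R) _ _ _ d2.
apply: is_derive_eq; rewrite /GRing.scale/=.
by rewrite mulrCA mulKf ?gt_eqF// mulrC.
Qed.

Let cont_half q t : 0 < t -> {for t, continuous (half_density q)}.
Proof.
move=> t0.
have near_pos : \forall s \near t, 0 < s by exact: lt_nbhsr.
have cp p : {for t, continuous (fun s : R => s `^ p)}.
  apply/differentiable_continuous/derivable1_diffP.
  by apply: derivable_powR; rewrite in_itv/= t0.
rewrite /prop_for /continuous_at /half_density t0.
apply: cvg_trans; last first.
  apply: (@continuousM _ _ (fun t => t `^ (q - 1)) (fun t => (1 + (t `^ q) ^+ 2)^-1) t).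
    exact: cp.
  apply: continuousV; first by rewrite gt_eqF// ltr_pwDl// sqr_ge0.
  apply: continuousD; first exact: cst_continuous.
  by apply: (@continuous_comp _ _ _ (fun s : R => s `^ q) (fun s => s ^+ 2)); [exact: cp|exact: exprn_continuous].
by apply: near_eq_cvg; apply: filterS near_pos => s /= ->.
Qed.

(** Exhausting segments of the open half-line; the right end n + 2 keeps them nondegenerate at n =
    0. *)
Lemma near_inv_itv t : 0 < t ->
  \forall n \near \oo, (n.+1%:R^-1 : R) <= t <= n.+2%:R.
Proof.
move=> t0; near=> n.
have h1 : t <= n.+2%:R.
  rewrite (@le_trans _ _ n%:R)// ?ler_nat//; last by rewrite -addn2 leq_addr.
  by near: n; exact: nbhs_infty_ger.
rewrite h1 andbT invf_ple ?posrE// (@le_trans _ _ n%:R)// ?ler_nat//.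
by near: n; exact: nbhs_infty_ger.
Unshelve. all: by end_near. Qed.

Lemma inv_lt_itv n : (n.+1%:R^-1 : R) < n.+2%:R.
Proof. by rewrite (@le_lt_trans _ _ 1)// ?invf_le1// ?ler1n// ltr1n. Qed.

Lemma rintegrable_density q : 0 < q -> rintegrable (density q).
Proof.
move=> q0; apply: rintegrableD.
  apply: (@rintegrable_FTC _ (fun t => 0 < t) (fun t => q^-1 * atan (t `^ q))
    (half_density q) (fun n => n.+1%:R^-1) (fun n => n.+2%:R)
    (q^-1 * (pi / 2) - q^-1 * (- (pi / 2)))).
  - exact: half_density_ge0.
  - exact: inv_lt_itv.
  - by move=> n t /andP[h _]; apply: lt_le_trans h; rewrite invr_gt0.
  - exact: near_inv_itv.
  - by move=> t /negbTE; rewrite /half_density => ->.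
  - by move=> t; exact: deriv_half.
  - by move=> n t /andP[h _]; apply: cont_half; apply: lt_le_trans h; rewrite invr_gt0.
  - move=> n; rewrite lerB// ler_wpM2l ?invr_ge0 ?ltW//.
      exact: atan_ltpi2.
    exact: atan_gtNpi2.
apply: (@rintegrable_FTC _ (fun t => t < 0) (fun t => - (q^-1 * atan ((- t) `^ q)))
    (fun t => half_density q (- t)) (fun n => - n.+2%:R) (fun n => - n.+1%:R^-1)
    (q^-1 * (pi / 2) - q^-1 * (- (pi / 2)))).
- by move=> t; exact: half_density_ge0.
- by move=> n; rewrite ltrN2 inv_lt_itv.
- by move=> n t /andP[_ h]; apply: le_lt_trans h _; rewrite oppr_lt0 invr_gt0.
- move=> t t0; have : 0 < - t by rewrite oppr_gt0.
  move=> /near_inv_itv; apply: filterS => n /andP[h1 h2].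
  by rewrite lerNl h2 lerNr h1.
- by move=> t; rewrite -oppr_gt0 => /negbTE; rewrite /half_density => ->.
- move=> t; rewrite -oppr_gt0 => t0.
  have d1 := deriv_half q0 t0.
  have d2 := is_derive1_comp d1 (is_deriveNid t 1).
  by have := is_deriveN d2; rewrite mulrN1 opprK.
- move=> n t /andP[_ h].
  apply: (@continuous_comp _ _ _ -%R (half_density q)); first exact: opp_continuous.
  apply: cont_half; rewrite oppr_gt0 (le_lt_trans h)//.
- move=> n; rewrite [- - (q^-1 * _)]opprK addrC lerB// ler_wpM2l ?invr_ge0 ?ltW//.
    exact: atan_ltpi2.
  exact: atan_gtNpi2.
Qed.

(* The power at the origin is kept because on the imaginary axis [r = |t|],
   where [r^p] is singular for [p < 0]. *)
Lemma le_density p k alpha : -1 < p -> 0 < k -> 0 < alpha ->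
  exists2 q, 0 < q & exists2 C, 0 <= C & forall r t, t != 0 -> `|t| <= r ->
    r `^ p * expR (- (k * r `^ alpha)) <= C * density q t.
Proof.
(* This choice gives p - (q - 1) >= 0 and q - 1 <= 0: the power r^(p - (q - 1)) is absorbed by the
   exponential, and r^(q - 1) <= |t|^(q - 1) because |t| <= r. *)
move=> p1 k0 al0; pose q := Num.min (p + 1) 1.
have q0 : 0 < q by rewrite lt_min ltr01 andbT -ltrBlDr sub0r.
have q1 : q <= 1 by rewrite ge_min lexx orbT.
have qp : 0 <= p - (q - 1) by rewrite subr_ge0 lerBlDr ge_min lexx.
exists q => //.
have [C C0 HC] := powR_expR_bounded qp k0 al0.
have [|D D0 HD] := @powR_expR_bounded (p - (q - 1) + (q * 2)) _ _ _ k0 al0.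
  by rewrite addr_ge0// mulr_ge0// ltW.
exists (C + D); first exact: addr_ge0.
move=> r t t0 tr; have tp : 0 < `|t| by rewrite normr_gt0.
have r0 : 0 < r by exact: lt_le_trans tr.
have P1 : 0 < 1 + (`|t| `^ q) ^+ 2 by rewrite ltr_pwDl// sqr_ge0.
rewrite densityE// mulrA ler_pdivlMr//.
have E (a b : R) : r `^ (a + b) = r `^ a * r `^ b.
  by rewrite powRD// (gt_eqF r0) implybT.
have -> : r `^ p = r `^ (p - (q - 1)) * r `^ (q - 1) by rewrite -E subrK.
have h1 : r `^ (q - 1) <= `|t| `^ (q - 1).
  have q1' : 0 <= 1 - q by rewrite subr_ge0.
  have F (a : R) : a `^ (q - 1) = (a `^ (1 - q))^-1 by rewrite -powRN opprB.
  by rewrite !F lef_pV2 ?posrE ?powR_gt0// ge0_ler_powR// nnegrE ltW.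
have h2 : (`|t| `^ q) ^+ 2 <= r `^ (q * 2).
  rewrite powRrM powR_mulrn ?powR_ge0// lerXn2r ?nnegrE ?powR_ge0//.
  by rewrite ge0_ler_powR// ?nnegrE ltW.
set e := expR _; have e0 : 0 <= e by exact: expR_ge0.
have h3 : r `^ (p - (q - 1)) * (1 + (`|t| `^ q) ^+ 2) * e <= C + D.
  rewrite mulrDr mulr1 mulrDl lerD ?HC// (le_trans _ (HD r r0))//.
  by rewrite [r `^ (_ + q * 2)]E ler_wpM2r// ler_wpM2l ?powR_ge0.
apply: (@le_trans _ _ ((r `^ (p - (q - 1)) * (1 + (`|t| `^ q) ^+ 2) * e) * r `^ (q - 1))).
  by rewrite le_eqVlt; apply/orP; left; apply/eqP; ring.
by rewrite ler_pM ?powR_ge0// !mulr_ge0 ?powR_ge0// ltW.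
Qed.

End Dominators.

(** * Shifting the contour of the kernel *)

Section ComplexContinuity.
Variable R : realType.
Implicit Types (f g : R -> R[i]) (x t sigma : R) (l m c : R[i]).

Lemma ccontD f g x : ccont f x -> ccont g x -> ccont (fun t => f t + g t) x.
Proof.
move=> [f1 f2] [g1 g2]; split.
  by rewrite (funext (fun t => ReD (f t) (g t))); exact: (continuousD f1 g1).
by rewrite (funext (fun t => ImD (f t) (g t))); exact: (continuousD f2 g2).
Qed.

Lemma ccontM f g x : ccont f x -> ccont g x -> ccont (fun t => f t * g t) x.
Proof.
move=> [f1 f2] [g1 g2]; split.
  rewrite (funext (fun t => ReM (f t) (g t))).
  exact: (continuousB (continuousM f1 g1) (continuousM f2 g2)).
rewrite (funext (fun t => ImM (f t) (g t))).
exact: (continuousD (continuousM f1 g2) (continuousM f2 g1)).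
Qed.

Lemma ccont_cst c x : ccont (fun=> c) x.
Proof. by split; exact: cst_continuous. Qed.

Lemma ccontN f x : ccont f x -> ccont (fun t => - f t) x.
Proof.
move=> fx; rewrite (_ : (fun t => _) = (fun t => -1 * f t)); last first.
  by apply/funext => t; rewrite mulN1r.
by apply: ccontM => //; exact: ccont_cst.
Qed.

Lemma ccont_cexp f x : ccont f x -> ccont (fun t => cexp (f t)) x.
Proof.
move=> [f1 f2].
have e1 : {for x, continuous (fun t => expR (Re (f t)))}.
  by apply: (continuous_comp f1); exact: continuous_expR.
split.
  rewrite (funext (fun t => Re_cexp (f t))); apply: (continuousM e1).
  by apply: (continuous_comp f2); exact: continuous_cos.
rewrite (funext (fun t => Im_cexp (f t))); apply: (continuousM e1).
by apply: (continuous_comp f2); exact: continuous_sin.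
Qed.

Lemma cder_comp f (h : R -> R) x l (d : R) :
  cder f (h x) l -> is_derive x 1 h d -> cder (fun t => f (h t)) x (d%:C * l).
Proof.
move=> [f1 f2] hd; split.
  have := is_derive1_comp f1 hd.
  by rewrite !reimE mul0r subr0 [d * _]mulrC.
have := is_derive1_comp f2 hd.
by rewrite !reimE mul0r addr0 [d * _]mulrC.
Qed.

(** The substitution x = exp s transports the statement to the whole line. *)
Lemma cder0_cst_pos f : (forall x, 0 < x -> cder f x 0) ->
  forall x y : R, 0 < x -> 0 < y -> f x = f y.
Proof.
move=> df x y x0 y0.
have := @cder0_cst _ (fun s => f (expR s)) _ (ln x) (ln y).
rewrite !lnK//; apply => s.
apply: cder_eq (cder_comp (df _ (expR_gt0 s)) (is_derive_expR s)) _.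
by rewrite mulr0.
Qed.

End ComplexContinuity.

Section VerticalLines.
Variable R : realType.
Implicit Types (f g : R -> R[i]) (x t sigma : R) (l m c : R[i]).

Definition vline sigma t : R[i] := sigma +i* t.

Lemma ReV (z : R[i]) : Re z^-1 = Re z / (Re z ^+ 2 + Im z ^+ 2).
Proof. by case: z. Qed.

Lemma ImV (z : R[i]) : Im z^-1 = - (Im z / (Re z ^+ 2 + Im z ^+ 2)).
Proof. by case: z. Qed.

Lemma vline_neq0 sigma t : 0 < sigma -> vline sigma t != 0.
Proof. by move=> s0; apply/eqP => /(congr1 (@complex.Re _))/= /eqP; rewrite gt_eqF. Qed.

Lemma cmod_vline_ge sigma t : 0 <= sigma -> sigma <= cmod (vline sigma t).
Proof. by move=> s0; rewrite (le_trans _ (Re_le_cmod _))//= ler_norm. Qed.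

Lemma cmod_vline_geN sigma t : `|t| <= cmod (vline sigma t).
Proof. exact: Im_le_cmod (vline sigma t). Qed.

Lemma clog_vline sigma t : 0 < sigma ->
  clog (vline sigma t) = (2^-1 * ln (sigma ^+ 2 + t ^+ 2)) +i* atan (t / sigma).
Proof.
move=> s0; rewrite /clog carg_atan//; congr (_ +i* _).
have m0 : 0 < cmod (vline sigma t) by rewrite cmod_gt0 vline_neq0.
have <- : cmod (vline sigma t) ^+ 2 = sigma ^+ 2 + t ^+ 2 by rewrite sqr_cmod.
by rewrite lnXn// -[ln _ *+ 2]mulr_natl mulKf.
Qed.

(** Together with [cder_clog_ver], these are the Cauchy-Riemann equations of the logarithm: 1 / z in
    the real direction, i / z in the imaginary one. *)
Lemma cder_clog_hor sigma t : 0 < sigma ->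
  cder (fun s => clog (vline s t)) sigma (vline sigma t)^-1.
Proof.
move=> s0.
apply: (@cder_near _ (fun s => (2^-1 * ln (s ^+ 2 + t ^+ 2)) +i* atan (t / s))).
  by apply: filterS (lt_nbhsr s0) => s /= sp; rewrite clog_vline.
have n0 : 0 < sigma ^+ 2 + t ^+ 2 by rewrite ltr_pwDl ?sqr_ge0// exprn_gt0.
split=> /=.
  have d1 := is_derive1_ln n0.
  have d2 : is_derive sigma 1 (fun s => s ^+ 2 + t ^+ 2) (2 * sigma).
    by apply: is_derive_eq; rewrite /GRing.scale/=; ring.
  have d3 := @is_derive1_comp _ (@ln R) (fun s : R => s ^+ 2 + t ^+ 2) _ _ _ d1 d2.
  have := @is_deriveZ _ _ _ _ (2^-1 : R) _ _ _ d3.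
  rewrite (_ : _ *: _ = Re (vline sigma t)^-1)//.
  rewrite ReV /GRing.scale/=; field; exact: lt0r_neq0.
have d1 : is_derive sigma 1 (fun s : R => t * s^-1) (t * (- sigma ^- 2 *: 1)).
  apply: (@is_deriveZ _ _ _ _ t _ _ _ (is_deriveV _ _)).
  exact: lt0r_neq0.
have := @is_derive1_comp _ (@atan R) (fun s : R => t / s) _ _ _ (is_derive1_atan (t / sigma)) d1.
rewrite (_ : _ * _ = Im (vline sigma t)^-1)//.
rewrite ImV /GRing.scale/=; field.
by rewrite !lt0r_neq0.
Qed.

Lemma cder_clog_ver sigma t : 0 < sigma ->
  cder (fun u => clog (vline sigma u)) t ('i / vline sigma t).
Proof.
move=> s0.
rewrite (_ : (fun u => _) =
  (fun u => (2^-1 * ln (sigma ^+ 2 + u ^+ 2)) +i* atan (u / sigma))); last first.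
  by apply/funext => u; rewrite clog_vline.
have n0 : 0 < sigma ^+ 2 + t ^+ 2 by rewrite ltr_pwDl ?sqr_ge0// exprn_gt0.
split=> /=.
  have d1 := is_derive1_ln n0.
  have d2 : is_derive t 1 (fun u => sigma ^+ 2 + u ^+ 2) (2 * t).
    by apply: is_derive_eq; rewrite /GRing.scale/=; ring.
  have d3 := @is_derive1_comp _ (@ln R) (fun u : R => sigma ^+ 2 + u ^+ 2) _ _ _ d1 d2.
  have := @is_deriveZ _ _ _ _ (2^-1 : R) _ _ _ d3.
  rewrite (_ : _ *: _ = Re ('i / vline sigma t))//.
  rewrite ReM ReV ImV Rei Imi /GRing.scale/=; field; exact: lt0r_neq0.
have d1 : is_derive t 1 (fun u : R => u * sigma^-1) (sigma^-1).
  by apply: is_derive_eq; rewrite /GRing.scale/=; ring.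
have := @is_derive1_comp _ (@atan R) (fun u : R => u / sigma) _ _ _ (is_derive1_atan (t / sigma)) d1.
rewrite (_ : _ * _ = Im ('i / vline sigma t))//.
rewrite ImM ReV ImV Rei Imi /GRing.scale/=; field.
by rewrite !lt0r_neq0.
Qed.

(** On the axis the formula atan (t / sigma) breaks down, so the definition by [acos] is used: its
    argument is 0 there, a point of continuity of [acos], and the imaginary part [t] that selects
    the branch is fixed. *)
Lemma ccont_clog_axis t : t != 0 -> ccont (fun s : R => clog (vline s t)) 0.
Proof.
move=> t0; have n0 : 0 < 0 ^+ 2 + t ^+ 2 by rewrite expr0n add0r exprn_even_gt0.
have c1 : {for (0 : R), continuous (fun s : R => s ^+ 2 + t ^+ 2)}.
  by apply: continuousD; [exact: exprn_continuous|exact: cst_continuous].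
have c2 : {for (0 : R), continuous (fun s : R => cmod (vline s t))}.
  apply: (@continuous_comp _ _ _ (fun s : R => s ^+ 2 + t ^+ 2) Num.sqrt) => //.
  exact: sqrt_continuous.
have m0 : 0 < cmod (vline 0 t) by rewrite cmodE/= sqrtr_gt0.
split.
  by apply: (continuous_comp c2); exact: continuous_ln.
have c3 : {for (0 : R), continuous (fun s : R => acos (s / cmod (vline s t)))}.
  apply: (@continuous_comp _ _ _ (fun s : R => s / cmod (vline s t)) (@acos R)).
    apply: (@continuousM _ _ id (fun s : R => (cmod (vline s t))^-1)) => //.
    by apply: continuousV => //; rewrite gt_eqF.
  by apply: continuous_acos; rewrite mul0r oppr_lt0 !ltr01.
rewrite /clog/= /carg/=; case: (0 <= t) => //.
exact: continuousN c3.
Qed.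

End VerticalLines.

Section ContourShift.
Variable R : realType.
Local Notation mu := (@lebesgue_measure R).
Variables (a : R[i]) (alpha : R).
Hypothesis adm : admissible alpha a.
Implicit Types (theta z : R[i]) (x y t sigma : R).

Lemma Nker_integrand_le (k : R) theta x y z :
  (forall z, z != 0 -> 0 <= Re z ->
    k * cmod z `^ alpha <= Re (a * cpow z alpha%:C)) ->
  0 <= y -> z != 0 -> 0 <= Re z ->
  cmod (Nker_integrand theta alpha a x y z) <=
  expR (`|Im theta| * pi) * expR (`|Re z| * `|x|) *
    (cmod z `^ Re theta * expR (- (k * y * cmod z `^ alpha))).
Proof.
move=> hk y0 z0 rz; rewrite /Nker_integrand cmodM cmod_cexp.
rewrite ReD ReN [Re (_ * y%:C)]ReM ReC ImC mulr0 subr0.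
rewrite [Re (z * _)]ReM ReC ImC mulr0 subr0 expRD.
rewrite -mulrA [X in _ <= _ * X]mulrCA [X in _ <= X]mulrA.
rewrite ler_pM ?mulr_ge0 ?cmod_ge0 ?expR_ge0//; first exact: cmod_cpow_le.
rewrite [X in _ <= X]mulrC ler_pM ?expR_ge0// ler_expR.
  by rewrite lerN2 mulrAC ler_wpM2r// hk.
by rewrite -normrM ler_norm.
Qed.

(** The majorant is uniform in the strip s0 <= sigma <= s1, as differentiation under the integral in
    sigma requires. *)
Lemma Nker_integrand_line_le theta x y (s0 s1 : R) : 0 < y -> 0 < s0 ->
  exists2 C, 0 <= C & forall sigma t, s0 <= sigma <= s1 ->
    cmod (Nker_integrand theta alpha a x y (vline sigma t)) <= C * cauchy t.
Proof.
move=> y0 s00; have [k k0 hk] := admissible_sector adm.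
have [/andP[al0 _] _ _ _] := adm.
have [C C0 HC] := le_cauchy (Re theta) (mulr_gt0 k0 y0) al0 s00.
exists (expR (`|Im theta| * pi) * expR (s1 * `|x|) * C).
  by rewrite !mulr_ge0 ?expR_ge0.
move=> sigma t /andP[s0s ss1]; have sp : 0 < sigma by exact: lt_le_trans s0s.
have ms : s0 <= cmod (vline sigma t).
  by rewrite (le_trans s0s)// cmod_vline_ge// ltW.
rewrite (le_trans (Nker_integrand_le theta x hk (ltW y0) (vline_neq0 t sp) (ltW sp)))//.
rewrite -[X in _ <= X]mulrA ler_pM ?mulr_ge0 ?expR_ge0 ?powR_ge0//.
  rewrite ler_wpM2l ?expR_ge0// ler_expR ler_wpM2r//=.
  by rewrite gtr0_norm.
by rewrite HC// cmod_vline_geN.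
Qed.

(** The complex derivative of the integrand in [z], written with shifted exponents so that its
    bounds and continuity follow from those of the integrand. *)
Definition Nker_integrand' theta x y z : R[i] :=
  theta * Nker_integrand (theta - 1) alpha a x y z
  - a * alpha%:C * y%:C * Nker_integrand (theta + (alpha%:C - 1)) alpha a x y z
  + x%:C * Nker_integrand theta alpha a x y z.

Lemma Nker_integrand'E theta x y z : z != 0 ->
  Nker_integrand' theta x y z =
  (theta / z - a * alpha%:C * y%:C * (cpow z alpha%:C / z) + x%:C) *
  Nker_integrand theta alpha a x y z.
Proof.
move=> z0; rewrite /Nker_integrand' /Nker_integrand [cpow z (_ + (_ - _))]cpowD !cpowB1//; ring.
Qed.

(** Chain rule along a path, applied to horizontal and vertical lines; their common complex
    derivative is the analyticity behind the shift. *)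
Let cder_Nker_integrand (gam : R -> R[i]) theta x y u (l : R[i]) :
  gam u != 0 ->
  cder gam u l -> cder (fun s => clog (gam s)) u (l / gam u) ->
  cder (fun s => Nker_integrand theta alpha a x y (gam s)) u
    (l * Nker_integrand' theta x y (gam u)).
Proof.
move=> g0 dg dl; rewrite /Nker_integrand.
have d1 := cder_cexp (cderMl theta dl).
have d2 := cder_cexp (cderMl alpha%:C dl).
have d3 := cder_cexp (cderD (cderN (cderM (cderMl a d2) (cder_cst y%:C u)))
  (cderM dg (cder_cst x%:C u))).
apply: cder_eq (cderM d1 d3) _.
rewrite Nker_integrand'E// /Nker_integrand -!cpowE; ring.
Qed.

Lemma cder_Nker_hor theta x y sigma t : 0 < sigma ->
  cder (fun s => Nker_integrand theta alpha a x y (vline s t)) sigma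
    (Nker_integrand' theta x y (vline sigma t)).
Proof.
move=> s0; rewrite -[Nker_integrand' _ _ _ _]mul1r.
apply: (@cder_Nker_integrand (fun s => vline s t)); first exact: vline_neq0.
  by split => /=; [exact: is_derive_id|exact: is_derive_cst].
by rewrite mul1r; exact: cder_clog_hor.
Qed.

Lemma cder_Nker_ver theta x y sigma t : 0 < sigma ->
  cder (fun u => Nker_integrand theta alpha a x y (vline sigma u)) t
    ('i * Nker_integrand' theta x y (vline sigma t)).
Proof.
move=> s0; apply: (@cder_Nker_integrand (fun u => vline sigma u)).
- exact: vline_neq0.
- by split => /=; [exact: is_derive_cst|exact: is_derive_id].
- exact: cder_clog_ver.
Qed.

Lemma ccont_Nker' theta x y sigma t : 0 < sigma ->
  ccont (fun u => Nker_integrand' theta x y (vline sigma u)) t.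
Proof.
move=> s0; have c th := cder_ccont (cder_Nker_ver th x y t s0).
apply: ccontD; last by apply: ccontM => //; exact: ccont_cst.
apply: ccontD; first by apply: ccontM => //; exact: ccont_cst.
by apply: ccontN; apply: ccontM => //; exact: ccont_cst.
Qed.

Lemma cmeas_Nker theta x y sigma : 0 < sigma ->
  cmeas (fun t => Nker_integrand theta alpha a x y (vline sigma t)).
Proof. by move=> s0; apply: ccont_cmeas => t; exact: cder_ccont (cder_Nker_ver _ _ _ _ s0). Qed.

Lemma Nker_integrand'_line_le theta x y (s0 s1 : R) : 0 < y -> 0 < s0 ->
  exists2 C, 0 <= C & forall sigma t, s0 <= sigma <= s1 ->
    cmod (Nker_integrand' theta x y (vline sigma t)) <= C * cauchy t.
Proof.
move=> y0 s00.
have [C1 C10 H1] := Nker_integrand_line_le (theta - 1) x s1 y0 s00.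
have [C2 C20 H2] := Nker_integrand_line_le (theta + (alpha%:C - 1)) x s1 y0 s00.
have [C3 C30 H3] := Nker_integrand_line_le theta x s1 y0 s00.
exists (cmod theta * C1 + cmod (a * alpha%:C * y%:C) * C2 + cmod x%:C * C3).
  by rewrite !addr_ge0// mulr_ge0// cmod_ge0.
move=> sigma t ss; rewrite /Nker_integrand' (le_trans (cmodD _ _))// mulrDl.
rewrite lerD//; last by rewrite cmodM -mulrA ler_wpM2l ?cmod_ge0 ?H3.
rewrite (le_trans (cmodD _ _))// mulrDl lerD//.
  by rewrite cmodM -mulrA ler_wpM2l ?cmod_ge0 ?H1.
by rewrite cmodN cmodM -(mulrA (cmod _)) ler_wpM2l ?cmod_ge0 ?H2.
Qed.

Lemma cintegrable_Nker_line theta x y sigma : 0 < y -> 0 < sigma ->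
  cintegrable setT (fun t => Nker_integrand theta alpha a x y (vline sigma t)).
Proof.
move=> y0 s0; have [C _ HC] := Nker_integrand_line_le theta x sigma y0 s0.
apply: cintegrable_le (cmeas_Nker _ _ _ s0) (rintegrableZl C (@rintegrable_cauchy R)) _.
by move=> t; rewrite HC ?lexx.
Qed.

Lemma cvg_cauchy : cauchy (n.+1%:R : R) @[n --> \oo] --> (0 : R).
Proof.
apply: (@squeeze_cvgr _ _ _ _ (fun=> 0) (fun n => (n.+1%:R : R)^-1)).
- apply: nearW => n; rewrite ltW ?cauchy_gt0//= lef_pV2 ?posrE ?ltr_pwDl ?sqr_ge0//.
  by rewrite (@le_trans _ _ (n.+1%:R ^+ 2))// ?lerDr// expr2 ler_peMr// ler1n.
- exact: cvg_cst.
- exact: cvg_harmonic.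
Qed.

(** Up to a factor i the integrand is the [t]-derivative of [Nker_integrand], which tends to 0 at
    both ends of the line. *)
Lemma cintegral_Nker' theta x y sigma : 0 < y -> 0 < sigma ->
  cintegral setT (fun t => Nker_integrand' theta x y (vline sigma t)) = 0.
Proof.
move=> y0 s0.
have [C1 _ H1] := Nker_integrand_line_le theta x sigma y0 s0.
have [C2 _ H2] := Nker_integrand'_line_le theta x sigma y0 s0.
have iN : cintegrable setT (fun t => Nker_integrand' theta x y (vline sigma t)).
  apply: cintegrable_le (rintegrableZl C2 (@rintegrable_cauchy R)) _.
    by apply: ccont_cmeas => t; exact: ccont_Nker'.
  by move=> t; rewrite H2 ?lexx.
have cv : C1 * cauchy (n.+1%:R : R) @[n --> \oo] --> (0 : R).
  by rewrite -[X in _ --> X](mulr0 C1); apply: cvgMr => //; exact: cvg_cauchy.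
have : cintegral setT (fun t => 'i * Nker_integrand' theta x y (vline sigma t)) = 0.
  apply: (@cintegral_derivative_eq0 _ _ _ (fun t => C1 * cauchy t)
    (fun t => cder_Nker_ver theta x y t s0)) => //.
  - by move=> t; apply: ccontM; [exact: ccont_cst|exact: ccont_Nker'].
  - exact: cintegrableZ.
  - by move=> t; rewrite H1 ?lexx.
  - by under eq_fun do rewrite /cauchy sqrrN.
rewrite cintegralZ// => /eqP; rewrite mulf_eq0 => /orP[|/eqP//].
by rewrite (negPf (neq0Ci R[i])).
Qed.

Lemma cintegral_Nker_shift theta x y (s1 s2 : R) : 0 < y -> 0 < s1 -> 0 < s2 ->
  cintegral setT (fun t => Nker_integrand theta alpha a x y (vline s1 t)) =
  cintegral setT (fun t => Nker_integrand theta alpha a x y (vline s2 t)).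
Proof.
move=> y0; apply: (@cder0_cst_pos _ (fun s =>
  cintegral setT (fun t => Nker_integrand theta alpha a x y (vline s t)))).
move=> s s0; have s20 : 0 < s / 2 by rewrite divr_gt0.
(* The strip s / 2 <= Re z <= 2 s surrounds the line and stays off the imaginary axis, so one
   majorant serves throughout. *)
have [C _ HC] := Nker_integrand'_line_le theta x (2 * s) y0 s20.
rewrite -(cintegral_Nker' theta x y0 s0).
have pos (r : R) : r \in `]s / 2, 2 * s[ -> 0 < r.
  by rewrite in_itv/= => /andP[h _]; exact: lt_trans h.
apply: (@cder_under_integral _
  (fun s t => Nker_integrand theta alpha a x y (vline s t))
  (fun s t => Nker_integrand' theta x y (vline s t)) (fun t => C * cauchy t)
  s (s / 2) (2 * s)).
- by rewrite in_itv/=; apply/andP; split; lra.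
- by move=> r /pos; exact: cintegrable_Nker_line.
- by move=> r t /pos; exact: cder_Nker_hor.
- exact/rintegrableZl/rintegrable_cauchy.
- by move=> r t; rewrite in_itv/= => /andP[h1 h2]; rewrite HC// !ltW.
Qed.

End ContourShift.

Section Punctured.
Variable R : realType.
Local Notation mu := (@lebesgue_measure R).

(** On the imaginary axis t = 0 is the point z = 0, where [cpow] takes a junk value; this lemma and
    the next ones allow that value to be changed. *)
Lemma measurable_punctured (f g : R -> R) : (forall t, t != 0 -> g t = f t) ->
  measurable_fun setT f -> measurable_fun setT g.
Proof.
move=> fg mf; rewrite (_ : g = fun t => if t == 0 then g 0 else f t).
  apply: measurable_fun_ifT => //; exact: measurable_fun_eqr.
by apply/funext => t; case: eqVneq => [->//|]; exact: fg.
Qed.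

Lemma cmeas_punctured (f g : R -> R[i]) : (forall t, t != 0 -> g t = f t) ->
  cmeas f -> cmeas g.
Proof.
move=> fg [f1 f2]; split.
  by apply: (measurable_punctured _ f1) => t t0; rewrite fg.
by apply: (measurable_punctured _ f2) => t t0; rewrite fg.
Qed.

Lemma rintegral_punctured (f g : R -> R) : (forall t, t != 0 -> g t = f t) ->
  rintegrable f -> rintegrable g /\ \int[mu]_t g t = \int[mu]_t f t.
Proof.
move=> fg intf; have mg := measurable_punctured fg (rintegrable_meas intf).
have m0 : mu [set (0 : R)] = 0%E by rewrite lebesgue_measure_set1.
have ms : measurable [set (0 : R)] by exact: measurable_set1.
have E : {in setT `\` [set (0 : R)], (EFin \o g) =1 (EFin \o f)}.
  by move=> t /set_mem[_ /= /eqP t0]; rewrite /= fg.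
have N (h : R -> R) : measurable_fun setT h ->
    rintegrable h <-> mu.-integrable (setT `\` [set 0]) (EFin \o h).
  move=> mh; have mh' : measurable_fun setT (EFin \o h) by exact/measurable_EFinP.
  exact: (@negligible_integrable _ _ _ mu setT [set 0] (EFin \o h) ms measurableT mh' m0).
have intg : rintegrable g.
  apply/(N _ mg); move/(N _ (rintegrable_meas intf)): (intf).
  apply: eq_integrable; first exact: measurableD.
  by move=> t Dt; rewrite E.
split=> //; rewrite /Rintegral (@negligible_integral _ _ _ mu setT [set 0] _ ms measurableT intg m0).
rewrite [in RHS](@negligible_integral _ _ _ mu setT [set 0] _ ms measurableT intf m0).
by congr fine; exact: eq_integral.
Qed.

Lemma cintegral_punctured (f g : R -> R[i]) : (forall t, t != 0 -> g t = f t) ->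
  cintegrable setT f ->
  cintegrable setT g /\ cintegral setT g = cintegral setT f.
Proof.
move=> fg [f1 f2].
have [|g1 e1] := @rintegral_punctured _ (fun t => Re (g t)) _ f1.
  by move=> t t0; rewrite fg.
have [|g2 e2] := @rintegral_punctured _ (fun t => Im (g t)) _ f2.
  by move=> t t0; rewrite fg.
by split; [split|apply: complex_eq].
Qed.

End Punctured.

(** * The kernel on the imaginary axis as a limit of vertical lines *)

Section KernelOnAxis.
Variable R : realType.
Variables (a : R[i]) (alpha : R).
Hypothesis adm : admissible alpha a.
Implicit Types (theta z : R[i]) (x y t sigma : R).

Lemma cvg_ccont (f : R -> R[i]) (s : nat -> R) x : ccont f x ->
  s n @[n --> \oo] --> x ->
  (Re (f (s n)) @[n --> \oo] --> Re (f x)) /\ (Im (f (s n)) @[n --> \oo] --> Im (f x)).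
Proof.
move=> [f1 f2] sx; split.
  exact: (cvg_comp _ _ sx f1).
exact: (cvg_comp _ _ sx f2).
Qed.

(** The lines Re z = 1 / (n + 1) approach the axis while their integrals are all equal. The majorant
    is of order |t|^(min (Re theta, 0)) at 0, and this is where Re theta > -1 enters. *)
Lemma cintegral_Nker_axis theta x y : -1 < Re theta -> 0 < y ->
  cintegrable setT (fun t => Nker_integrand theta alpha a x y (vline 0 t)) /\
  forall sigma, 0 < sigma ->
  cintegral setT (fun t => Nker_integrand theta alpha a x y (vline sigma t)) =
  cintegral setT (fun t => Nker_integrand theta alpha a x y (vline 0 t)).
Proof.
move=> th y0; have [k k0 hk] := admissible_sector adm.
have [/andP[al0 _] _ _ _] := adm.
have [q q0 [C C0 HC]] := le_density th (mulr_gt0 k0 y0) al0.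
pose s n : R := n.+1%:R^-1.
have s0 n : 0 < s n by rewrite invr_gt0.
have s1 n : s n <= 1 by rewrite invf_le1// ler1n.
(* Setting the value at t = 0 to 0 gives domination and convergence at every point. *)
pose u sg t : R[i] := if t == 0 then 0 else Nker_integrand theta alpha a x y (vline sg t).
pose h t := expR (`|Im theta| * pi) * expR `|x| * C * density q t.
have ih : rintegrable h by exact/rintegrableZl/rintegrable_density.
have uh n t : cmod (u (s n) t) <= h t.
  rewrite /u; case: eqVneq => [_|t0].
    rewrite cmodC normr0 !mulr_ge0 ?expR_ge0//.
    by rewrite addr_ge0// half_density_ge0.
  have := Nker_integrand_le theta x hk (ltW y0) (vline_neq0 t (s0 n)) (ltW (s0 n)).
  move/le_trans; apply; rewrite /h -[X in _ <= X]mulrA.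
  rewrite ler_pM ?mulr_ge0 ?expR_ge0 ?powR_ge0//.
    rewrite ler_wpM2l ?expR_ge0// ler_expR ler_piMl//.
    by rewrite /= gtr0_norm.
  by rewrite HC// cmod_vline_geN.
have cv t : (Re (u (s n) t) @[n --> \oo] --> Re (u 0 t)) /\
            (Im (u (s n) t) @[n --> \oo] --> Im (u 0 t)).
  rewrite /u; case: eqVneq => [_|t0]; first by split; exact: cvg_cst.
  apply: (@cvg_ccont (fun sg => Nker_integrand theta alpha a x y (vline sg t)));
    last exact: cvg_harmonic.
  have c1 := ccont_clog_axis t0.
  have c2 th' : ccont (fun sg => cpow (vline sg t) th') 0.
    by apply/ccont_cexp/ccontM => //; exact: ccont_cst.
  have c3 : ccont (fun sg => vline sg t) 0.
    split; last exact: cst_continuous.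
    by move=> A; exact.
  apply: ccontM => //; apply: ccont_cexp; apply: ccontD.
    apply: ccontN; apply: ccontM; last exact: ccont_cst.
    by apply: ccontM => //; exact: ccont_cst.
  by apply: ccontM => //; exact: ccont_cst.
have ueq sg t : t != 0 -> u sg t = Nker_integrand theta alpha a x y (vline sg t).
  by rewrite /u => /negbTE ->.
have mu_ n : cmeas (u (s n)).
  apply: (cmeas_punctured (ueq (s n))); exact: cmeas_Nker.
have [iu0 r1 r2] := cintegral_dominated mu_ ih uh
   (fun t => (cv t).1) (fun t => (cv t).2).
have [iN0 e0] := cintegral_punctured (fun t nz => esym (ueq 0 t nz)) iu0.
split=> // sigma sp.
have e n : cintegral setT (u (s n)) =
    cintegral setT (fun t => Nker_integrand theta alpha a x y (vline sigma t)).
  have [_ ->] := cintegral_punctured (ueq _) (cintegrable_Nker_line adm theta x y0 (s0 n)).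
  exact: cintegral_Nker_shift.
rewrite e0; apply: complex_eq; apply/esym.
  apply: (cvg_unique _ r1) => //.
  by apply: cvg_near_cst; apply: nearW => n; rewrite (e n).
apply: (cvg_unique _ r2) => //.
by apply: cvg_near_cst; apply: nearW => n; rewrite (e n).
Qed.

Lemma on_imag_axisE (f : R[i] -> R[i]) t : on_imag_axis f t = 'i * f (vline 0 t).
Proof.
rewrite /on_imag_axis mulrC; congr (_ * f _).
by apply: complex_eq; rewrite !reimE/= ?mul0r ?mul1r ?addr0 ?subr0 ?mulr0 ?add0r.
Qed.

Lemma cintegrable_Nker theta x y : -1 < Re theta -> 0 < y ->
  cintegrable setT (on_imag_axis (Nker_integrand theta alpha a x y)).
Proof.
move=> th y0; have [iN _] := cintegral_Nker_axis x th y0.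
rewrite (_ : on_imag_axis _ =
  fun t => 'i * Nker_integrand theta alpha a x y (vline 0 t)).
  exact: cintegrableZ.
by apply/funext => t; rewrite on_imag_axisE.
Qed.

(** The i of dz = i dt cancels against that of 1 / (2 i pi). *)
Lemma NkerE theta x y sigma : -1 < Re theta -> 0 < y -> 0 < sigma ->
  Nker theta alpha a x y = (2 * pi)^-1%:C *
    cintegral setT (fun t => Nker_integrand theta alpha a x y (vline sigma t)).
Proof.
move=> th y0 s0; have [iN eN] := cintegral_Nker_axis x th y0.
rewrite /Nker eN//.
rewrite (_ : cintegral setT (on_imag_axis _) =
  'i * cintegral setT (fun t => Nker_integrand theta alpha a x y (vline 0 t))).
  rewrite mulrA; congr (_ * _).
  rewrite invfM mulfVK ?neq0Ci// rmorphV/=; last first.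
    by rewrite unitfE mulf_neq0// gt_eqF// pi_gt0.
  by rewrite rmorphM/= rmorph_nat.
by rewrite -cintegralZ//; apply: eq_cintegral => t _; rewrite on_imag_axisE.
Qed.

End KernelOnAxis.

(** * The space P *)

Section HalfLineDerivative.
Variable R : realType.
Implicit Types (f g : R -> R[i]) (x y : R) (l : R[i]) (G : nat -> R -> R[i]).

(** The norm of R[i] takes its values in R[i]; this brings convergence back to real radii. *)
Lemma ccvgP (T : Type) (F : set_system T) (FF : Filter F) (g : T -> R[i]^o) (l : R[i]^o) :
  g y @[y --> F] --> l <->
  (forall e : R, 0 < e -> \forall y \near F, cmod (l - g y) < e).
Proof.
split=> [/cvgrPdist_lt gl e e0|gl].
  have e0' : 0 < e%:C by rewrite ltcR.
  by apply: filterS (gl _ e0') => y; rewrite norm_cmod ltcR.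
apply/cvgrPdist_lt => e; rewrite ltcE => /andP[/eqP/= ei er].
apply: filterS (gl _ er) => y; rewrite norm_cmod => h.
by rewrite ltcE/= ei eqxx h.
Qed.

Lemma ccvg_ReIm (T : Type) (F : set_system T) (FF : Filter F) (g : T -> R[i]) (l : R[i]) :
  (forall e : R, 0 < e -> \forall y \near F, cmod (l - g y) < e) <->
  (Re (g y) @[y --> F] --> Re l /\ Im (g y) @[y --> F] --> Im l).
Proof.
split=> [gl|[/cvgrPdist_lt h1 /cvgrPdist_lt h2] e e0].
  split; apply/cvgrPdist_lt => e e0; apply: filterS (gl _ e0) => y;
    apply: le_lt_trans.
    by rewrite -ReN -ReD Re_le_cmod.
  by rewrite -ImN -ImD Im_le_cmod.
have e20 : 0 < e / 2 by rewrite divr_gt0.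
apply: filterS2 (h1 _ e20) (h2 _ e20) => y y1 y2.
rewrite (le_lt_trans (cmod_le_ReIm _))// !reimE.
by rewrite (splitr e) ltrD.
Qed.

(** Caratheodory's slope function links the derivative to difference quotients on a punctured
    neighbourhood, the form used in [hquot]. *)
Lemma is_derive_quotP (u : R -> R) x d :
  is_derive x 1 u d <-> (u y - u x) / (y - x) @[y --> x^'] --> d.
Proof.
split.
  move=> /is_derive1_caratheodory[g [ug /continuous_withinNx cg gx]].
  rewrite -gx; apply: cvg_trans cg; apply: near_eq_cvg.
  near=> y; rewrite ug mulfK// subr_eq0.
  by near: y; exact: nbhs_dnbhs_neq.
move=> ud; apply/is_derive1_caratheodory.
exists (fun y => if y == x then d else (u y - u x) / (y - x)); split.
- move=> z; case: eqVneq => [->|zx]; first by rewrite !subrr mulr0.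
  by rewrite divfK// subr_eq0.
- apply/continuous_withinNx; rewrite eqxx; apply: cvg_trans ud.
  apply: near_eq_cvg; near=> y.
  rewrite ifN//; near: y; exact: nbhs_dnbhs_neq.
- by rewrite eqxx.
Unshelve. all: by end_near. Qed.

Lemma hquot_ReIm f x y : hquot f x y =
  ((Re (f y) - Re (f x)) / (y - x)) +i* ((Im (f y) - Im (f x)) / (y - x)).
Proof.
rewrite /hquot (_ : ((y - x)%:C)^-1 = ((y - x)^-1)%:C); last first.
  have [->|yx] := eqVneq (y - x) 0; first by rewrite !invr0.
  by rewrite -fmorphV.
by apply: complex_eq; rewrite !reimE ?mulr0 ?subr0 ?add0r// addr0.
Qed.

Lemma cder_quotP f x l : cder f x l <->
  (forall e : R, 0 < e -> \forall y \near x^', cmod (l - hquot f x y) < e).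
Proof.
split=> [[/is_derive_quotP f1 /is_derive_quotP f2]|].
  by apply/ccvg_ReIm; split; under eq_fun do rewrite hquot_ReIm.
move=> /ccvg_ReIm[f1 f2]; split; apply/is_derive_quotP.
  by move: f1; under eq_fun do rewrite hquot_ReIm.
by move: f2; under eq_fun do rewrite hquot_ReIm.
Qed.

(** Properness makes the one-sided limits unique; it holds because right punctured neighbourhoods of
    [x] lie in the half-line. *)
Lemma half_line_proper x : 0 <= x -> ProperFilter (within `[0, +oo[ x^').
Proof.
move=> x0; apply: Build_ProperFilter.
rewrite -[within _ _ _]/(\forall y \near x^', `[0, +oo[%classic y -> False) => xP.
have : \forall y \near x^'+, False.
  move: xP; rewrite !near_withinE; apply: filterS => y h xy.
  by apply: h; rewrite ?gt_eqF//= in_itv/= andbT (le_trans x0)// ltW.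
by case/filter_ex.
Qed.

Lemma hderiv_cder f x l : 0 <= x -> cder f x l ->
  hderivable f x /\ hderiv f x = l.
Proof.
move=> x0 /cder_quotP fl; have FF := half_line_proper x0.
have cl : (hquot f x y @[y --> within `[0, +oo[ x^']) --> (l : R[i]^o).
  apply/ccvgP => e e0; rewrite near_withinE.
  by apply: filterS (fl e e0).
split; first by apply/cvg_ex; exists l.
apply: cvg_lim cl; exact: norm_hausdorff.
Qed.

Lemma eq_hderiv f g x : 0 <= x -> (forall y, 0 <= y -> f y = g y) ->
  (hderivable f x -> hderivable g x) /\ hderiv f x = hderiv g x.
Proof.
move=> x0 fg; have FF := half_line_proper x0.
have E : hquot f x y @[y --> within `[0, +oo[ x^'] =
         hquot g x y @[y --> within `[0, +oo[ x^'].
  by apply/seteqP; split; apply: near_eq_cvg; rewrite near_withinE;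
    apply: nearW => y; rewrite /= in_itv/= andbT => y0; rewrite /hquot !fg.
by rewrite /hderivable /hderiv E.
Qed.

Lemma hderivn_chain G : (forall m x, cder (G m) x (G m.+1 x)) ->
  forall m x, 0 <= x -> hderivn m (G 0%N) x = G m x /\ hderivable (hderivn m (G 0%N)) x.
Proof.
move=> dG; have E m : forall x, 0 <= x -> hderivn m (G 0%N) x = G m x.
  elim: m => // m IH x x0.
  rewrite /hderivn iterS -/(hderivn m (G 0%N)) (eq_hderiv x0 IH).2.
  exact: (hderiv_cder x0 (dG m x)).2.
move=> m x x0; split; first exact: E.
apply: (eq_hderiv x0 (fun y hy => esym (E m y hy))).1.
exact: (hderiv_cder x0 (dG m x)).1.
Qed.

(** Membership criterion for a function given on the whole line with all its derivatives: vanishing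
    for x <= 0 yields flatness, growth below every exponential yields the limits at infinity. *)
Lemma in_P_chain G : (forall m x, cder (G m) x (G m.+1 x)) ->
  (forall m x, x <= 0 -> G m x = 0) ->
  (forall m e, 0 < e -> exists C, forall x, 0 <= x -> cmod (G m x) <= C * expR (e * x)) ->
  in_P (G 0%N).
Proof.
move=> dG G0 bG; have H := hderivn_chain dG; split.
- by move=> x x0; rewrite G0// ltW.
- by move=> m x x0; case: (H m x x0).
- by move=> m; rewrite (H m 0 (lexx _)).1 G0.
(* The bound at rate e / 2 leaves a factor exp (- e x / 2), which tends to 0. *)
- move=> e m e0; have e20 : 0 < e / 2 by rewrite divr_gt0.
  have [C HC] := bG m _ e20.
  apply/ccvgP => r r0.
  have cv : C * expR (- (e / 2 * x)) @[x --> +oo] --> (0 : R).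
    rewrite -[X in _ --> X](mulr0 C); apply: cvgMr.
    have := @cvgr_expR R.
    move=> h; apply: (cvg_comp (fun x => e / 2 * x) (fun x => expR (- x)) _ h).
    exact: gt0_cvgMry.
  move/cvgrPdist_lt : cv => /(_ _ r0); apply: filterS2; last exact: (nbhs_pinfty_ge (num_real 0)).
  move=> x x0; rewrite sub0r normrN => h1.
  rewrite sub0r cmodN (le_lt_trans _ h1)// (le_trans _ (ler_norm _))//.
  rewrite cmodM (H m x x0).1 cmodC (gtr0_norm (expR_gt0 _)).
  rewrite (le_trans (ler_wpM2r (expR_ge0 _) (HC x x0)))//.
  rewrite -(mulrA C) -expRD.
  by rewrite (_ : e / 2 * x - e * x = - (e / 2 * x))//; field.
Qed.

End HalfLineDerivative.

Section SpacePFacts.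
Variable R : realType.
Implicit Types (f g : R -> R[i]) (x y e : R) (l : R[i]) (G : nat -> R -> R[i]).

(* [hderivn m f] is a junk value at negative points when [m > 0]; its extension
   by 0 has two-sided derivatives everywhere when [f] is in P. *)
Definition hext m f x : R[i] := if x < 0 then 0 else hderivn m f x.

Lemma hext_ge0 m f x : 0 <= x -> hext m f x = hderivn m f x.
Proof. by move=> x0; rewrite /hext ltNge x0. Qed.

Lemma hext_le0 f : in_P f -> forall m x, x <= 0 -> hext m f x = 0.
Proof.
move=> [_ _ f0 _] m x; rewrite /hext le_eqVlt => /orP[/eqP ->|->//].
by rewrite ltxx f0.
Qed.

Lemma hext0E f : in_P f -> hext 0 f = f.
Proof. by move=> [f0 _ _ _]; apply/funext => x; rewrite /hext; case: ifPn => // /f0. Qed.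

Lemma in_P_eq0 f y : in_P f -> y <= 0 -> f y = 0.
Proof. by move=> Pf y0; rewrite -(hext0E Pf) hext_le0. Qed.

(** At 0 the quotients from the left are 0, and so is the derivative, by flatness; near a positive
    point only points of the half-line occur. *)
Lemma cder_hext f : in_P f -> forall m x, cder (hext m f) x (hext m.+1 f x).
Proof.
move=> Pf m x; have [f0 df fz _] := Pf.
have [x0|x0] := ltP x 0.
  rewrite [X in cder _ _ X]/hext x0; apply: cder_near (cder_cst 0 x).
  by apply: filterS (lt_nbhsl x0) => y; rewrite /hext => ->.
rewrite [X in cder _ _ X](hext_ge0 _ _ x0); apply/cder_quotP => e e0.
have FF := half_line_proper x0.
have cl : hquot (hderivn m f) x y @[y --> within `[0, +oo[ x^'] -->
    (hderivn m.+1 f x : R[i]^o) by exact: df.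
move/ccvgP : cl => /(_ _ e0); rewrite near_withinE => h.
have ny : \forall y \near x^', y < 0 -> x = 0.
  move: x0; rewrite le_eqVlt => /orP[/eqP <-|x0]; first exact: nearW.
  apply: nbhs_dnbhs; apply: filterS (lt_nbhsr x0) => y y0 y1.
  by have := lt_trans y0 y1; rewrite ltxx.
apply: filterS2 h ny => y h ny; have [y0|y0] := ltP y 0; last first.
  move: h; rewrite /= in_itv/= andbT => /(_ y0); rewrite /hquot.
  by rewrite !hext_ge0.
rewrite (ny y0) fz sub0r cmodN /hquot !(hext_le0 Pf) ?(ltW y0)//.
by rewrite subrr mul0r cmodC normr0.
Qed.

Lemma in_P_cmeas f : in_P f -> cmeas f.
Proof.
move=> Pf; rewrite -(hext0E Pf); apply: ccont_cmeas => x.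
exact: cder_ccont (cder_hext Pf 0 x).
Qed.

(** A maximum on a compact [0, B] and the limit 0 beyond it. This makes the supremum in [seminorm] a
    genuine one rather than a default value. *)
Lemma hderivn_bounded f m e : in_P f -> 0 < e ->
  exists M, forall x, 0 <= x -> cmod (hderivn m f x) * expR (- (e * x)) <= M.
Proof.
move=> Pf e0; have [_ _ _ /(_ e m e0)/ccvgP/(_ 1 ltr01)[A [_ HA]]] := Pf.
pose B := Num.max A 0.
have B0 : 0 <= B by rewrite le_max lexx orbT.
pose u x := `|Re (hext m f x)| + `|Im (hext m f x)|.
have cu : {within `[0, B], continuous u}.
  apply: continuous_subspaceT => x.
  have [c1 c2] := cder_ccont (cder_hext Pf m x).
  apply: (@continuousD _ _ _ (fun x => `|Re (hext m f x)|)
    (fun x => `|Im (hext m f x)|) x).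
    by apply: (continuous_comp c1); exact: norm_continuous.
  by apply: (continuous_comp c2); exact: norm_continuous.
have [c _ Hc] := EVT_max B0 cu.
exists (Num.max 1 (u c)) => x x0; rewrite le_max.
have [xB|xB] := leP x B; apply/orP; [right|left].
  have := Hc x; rewrite in_itv/= x0 xB => /(_ isT); apply: le_trans.
  rewrite -(hext_ge0 _ _ x0) (@le_trans _ _ (cmod (hext m f x)))//.
    by rewrite ler_piMr ?cmod_ge0// -expR0 ler_expR oppr_le0 mulr_ge0// ltW.
  exact: cmod_le_ReIm.
have Ax : A < x by apply: le_lt_trans xB; rewrite le_max lexx.
have := HA _ Ax; rewrite /= sub0r cmodN cmodM cmodC (gtr0_norm (expR_gt0 _)).
exact: ltW.
Qed.

Lemma cmod_le_seminorm f m e x : in_P f -> 0 < e -> 0 <= x ->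
  cmod (hderivn m f x) <= seminorm m e f * expR (e * x).
Proof.
move=> Pf e0 x0; have [M HM] := hderivn_bounded m Pf e0.
rewrite -ler_pdivrMr ?expR_gt0// -expRN; apply: ub_le_sup.
  by exists M => _ [y /= + <-]; rewrite in_itv/= andbT => y0; exact: HM.
by exists x => //=; rewrite in_itv/= x0.
Qed.

Lemma seminorm_le f m e C :
  (forall x, 0 <= x -> cmod (hderivn m f x) <= C * expR (e * x)) ->
  seminorm m e f <= C.
Proof.
move=> fC; apply: ge_sup.
  by exists (cmod (hderivn m f 0) * expR (- (e * 0))), 0 => //=; rewrite in_itv/= lexx.
move=> _ [y /= + <-]; rewrite in_itv/= andbT => y0.
by rewrite expRN ler_pdivrMr ?expR_gt0// fC.
Qed.

Lemma seminorm_ge0 f m e : in_P f -> 0 < e -> 0 <= seminorm m e f.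
Proof.
move=> Pf e0; have := cmod_le_seminorm m Pf e0 (lexx 0).
by rewrite mulr0 expR0 mulr1; apply: le_trans; exact: cmod_ge0.
Qed.

Lemma cder_bound f g x B : 0 <= x -> (forall y, cder f y (g y)) -> f 0 = 0 ->
  (forall y, 0 <= y <= x -> cmod (g y) <= B) -> cmod (f x) <= 2 * B * x.
Proof.
move=> x0 df f0 gB.
have aux (u v : R -> R) : (forall y, is_derive y 1 u (v y)) -> u 0 = 0 ->
    (forall y, 0 <= y <= x -> `|v y| <= B) -> `|u x| <= B * x.
  move=> du u0 vB.
  have cu : {within `[0, x], continuous u}.
    apply: continuous_subspaceT => y.
    by have [? _] := du y; exact/differentiable_continuous/derivable1_diffP.
  have [c + E] := @MVT_segment _ u v 0 x x0 (fun y _ => du y) cu.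
  rewrite in_itv/= => cx; rewrite -[u x]subr0 -u0 E subr0 normrM (ger0_norm x0).
  by rewrite ler_wpM2r// vB.
rewrite (le_trans (cmod_le_ReIm _))// -mulrA mulr_natl mulr2n lerD//.
  apply: (aux (fun y => Re (f y)) (fun y => Re (g y))).
  - by move=> y; case: (df y).
  - by rewrite f0.
  - by move=> y /gB; apply: le_trans; exact: Re_le_cmod.
apply: (aux (fun y => Im (f y)) (fun y => Im (g y))).
- by move=> y; case: (df y).
- by rewrite f0.
- by move=> y /gB; apply: le_trans; exact: Im_le_cmod.
Qed.

(** Integration [n] times from 0, where all the functions vanish; each step costs a factor 2 x. *)
Lemma chain_growth n G (S e : R) : 0 <= S -> 0 < e ->
  (forall m x, cder (G m) x (G m.+1 x)) -> (forall m, G m 0 = 0) ->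
  (forall x, 0 <= x -> cmod (G n x) <= S * expR (e * x)) ->
  forall x, 0 <= x -> cmod (G 0%N x) <= 2 ^+ n * S * x ^+ n * expR (e * x).
Proof.
move=> S0 e0; elim: n G => [|n IH] G dG G0 GS x x0.
  by rewrite expr0 mul1r expr0 mulr1 GS.
have H := IH (fun m => G m.+1) (fun m => dG m.+1) (fun m => G0 m.+1) GS.
have := @cder_bound (G 0%N) (G 1%N) x
  (2 ^+ n * S * x ^+ n * expR (e * x)) x0 (dG 0%N) (G0 0%N).
rewrite (_ : 2 * _ * x = 2 ^+ n.+1 * S * x ^+ n.+1 * expR (e * x)); last first.
  by rewrite !exprS; ring.
apply => y /andP[y0 yx]; rewrite (le_trans (H y y0))//.
rewrite ler_pM ?expR_ge0 ?mulr_ge0 ?exprn_ge0//.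
  by rewrite ler_wpM2l ?mulr_ge0 ?exprn_ge0// lerXn2r.
by rewrite ler_expR ler_wpM2l// ltW.
Qed.

Lemma in_P_growth f n e x : in_P f -> 0 < e -> 0 <= x ->
  cmod (f x) <= 2 ^+ n * seminorm n e f * x ^+ n * expR (e * x).
Proof.
move=> Pf e0 x0; rewrite -[in leLHS](hext0E Pf).
apply: (@chain_growth n (fun m => hext m f)) => //.
- exact: seminorm_ge0.
- exact: cder_hext.
- by move=> m; rewrite (hext_le0 Pf).
- by move=> y y0; rewrite hext_ge0// cmod_le_seminorm.
Qed.

Lemma in_PB f g : in_P f -> in_P g -> in_P (fun x => f x - g x).
Proof.
move=> Pf Pg.
rewrite (_ : (fun x => _) = (fun m x => hext m f x - hext m g x) 0%N); last first.
  by rewrite /= (hext0E Pf) (hext0E Pg).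
apply: (@in_P_chain _ (fun m x => hext m f x - hext m g x)).
- by move=> m x; apply: cderD; [|apply: cderN]; exact: cder_hext.
- by move=> m x x0; rewrite !hext_le0// subrr.
- move=> m e e0; exists (seminorm m e f + seminorm m e g) => x x0.
  rewrite (le_trans (cmodD _ _))// cmodN mulrDl !hext_ge0//.
  by rewrite lerD// cmod_le_seminorm.
Qed.

End SpacePFacts.

(** * The operators as multipliers of the Laplace transform *)

Section HalfLineExponential.
Variable R : realType.
Implicit Types (x y t d : R).

(** Majorant in [y], set to 0 for y <= 0 so that integrals can run over the whole line. *)
Definition decay d y : R := if 0 < y then expR (- (d * y)) else 0.

Lemma decay_ge0 d y : 0 <= decay d y.
Proof. by rewrite /decay; case: ifP => // _; exact: expR_ge0. Qed.

Let is_derive_expM (c t : R) : is_derive t 1 (fun t => expR (- (c * t))) (- c * expR (- (c * t))).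
Proof.
have d1 : is_derive t 1 (fun t => - (c * t)) (- c).
  by apply: is_derive_eq; rewrite /GRing.scale/= mulr1.
have := @is_derive1_comp _ (@expR R) (fun t => - (c * t)) t _ _ (is_derive_expR _) d1.
by rewrite mulrC.
Qed.

Lemma rintegrable_decay d : 0 < d -> rintegrable (decay d).
Proof.
move=> d0.
have cont y : 0 < y -> {for y, continuous (decay d)}.
  move=> y0; rewrite /prop_for /continuous_at /decay y0.
  have c : expR (- (d * t)) @[t --> y] --> expR (- (d * y)).
    by have [/derivable1_diffP/differentiable_continuous] := is_derive_expM d y.
  apply: cvg_trans c.
  by apply: near_eq_cvg; apply: filterS (lt_nbhsr y0) => s /= ->.
apply: (@rintegrable_FTC _ (fun t => 0 < t) (fun t => (- d^-1) * expR (- (d * t)))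
    (decay d) (fun n => n.+1%:R^-1) (fun n => n.+2%:R) d^-1).
- exact: decay_ge0.
- exact: inv_lt_itv.
- by move=> n t /andP[h _]; apply: lt_le_trans h; rewrite invr_gt0.
- exact: near_inv_itv.
- by move=> t /negbTE; rewrite /decay => ->.
- move=> t t0; rewrite /decay t0.
  have := @is_deriveZ _ _ _ _ (- d^-1 : R) _ _ _ (is_derive_expM d t).
  by rewrite /GRing.scale/= mulrA mulrNN mulVf ?mul1r// gt_eqF.
- by move=> n t /andP[h _]; apply: cont; apply: lt_le_trans h; rewrite invr_gt0.
- move=> n; rewrite !mulNr opprK (@le_trans _ _ (d^-1 * expR (- (d * n.+1%:R^-1))))//.
    by rewrite gerDr oppr_le0 mulr_ge0 ?expR_ge0// invr_ge0 ltW.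
  rewrite ler_piMr ?invr_ge0 ?(ltW d0)// -expR0 ler_expR oppr_le0 mulr_ge0// ?ltW//.
Qed.

End HalfLineExponential.

Section LaplaceRepresentation.
Variable R : realType.
Local Notation mu := (@lebesgue_measure R).
Variables (a : R[i]) (alpha : R).
Hypothesis adm : admissible alpha a.
Implicit Types (theta z : R[i]) (x y t sigma : R) (f g : R -> R[i]).

(** Functions of P vanish for y < 0, so the integral over the line is the usual Laplace
    transform. *)
Definition Lap f (w : R[i]) : R[i] :=
  cintegral setT (fun y => f y * cexp (- (w * y%:C))).

Definition LapQ theta f z : R[i] := cpow z theta * Lap f (a * cpow z alpha%:C).

(* The Bromwich integral of [LapQ theta f] along the line [Re z = sigma]. *)
Definition Hop theta f sigma x : R[i] := (2 * pi)^-1%:C *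
  cintegral setT (fun t => LapQ theta f (vline sigma t) * cexp (vline sigma t * x%:C)).

Definition Kern theta f z y : R[i] :=
  cpow z theta * (f y * cexp (- (a * cpow z alpha%:C * y%:C))).

(* Flatness of [f] at 0 turns the decay of [exp (- a z^alpha y)] in [y] into
   decay in [z]: [y^n exp (- k |z|^alpha y) <= C |z|^(- alpha n)]. *)
Lemma Kern_le theta (N : nat) (sigma : R) : 0 < sigma ->
  exists n e d C, [/\ 0 < e, 0 < d, 0 <= C & forall f z y, in_P f -> sigma <= Re z ->
    cmod (Kern theta f z y) <= C * seminorm n e f * cmod z ^- N * decay d y].
Proof.
move=> s0; have [k k0 hk] := admissible_sector adm.
have [/andP[al0 _] _ _ _] := adm.
have sal : 0 < sigma `^ alpha by rewrite powR_gt0.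
(* With alpha n >= Re theta + N, the remaining power of |z| has an exponent at most 0 and is bounded
   by its value at sigma. *)
pose p := Re theta; pose n := (Num.truncn (`|p + N%:R| / alpha)).+1.
have pn : p + N%:R <= alpha * n%:R.
  rewrite (le_trans (ler_norm _))// mulrC -ler_pdivrMr// ltW//.
  exact: truncnS_gt.
(* exp (- k |z|^alpha y) is split into two equal factors: one absorbs y^n, the other absorbs exp (d
   y) and still leaves exp (- d y), because k sigma^alpha / 2 = 2 d. *)
pose d := k * sigma `^ alpha / 4.
have d0 : 0 < d by rewrite divr_gt0// mulr_gt0.
have k20 : 0 < k / 2 by rewrite divr_gt0.
pose C := expR (`|Im theta| * pi) * 2 ^+ n * (n`!%:R / (k / 2) ^+ n) *
  sigma `^ (p + N%:R - alpha * n%:R).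
have C0 : 0 <= C.
  by rewrite !mulr_ge0 ?expR_ge0 ?powR_ge0// invr_ge0 exprn_ge0// ltW.
exists n, d, d, C; split=> // f z y Pf sz.
have rz : 0 < Re z by exact: lt_le_trans sz.
have z0 : z != 0 by apply: contraTneq rz => ->; rewrite ltxx.
have m0 : 0 < cmod z by rewrite cmod_gt0.
have sm : sigma <= cmod z.
  by rewrite (le_trans sz)// (le_trans _ (Re_le_cmod _))// ler_norm.
have S0 := seminorm_ge0 n Pf d0.
rewrite /decay; case: ifPn => [y0|]; last first.
  rewrite -leNgt => y0; rewrite -(hext0E Pf) /Kern (hext_le0 Pf)//.
  by rewrite mul0r mulr0 mulr0 cmodC normr0.
have yge := ltW y0.
rewrite /Kern 2!cmodM cmod_cexp.
set S := seminorm n d f in S0 *.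
set A := cmod z `^ alpha.
have A0 : 0 < A by rewrite powR_gt0.
have sA : sigma `^ alpha <= A by rewrite ge0_ler_powR ?nnegrE// ltW.
have b1 := cmod_cpow_le theta z0.
have b2 : cmod (f y) <= 2 ^+ n * S * y ^+ n * expR (d * y) by exact: in_P_growth.
have b3 : expR (Re (- (a * cpow z alpha%:C * y%:C))) <= expR (- (k * A * y)).
  rewrite ler_expR ReN lerN2 ReM ReC ImC mulr0 subr0 ler_wpM2r// hk//.
  exact: ltW.
have b4 : y ^+ n * expR (- (k / 2 * (A * y))) <=
    n`!%:R / (k / 2) ^+ n * cmod z `^ (- (alpha * n%:R)).
  have h := pow_expR_le n k20 (mulr_ge0 (ltW A0) yge).
  rewrite powRN powRrM powR_mulrn ?powR_ge0// -/A.
  rewrite [leRHS]mulrC ler_pdivlMl ?exprn_gt0//; apply: le_trans h.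
  rewrite exprMn.
  by rewrite le_eqVlt; apply/orP; left; apply/eqP; ring.
have b5 : cmod z `^ p * cmod z `^ (- (alpha * n%:R)) <=
    sigma `^ (p + N%:R - alpha * n%:R) * cmod z ^- N.
  have E (u v : R) : cmod z `^ (u + v) = cmod z `^ u * cmod z `^ v.
    by rewrite powRD// (gt_eqF m0) implybT.
  rewrite -E (_ : p - alpha * n%:R = (p + N%:R - alpha * n%:R) + - N%:R); last by ring.
  rewrite E powR_invn ?(ltW m0)// ler_wpM2r ?invr_ge0 ?exprn_ge0 ?(ltW m0)//.
  have F (u : R) : u `^ (p + N%:R - alpha * n%:R) = (u `^ (alpha * n%:R - (p + N%:R)))^-1.
    by rewrite -powRN opprB.
  by rewrite !F lef_pV2 ?posrE ?powR_gt0// ge0_ler_powR ?subr_ge0 ?nnegrE ?(ltW s0) ?(ltW m0).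
have b6 : expR (- (k / 2 * (A * y))) * expR (d * y) <= expR (- (d * y)).
  rewrite -expRD ler_expR -subr_ge0.
  rewrite (_ : _ - _ = (k / 2 * (A - sigma `^ alpha)) * y); last by rewrite /d; field.
  by rewrite mulr_ge0// mulr_ge0 ?subr_ge0// ltW.
have e3 : expR (- (k * A * y)) = expR (- (k / 2 * (A * y))) * expR (- (k / 2 * (A * y))).
  by rewrite -expRD; congr expR; field.
set X := expR (- (k / 2 * (A * y))) in b4 b6 e3.
have X0 : 0 <= X by exact: expR_ge0.
apply: (@le_trans _ _ ((expR (`|Im theta| * pi) * cmod z `^ p) *
    ((2 ^+ n * S * y ^+ n * expR (d * y)) * (X * X)))).
  rewrite ler_pM ?cmod_ge0 ?mulr_ge0 ?cmod_ge0 ?expR_ge0//.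
  by rewrite ler_pM ?cmod_ge0 ?expR_ge0// (le_trans b3)// e3.
set e1 := expR (`|Im theta| * pi).
have e10 : 0 <= e1 by exact: expR_ge0.
have -> : (e1 * cmod z `^ p) * ((2 ^+ n * S * y ^+ n * expR (d * y)) * (X * X)) =
  (e1 * 2 ^+ n * S) * ((y ^+ n * X) * cmod z `^ p * (X * expR (d * y))) by ring.
have -> : C * S * cmod z ^- N * expR (- (d * y)) =
  (e1 * 2 ^+ n * S) * ((n`!%:R / (k / 2) ^+ n *
    (sigma `^ (p + N%:R - alpha * n%:R) * cmod z ^- N)) * expR (- (d * y))).
  by rewrite /C -/e1; ring.
rewrite ler_wpM2l ?mulr_ge0 ?exprn_ge0//.
rewrite ler_pM ?mulr_ge0 ?exprn_ge0 ?powR_ge0 ?expR_ge0//.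
apply: (@le_trans _ _ ((n`!%:R / (k / 2) ^+ n * cmod z `^ (- (alpha * n%:R))) * cmod z `^ p)).
  by rewrite ler_wpM2r ?powR_ge0.
rewrite -mulrA ler_wpM2l ?divr_ge0 ?exprn_ge0 ?(ltW k20)//.
by rewrite mulrC.
Qed.

End LaplaceRepresentation.

Section LaplaceOperator.
Variable R : realType.
Local Notation mu := (@lebesgue_measure R).
Variables (a : R[i]) (alpha : R).
Hypothesis adm : admissible alpha a.
Implicit Types (theta z : R[i]) (x y t sigma : R) (f g : R -> R[i]).

Local Notation LapQ := (LapQ a alpha).
Local Notation Hop := (Hop a alpha).
Local Notation Kern := (Kern a alpha).

Lemma cmeas_clog_vline sigma : 0 < sigma -> cmeas (fun t => clog (vline sigma t)).
Proof. by move=> s0; apply: ccont_cmeas => t; exact: cder_ccont (cder_clog_ver t s0). Qed.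

Lemma cmeas_vline sigma : cmeas (vline sigma).
Proof. by split; [exact: measurable_cst|exact: measurable_id]. Qed.

Lemma cmeas_cpow_vline theta sigma : 0 < sigma ->
  cmeas (fun t => cpow (vline sigma t) theta).
Proof.
move=> s0; apply/cmeas_cexp/cmeasM; first exact: cmeas_cst.
exact: cmeas_clog_vline.
Qed.

Lemma cmeas_Kern2 theta f sigma : in_P f -> 0 < sigma ->
  cmeas (fun p : R * R => Kern theta f (vline sigma p.1) p.2).
Proof.
move=> Pf s0; have cp th : cmeas (fun p : R * R => cpow (vline sigma p.1) th).
  exact: (cmeas_comp (cmeas_cpow_vline th s0) measurable_fst).
apply: cmeasM => //; apply: cmeasM.
  exact: (cmeas_comp (in_P_cmeas Pf) measurable_snd).
apply/cmeas_cexp/cmeasN/cmeasM; last by apply: cmeas_real; exact: measurable_snd.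
by apply: cmeasM => //; exact: cmeas_cst.
Qed.

Lemma cmeas_Kern theta f z : in_P f -> cmeas (Kern theta f z).
Proof.
move=> Pf; apply: cmeasM; first exact: cmeas_cst.
apply: cmeasM; first exact: in_P_cmeas.
apply/cmeas_cexp/cmeasN/cmeasM; first exact: cmeas_cst.
exact: cmeas_real.
Qed.

(** |z|^2 is at least t^2 and at least sigma0^2, hence (1 + sigma0^-2) |z|^2 >= 1 + t^2. Two powers
    of decay thus suffice for integrability on a line. *)
Lemma le_vline_cauchy (sigma0 sigma t : R) : 0 < sigma0 -> sigma0 <= sigma ->
  cmod (vline sigma t) ^- 2 <= (1 + sigma0 ^- 2) * cauchy t.
Proof.
move=> s0 ss; have sp : 0 < sigma by exact: lt_le_trans ss.
have m0 : 0 < cmod (vline sigma t) by rewrite cmod_gt0 vline_neq0.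
have h : 0 < 1 + t ^+ 2 by rewrite ltr_pwDl// sqr_ge0.
rewrite ler_pdivlMr// ler_pdivrMl ?exprn_gt0//.
rewrite mulrDr mulr1 addrC lerD//.
  by rewrite sqr_cmod/= lerDr sqr_ge0.
rewrite -expr_div_n exprn_ege1// ler_pdivlMr// mul1r (le_trans ss)//.
exact: cmod_vline_ge (ltW sp).
Qed.

Lemma cintegrable_Kern theta f z : in_P f -> 0 < Re z -> cintegrable setT (Kern theta f z).
Proof.
move=> Pf rz; have [n [e [d [C [_ d0 _ H]]]]] := Kern_le adm theta 0 rz.
apply: cintegrable_le (cmeas_Kern theta z Pf) _ (fun y => H f z y Pf (lexx _)).
exact/rintegrableZl/rintegrable_decay.
Qed.

Lemma LapQE theta f z : in_P f -> 0 < Re z ->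
  LapQ theta f z = cintegral setT (Kern theta f z).
Proof.
move=> Pf rz; rewrite /LapQ /Lap -cintegralZ//.
have := cintegrable_Kern 0 Pf rz; congr cintegrable; apply/funext => y.
by rewrite /Kern /cpow mul0r cexp0 mul1r.
Qed.

Lemma LapQ_le theta (N : nat) sigma0 : 0 < sigma0 ->
  exists n e C, [/\ 0 < e, 0 <= C & forall f z, in_P f -> sigma0 <= Re z ->
    cmod (LapQ theta f z) <= C * seminorm n e f * cmod z ^- N].
Proof.
move=> s0; have [n [e [d [C [e0 d0 C0 H]]]]] := Kern_le adm theta N s0.
have I0 : 0 <= \int[mu]_t decay d t by apply: Rintegral_ge0 => t _; exact: decay_ge0.
exists n, e, (2 * C * \int[mu]_t decay d t); split=> //.
  by rewrite !mulr_ge0.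
move=> f z Pf sz; rewrite LapQE//; last exact: lt_le_trans sz.
have := cmod_cintegral_le (cmeas_Kern theta z Pf) _ (fun y => H f z y Pf sz).
move=> /(_ (rintegrableZl _ (rintegrable_decay d0)))/le_trans; apply.
rewrite RintegralZl//; last exact: rintegrable_decay.
by rewrite le_eqVlt; apply/orP; left; apply/eqP; ring.
Qed.

Lemma cmod_cexp_vline sigma t x : cmod (cexp (vline sigma t * x%:C)) = expR (sigma * x).
Proof. by rewrite cmod_cexp ReM/= mulr0 subr0. Qed.

Lemma cmeas_cexp_vline sigma x : cmeas (fun t => cexp (vline sigma t * x%:C)).
Proof. by apply/cmeas_cexp/cmeasM; [exact: cmeas_vline|exact: cmeas_cst]. Qed.

(** Fubini's theorem yields, beside integrability, the measurability in [t] of a function defined by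
    an integral. *)
Let LapQ_line theta f sigma : in_P f -> 0 < sigma ->
  cintegrable setT (fun t => LapQ theta f (vline sigma t)).
Proof.
move=> Pf s0; have [n [e [d [C [e0 d0 C0 H]]]]] := Kern_le adm theta 2 s0.
pose F t y := Kern theta f (vline sigma t) y.
have [||] := @cintegral_exchange _ F
  (fun t => C * seminorm n e f * ((1 + sigma ^- 2) * cauchy t)) (decay d)
  (cmeas_Kern2 theta Pf s0) _ (rintegrable_decay d0).
- by apply/rintegrableZl/rintegrableZl; exact: rintegrable_cauchy.
- move=> t y; rewrite (le_trans (H f (vline sigma t) y Pf (lexx _)))//.
  rewrite ler_wpM2r ?decay_ge0// ler_wpM2l ?mulr_ge0 ?seminorm_ge0//.
  exact: le_vline_cauchy.
- move=> + _; congr cintegrable; apply/funext => t.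
  by rewrite LapQE.
Qed.

Lemma cmeas_LapQ theta f sigma : in_P f -> 0 < sigma ->
  cmeas (fun t => LapQ theta f (vline sigma t)).
Proof. by move=> Pf s0; exact/cintegrable_cmeas/LapQ_line. Qed.

Lemma LapQ_line_le theta f sigma : in_P f -> 0 < sigma ->
  exists2 C, 0 <= C & forall t, cmod (LapQ theta f (vline sigma t)) <= C * cauchy t.
Proof.
move=> Pf s0; have [n [e [C [e0 C0 H]]]] := LapQ_le theta 2 s0.
exists (C * seminorm n e f * (1 + sigma ^- 2)).
  by rewrite !mulr_ge0 ?seminorm_ge0// addr_ge0// invr_ge0 exprn_ge0// ltW.
move=> t; rewrite (le_trans (H f (vline sigma t) Pf (lexx _)))//.
rewrite -[X in _ <= X]mulrA ler_wpM2l ?mulr_ge0 ?seminorm_ge0//.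
exact: le_vline_cauchy.
Qed.

Lemma cintegrable_Hop theta f sigma x : in_P f -> 0 < sigma ->
  cintegrable setT (fun t => LapQ theta f (vline sigma t) * cexp (vline sigma t * x%:C)).
Proof.
move=> Pf s0; have [C C0 HC] := LapQ_line_le theta Pf s0.
apply: (@cintegrable_le _ _ (fun t => expR (sigma * x) * (C * cauchy t))).
- by apply: cmeasM; [exact: cmeas_LapQ|exact: cmeas_cexp_vline].
- by apply/rintegrableZl/rintegrableZl; exact: rintegrable_cauchy.
- by move=> t; rewrite cmodM cmod_cexp_vline mulrC ler_wpM2l ?expR_ge0.
Qed.

(** Fubini's theorem exchanges the contour integral with the integral in [y]. For y <= 0 the inner
    kernel integral is not controlled, but [f] vanishes there. *)
Lemma HopE theta f sigma x : in_P f -> 0 < sigma ->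
  cintegrable setT (fun y => f y *
    cintegral setT (fun t => Nker_integrand theta alpha a x y (vline sigma t))) /\
  Hop theta f sigma x = (2 * pi)^-1%:C * cintegral setT (fun y => f y *
    cintegral setT (fun t => Nker_integrand theta alpha a x y (vline sigma t))).
Proof.
move=> Pf s0; have [n [e [d [C [e0 d0 C0 H]]]]] := Kern_le adm theta 2 s0.
pose F t y := Kern theta f (vline sigma t) y * cexp (vline sigma t * x%:C).
have mF : cmeas (fun p : R * R => F p.1 p.2).
  apply: cmeasM; first exact: cmeas_Kern2.
  exact: (cmeas_comp (cmeas_cexp_vline sigma x) measurable_fst).
pose g1 t := expR (sigma * x) * (C * seminorm n e f * ((1 + sigma ^- 2) * cauchy t)).
have ig1 : rintegrable g1.
  by apply/rintegrableZl/rintegrableZl/rintegrableZl; exact: rintegrable_cauchy.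
have Fg t y : cmod (F t y) <= g1 t * decay d y.
  rewrite /F cmodM cmod_cexp_vline mulrC /g1 -(mulrA (expR _)) ler_wpM2l ?expR_ge0//.
  rewrite (le_trans (H f (vline sigma t) y Pf (lexx _)))//.
  rewrite ler_wpM2r ?decay_ge0// ler_wpM2l ?mulr_ge0 ?seminorm_ge0//.
  exact: le_vline_cauchy.
have [_ E] := cintegral_exchange mF ig1 (rintegrable_decay d0) Fg.
pose F' y t := F t y.
have mF' : cmeas (fun p : R * R => F' p.1 p.2).
  have ms : measurable_fun setT (fun p : R * R => (p.2, p.1)).
    by apply: measurable_fun_pair; [exact: measurable_snd|exact: measurable_fst].
  by have := cmeas_comp mF ms.
have Fg' y t : cmod (F' y t) <= decay d y * g1 t by rewrite mulrC; exact: Fg.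
have [I _] := cintegral_exchange mF' (rintegrable_decay d0) ig1 Fg'.
have E' : (fun y => cintegral setT (F' y)) = (fun y => f y *
    cintegral setT (fun t => Nker_integrand theta alpha a x y (vline sigma t))).
  apply/funext => y.
  have [y0|y0] := leP y 0.
    have f0 := in_P_eq0 Pf y0.
    rewrite f0 mul0r -[RHS](@cintegral0 R); apply: eq_cintegral => t _.
    by rewrite /F' /F /Kern f0 mul0r mulr0 mul0r.
  rewrite -cintegralZ; last exact: cintegrable_Nker_line.
  apply: eq_cintegral => t _.
  rewrite /F' /F /Kern /Nker_integrand cexpD; ring.
split; first by rewrite -E'.
rewrite /Hop -E' -E; apply: (congr1 ( *%R _)).
apply: eq_cintegral => t _.
have rz : 0 < Re (vline sigma t) by [].
rewrite (LapQE theta Pf rz) mulrC -(cintegralZ _ (cintegrable_Kern theta Pf rz)).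
by apply: eq_cintegral => y _; rewrite mulrC.
Qed.

Lemma Hop_indep theta f sigma sigma' x : in_P f -> 0 < sigma -> 0 < sigma' ->
  Hop theta f sigma x = Hop theta f sigma' x.
Proof.
move=> Pf s0 s'0; rewrite (HopE theta x Pf s0).2 (HopE theta x Pf s'0).2.
apply: (congr1 ( *%R _)); apply: eq_cintegral => y _.
have [y0|y0] := leP y 0.
  by rewrite (in_P_eq0 Pf y0) !mul0r.
by rewrite (cintegral_Nker_shift adm theta x y0 s0 s'0).
Qed.

Lemma Hop_Nker theta f sigma x : in_P f -> 0 < sigma -> -1 < Re theta ->
  cintegrable setT (fun y => Nker theta alpha a x y * f y) /\
  Hop theta f sigma x = cintegral setT (fun y => Nker theta alpha a x y * f y).
Proof.
move=> Pf s0 th; have [I ->] := HopE theta x Pf s0.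
have E : (fun y => Nker theta alpha a x y * f y) = (fun y => (2 * pi)^-1%:C * (f y *
    cintegral setT (fun t => Nker_integrand theta alpha a x y (vline sigma t)))).
  apply/funext => y; have [y0|y0] := leP y 0.
    by rewrite (in_P_eq0 Pf y0) mul0r !mulr0.
  by rewrite (NkerE adm x th y0 s0); ring.
by rewrite E; split; [exact: cintegrableZ|rewrite cintegralZ].
Qed.

(** With [Hop_indep] this makes the growth rate as small as desired, with one seminorm of [f] in
    front, as continuity demands. *)
Lemma Hop_le theta sigma : 0 < sigma ->
  exists n e C, [/\ 0 < e, 0 <= C & forall f x, in_P f ->
    cmod (Hop theta f sigma x) <= C * seminorm n e f * expR (sigma * x)].
Proof.
move=> s0; have [n [e [C [e0 C0 H]]]] := LapQ_le theta 2 s0.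
have pi2 : 0 <= (2 * pi)^-1 :> R by rewrite invr_ge0 mulr_ge0// pi_ge0.
have I0 : 0 <= \int[mu]_t cauchy t by apply: Rintegral_ge0 => t _; rewrite ltW// cauchy_gt0.
exists n, e, ((2 * pi)^-1 * (2 * (C * (1 + sigma ^- 2) * \int[mu]_t cauchy t))); split=> //.
  by rewrite !mulr_ge0// addr_ge0// invr_ge0 exprn_ge0// ltW.
move=> f x Pf; rewrite /Hop cmodM cmodC ger0_norm// -!(mulrA (2 * pi)^-1) ler_wpM2l//.
apply: le_trans.
  apply: (@cmod_cintegral_le _ _
    (fun t => expR (sigma * x) * (C * seminorm n e f * ((1 + sigma ^- 2) * cauchy t)))).
  - by apply: cmeasM; [exact: cmeas_LapQ|exact: cmeas_cexp_vline].
  - by apply/rintegrableZl/rintegrableZl/rintegrableZl; exact: rintegrable_cauchy.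
  - move=> t; rewrite cmodM cmod_cexp_vline mulrC ler_wpM2l ?expR_ge0//.
    rewrite (le_trans (H f (vline sigma t) Pf (lexx _)))//.
    rewrite ler_wpM2l ?mulr_ge0 ?seminorm_ge0//.
    exact: le_vline_cauchy.
rewrite RintegralZl//; last first.
  by apply/rintegrableZl/rintegrableZl; exact: rintegrable_cauchy.
rewrite RintegralZl//; last by apply/rintegrableZl; exact: rintegrable_cauchy.
rewrite RintegralZl//; last exact: rintegrable_cauchy.
by rewrite le_eqVlt; apply/orP; left; apply/eqP; ring.
Qed.

(* Moving the line of integration to the right kills [Hop] on [x <= 0]. *)
Lemma Hop_le0 theta f sigma x : in_P f -> 0 < sigma -> x <= 0 ->
  Hop theta f sigma x = 0.
Proof.
move=> Pf s0 x0; apply/eqP; rewrite -cmod_eq0 eq_le cmod_ge0 andbT.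
(* Decay of order 3: two powers of |z| make the integral converge, the third gives the factor 1 /
   s. *)
have [n [e [C [e0 C0 H]]]] := LapQ_le theta 3 ltr01.
have S0 := seminorm_ge0 n Pf e0.
have I0 : 0 <= \int[mu]_t cauchy t by apply: Rintegral_ge0 => t _; rewrite ltW// cauchy_gt0.
have pi2 : 0 <= (2 * pi)^-1 :> R by rewrite invr_ge0 mulr_ge0// pi_ge0.
pose D := (2 * pi)^-1 * (2 * (C * seminorm n e f * 2 * \int[mu]_t cauchy t)).
have D0 : 0 <= D by rewrite !mulr_ge0.
have key s : 1 <= s -> cmod (Hop theta f sigma x) <= D / s.
  move=> s1; have sp : 0 < s by exact: lt_le_trans s1.
  rewrite (Hop_indep theta x Pf s0 sp) /Hop cmodM cmodC ger0_norm// /D.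
  rewrite -(mulrA (2 * pi)^-1) ler_wpM2l//.
  apply: le_trans.
    apply: (@cmod_cintegral_le _ _
      (fun t => (C * seminorm n e f * 2 / s) * cauchy t)).
    - by apply: cmeasM; [exact: cmeas_LapQ|exact: cmeas_cexp_vline].
    - by apply/rintegrableZl; exact: rintegrable_cauchy.
    - move=> t; rewrite cmodM cmod_cexp_vline.
      have m0 : 0 < cmod (vline s t) by rewrite cmod_gt0 vline_neq0.
      apply: (@le_trans _ _ (C * seminorm n e f * cmod (vline s t) ^- 3 * 1)).
        rewrite ler_pM ?cmod_ge0 ?expR_ge0 ?H//.
        by rewrite -expR0 ler_expR mulr_ge0_le0// ltW.
      rewrite mulr1 -!(mulrA (C * _)) ler_wpM2l ?mulr_ge0//.
      rewrite exprSr invfM [leRHS]mulrAC ler_pM ?invr_ge0 ?exprn_ge0 ?(ltW m0)//.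
        rewrite (le_trans (le_vline_cauchy t ltr01 s1))//.
        by rewrite expr1n invr1.
      by rewrite lef_pV2 ?posrE// cmod_vline_ge// ltW.
  rewrite RintegralZl//; last exact: rintegrable_cauchy.
  by rewrite le_eqVlt; apply/orP; left; apply/eqP; ring.
rewrite leNgt; apply/negP => c0.
(* At this [s] the bound D / s is smaller than the modulus that it should dominate. *)
have := key (1 + D / cmod (Hop theta f sigma x)).
have q0 : 0 <= D / cmod (Hop theta f sigma x) by rewrite divr_ge0// ltW.
rewrite lerDl => /(_ q0); apply/negP; rewrite -ltNge.
rewrite ltr_pdivrMr; last by rewrite ltr_pwDl.
by rewrite mulrDr mulr1 mulrC divfK ?gt_eqF// ltrDr.
Qed.

Lemma LapQ_add1 theta f z : z != 0 -> LapQ (theta + 1) f z = z * LapQ theta f z.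
Proof. by move=> z0; rewrite /LapQ /= cpowD cpow1//; ring. Qed.

(** Differentiation in [x] multiplies the transform by z, that is, raises theta by 1. *)
Lemma cder_Hop theta f sigma x : in_P f -> 0 < sigma ->
  cder (Hop theta f sigma) x (Hop (theta + 1) f sigma x).
Proof.
move=> Pf s0; have [C C0 HC] := LapQ_line_le (theta + 1) Pf s0.
apply: cderMl.
apply: (@cder_under_integral _
  (fun x t => LapQ theta f (vline sigma t) * cexp (vline sigma t * x%:C))
  (fun x t => LapQ (theta + 1) f (vline sigma t) * cexp (vline sigma t * x%:C))
  (fun t => expR (sigma * (x + 1)) * (C * cauchy t)) x (x - 1) (x + 1)).
- by rewrite in_itv/= ltrDl ltr01 gtrBl ltr01.
- by move=> y _; exact: cintegrable_Hop.
- move=> y t _; rewrite LapQ_add1 ?vline_neq0//.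
  apply: cder_eq (cderMl _ (cder_cexp (cderMl (vline sigma t) (cder_id y)))) _.
  by rewrite mulr1; ring.
- by apply/rintegrableZl/rintegrableZl; exact: rintegrable_cauchy.
- move=> y t yI; have yx : y <= x + 1.
    by move: yI; rewrite in_itv/= => /andP[_ /ltW].
  rewrite cmodM cmod_cexp_vline mulrC ler_pM ?expR_ge0 ?cmod_ge0//.
  by rewrite ler_expR ler_wpM2l// ltW.
Qed.

Lemma in_P_Hop theta f sigma : in_P f -> 0 < sigma -> in_P (Hop theta f sigma).
Proof.
move=> Pf s0.
rewrite (_ : Hop theta f sigma = (fun m : nat => Hop (theta + m%:R) f sigma) 0%N); last first.
  by rewrite /= addr0.
apply: (@in_P_chain _ (fun m : nat => Hop (theta + m%:R) f sigma)).
- by move=> m x; rewrite -natr1 addrA; exact: cder_Hop.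
- by move=> m x; exact: Hop_le0.
- move=> m e e0; have [n [e' [C [e'0 C0 H]]]] := Hop_le (theta + m%:R) e0.
  exists (C * seminorm n e' f) => x x0.
  (* The line is moved to Re z = e to obtain the rate [e]. *)
  by rewrite (Hop_indep _ x Pf s0 e0) H.
Qed.

Lemma hderivn_Hop theta f sigma m x : in_P f -> 0 < sigma -> 0 <= x ->
  hderivn m (Hop theta f sigma) x = Hop (theta + m%:R) f sigma x.
Proof.
move=> Pf s0 x0; rewrite -[in LHS](addr0 theta).
apply: (@hderivn_chain _ (fun m : nat => Hop (theta + m%:R) f sigma) _ m x x0).1.
by move=> k y; rewrite -natr1 addrA; exact: cder_Hop.
Qed.

Lemma HopB theta f g sigma x : in_P f -> in_P g -> 0 < sigma ->
  Hop theta f sigma x - Hop theta g sigma x = Hop theta (fun y => f y - g y) sigma x.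
Proof.
move=> Pf Pg s0; rewrite /Hop -mulrBr -cintegralB; try exact: cintegrable_Hop.
apply: (congr1 ( *%R _)); apply: eq_cintegral => t _; rewrite -mulrBl.
have rz : 0 < Re (vline sigma t) by [].
rewrite (LapQE theta Pf rz) (LapQE theta Pg rz) (LapQE theta (in_PB Pf Pg) rz).
apply: (congr1 ( *%R^~ _)).
rewrite -(cintegralB (cintegrable_Kern theta Pf rz) (cintegrable_Kern theta Pg rz)).
by apply: eq_cintegral => y _; rewrite /Kern; ring.
Qed.

End LaplaceOperator.

(** * Repeated integration and Taylor's formula *)

Section RepeatedIntegration.
Variable R : realType.
Local Notation mu := (@lebesgue_measure R).
Implicit Types (x y t sigma : R) (f g : R -> R[i]) (G : nat -> R -> R[i]).

Lemma cintegral_FTC f g (p q : R) : p < q ->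
  (forall t, cder f t (g t)) -> (forall t, ccont g t) ->
  cintegral `[p, q] g = f q - f p.
Proof.
move=> pq df cg; apply: complex_eq; rewrite !reimE.
  apply: (Rintegral_FTC (u := fun t => Re (f t))) => // t _.
    by case: (df t).
  by case: (cg t).
apply: (Rintegral_FTC (u := fun t => Im (f t))) => // t _.
  by case: (df t).
by case: (cg t).
Qed.

Definition taylor_weight x k y : R := (x - y) ^+ k / k`!%:R.

Let is_derive_subX x k y :
  is_derive y 1 (fun y => (x - y) ^+ k) (- (k%:R * (x - y) ^+ k.-1)).
Proof.
have d1 : is_derive y 1 (fun y => x - y) (-1) by apply: is_derive_eq; ring.
have := is_deriveX k d1; rewrite exprfctE => d2; apply: (is_derive_eq d2).
by rewrite /GRing.scale/=; ring.
Qed.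

Let is_derive_weight x k y :
  is_derive y 1 (taylor_weight x k.+1) (- taylor_weight x k y).
Proof.
rewrite /taylor_weight.
have d2 := is_derive_subX x k.+1 y.
have d3 : is_derive y 1 (fun y => (x - y) ^+ k.+1 / (k.+1)`!%:R)
    (- (k.+1%:R * (x - y) ^+ k) / (k.+1)`!%:R).
  by apply: is_derive_eq; rewrite /GRing.scale/=; ring.
apply: is_derive_eq; rewrite factS natrM.
by field; rewrite nat1r !pnatr_eq0 -lt0n fact_gt0.
Qed.

(* The Taylor polynomial of [G 0] at the moving base point [y], evaluated at
   [x]; its derivative in [y] telescopes. *)
Definition taylor_sum G x n y : R[i] :=
  \sum_(k < n) G k y * (taylor_weight x k y)%:C.

Lemma cder_taylor_sum G x n y : (forall m x, cder (G m) x (G m.+1 x)) ->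
  cder (taylor_sum G x n.+1) y (G n.+1 y * (taylor_weight x n y)%:C).
Proof.
move=> dG; elim: n => [|n IH].
  rewrite (_ : taylor_sum G x 1 = G 0%N).
    by rewrite /taylor_weight expr0 fact0 divr1 mulr1.
  apply/funext => s.
  by rewrite /taylor_sum big_ord_recl big_ord0 /taylor_weight expr0 fact0 divr1 mulr1 addr0.
rewrite (_ : taylor_sum G x n.+2 =
  fun y => taylor_sum G x n.+1 y + G n.+1 y * (taylor_weight x n.+1 y)%:C); last first.
  by apply/funext => s; rewrite /taylor_sum big_ord_recr.
apply: cder_eq (cderD IH (cderM (dG n.+1 y) (cder_real (is_derive_weight x n y)))) _.
by apply: complex_eq; rewrite !reimE; ring.
Qed.

(** Taylor's formula with integral remainder: the moving sum is [G 0 x] at y = x, and 0 at y = 0 by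
    flatness. For x <= 0 the domain of integration is a point or empty. *)
Lemma Jint_chain G n : (0 < n)%N -> (forall m x, cder (G m) x (G m.+1 x)) ->
  (forall m x, x <= 0 -> G m x = 0) -> Jint n (G n) = G 0%N.
Proof.
case: n => // n _ dG G0; apply/funext => x; rewrite /Jint /=.
have [x0|x0] := leP x 0.
  rewrite G0// (_ : cintegral _ _ = 0) ?mulr0//.
  rewrite /cintegral; move: x0; rewrite le_eqVlt => /orP[/eqP ->|x0].
    by rewrite set_itv1 !Rintegral_set1.
  by rewrite set_itv_ge ?Rintegral_set0// bnd_simp -ltNge.
pose c : R[i] := (n`!%:R : R)%:C.
have c0 : c != 0 by rewrite -cmod_eq0 cmodC normr_eq0 pnatr_eq0 -lt0n fact_gt0.
have cE : n`!%:R = c by rewrite /c rmorph_nat.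
rewrite cE (@cintegral_FTC (fun y => c * taylor_sum G x n.+1 y))//; last 2 first.
- move=> t; apply: cder_eq (cderMl c (cder_taylor_sum x n t dG)) _.
  rewrite mulrCA; congr (_ * _); rewrite /c -rmorphM/=; congr _%:C.
  by rewrite /taylor_weight mulrC divfK// pnatr_eq0 -lt0n fact_gt0.
- move=> t; apply: ccontM; first exact: cder_ccont (dG n.+1 t).
  split; last exact: cst_continuous.
  by have [/derivable1_diffP/differentiable_continuous] := is_derive_subX x n t.
rewrite -mulrBr mulKf// (_ : taylor_sum G x n.+1 0 = 0) ?subr0.
  rewrite /taylor_sum big_ord_recl/= /taylor_weight expr0 fact0 divr1 mulr1.
  rewrite big1 ?addr0// => k _.
  by rewrite subrr exprS mul0r mul0r mulr0.
by rewrite /taylor_sum big1// => k _; rewrite G0// mul0r.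
Qed.

End RepeatedIntegration.

(** * Identification of the operators with Bromwich integrals *)

Section QtildeLaplace.
Variable R : realType.
Local Notation mu := (@lebesgue_measure R).
Variables (a : R[i]) (alpha : R).
Hypothesis adm : admissible alpha a.
Implicit Types (theta z : R[i]) (x y t sigma : R) (f g : R -> R[i]).

Lemma cintegral_half_line g : (forall y, y < 0 -> g y = 0) ->
  cintegral `[0, +oo[ g = cintegral setT g.
Proof.
move=> g0; have E (p : R[i] -> R) (p0 : p 0 = 0) :
    \int[mu]_(y in `[0, +oo[) p (g y) = \int[mu]_y p (g y).
  rewrite Rintegral_mkcond; apply: eq_Rintegral => y _.
  rewrite patchE mem_setE in_itv/= andbT; case: leP => // /g0 ->.
  by rewrite p0.
by rewrite /cintegral !E.
Qed.

Lemma cintegrable_subset g (D : set R) : measurable D -> cintegrable setT g ->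
  cintegrable D g.
Proof.
by move=> mD [g1 g2]; split; [move: g1|move: g2]; apply: integrableS.
Qed.

Lemma ReDn theta n : Re (theta + n%:R) = Re theta + n%:R.
Proof. by rewrite ReD (_ : Re n%:R = n%:R)// -(rmorph_nat (real_complex R)). Qed.

(** The limit defining the value at 0 exists and agrees because the Bromwich integral is continuous
    there. *)
Lemma QintE theta f : -1 < Re theta -> in_P f ->
  Qint theta alpha a f = Hop a alpha theta f 1.
Proof.
move=> th Pf; rewrite /Qint.
have gE x : cintegral `[0, +oo[ (fun y => Nker theta alpha a x y * f y) =
    Hop a alpha theta f 1 x.
  rewrite (Hop_Nker adm x Pf ltr01 th).2 cintegral_half_line// => y y0.
  by rewrite -(hext0E Pf) (hext_le0 Pf) ?mulr0// ltW.
apply/funext => x; rewrite /extend_half_line.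
case: ifPn => [/ltW x0|_]; first by rewrite Hop_le0.
case: eqVneq => [->|_]; last exact: gE.
have [c1 c2] := cder_ccont (cder_Hop adm theta 0 Pf ltr01).
have c : ((cintegral `[0, +oo[ (fun u => Nker theta alpha a y u * f u) : R[i]^o)
    @[y --> 0^'+]) --> (Hop a alpha theta f 1 0 : R[i]^o).
  apply/ccvgP/ccvg_ReIm; split; apply: cvg_at_right_filter.
    by under eq_fun do rewrite gE; exact: c1.
  by under eq_fun do rewrite gE; exact: c2.
by apply: cvg_lim c; exact: norm_hausdorff.
Qed.

(** The Bromwich integrals for theta + m are successive derivatives vanishing for x <= 0, so [n]
    integrations bring theta + n back to theta. The right-hand side is free of [n]. *)
Lemma Jint_Qint theta n f : (0 < n)%N -> -1 < Re theta + n%:R -> in_P f ->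
  Jint n (Qint (theta + n%:R) alpha a f) = Hop a alpha theta f 1.
Proof.
move=> n0 th Pf; rewrite QintE// ?ReDn//.
rewrite (@Jint_chain _ (fun m : nat => Hop a alpha (theta + m%:R) f 1))// ?addr0//.
- by move=> m x; rewrite -natr1 addrA; exact: cder_Hop.
- by move=> m x; exact: Hop_le0.
Qed.

Lemma JorderP theta : -1 < Re theta + (Jorder theta)%:R.
Proof.
have : `|Re theta| < (Jorder theta)%:R by exact: truncnS_gt.
rewrite ltr_norml => /andP[h _]; lra.
Qed.

Lemma QtildeE theta f : in_P f -> Qtilde theta alpha a f = Hop a alpha theta f 1.
Proof.
move=> Pf; rewrite /Qtilde; case: ifPn => [th|_]; first exact: QintE.
by apply: Jint_Qint => //; exact: JorderP.
Qed.

End QtildeLaplace.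

(** * Inversion of the Laplace transform *)

Section PoissonKernel.
Variable R : realType.
Local Notation mu := (@lebesgue_measure R).
Implicit Types (x y t d tau : R) (u : R -> R) (phi : R -> R[i]).

Lemma integral_cauchy : \int[mu]_t cauchy t = pi.
Proof.
apply: (@rintegral_FTC _ predT atan _ (fun n => - n.+1%:R) (fun n => n.+1%:R)) => //.
- exact: rintegrable_cauchy.
- by move=> n; rewrite gtrN.
- by move=> t _; exact: near_ninfty_itv.
- by move=> n t _; exact: continuous_cauchy.
have h : atan (n.+1%:R : R) @[n --> \oo] --> pi / 2.
  apply: (cvg_comp _ _ _ (@cvgy_atan R)).
  by apply/cvgryPge => A; near=> n; rewrite (@le_trans _ _ n%:R)// ?ler_nat//;
     near: n; exact: nbhs_infty_ger.
rewrite [X in _ --> X](splitr pi).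
under eq_fun do rewrite atanN opprK.
exact: cvgD.
Unshelve. all: by end_near. Qed.

(** Poisson kernel of the half-plane without the factor 1 / pi: its mass is pi. *)
Definition poisson d tau t : R := d / (d ^+ 2 + (t - tau) ^+ 2).

Lemma poisson_gt0 d tau t : 0 < d -> 0 < poisson d tau t.
Proof. by move=> d0; rewrite divr_gt0// ltr_pwDl ?sqr_ge0// exprn_gt0. Qed.

Lemma continuous_poisson d tau : 0 < d -> continuous (poisson d tau).
Proof.
move=> d0 t.
apply: (@continuousM _ _ (fun=> d) (fun t => (d ^+ 2 + (t - tau) ^+ 2)^-1)).
  exact: cst_continuous.
apply: continuousV; first by rewrite gt_eqF// ltr_pwDl ?sqr_ge0// exprn_gt0.
apply: (@continuousD _ _ _ (fun=> d ^+ 2) (fun t => (t - tau) ^+ 2)).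
  exact: cst_continuous.
apply: (@continuous_comp _ _ _ (fun t => t - tau) (fun s => s ^+ 2)).
  by apply: (@continuousB _ _ _ id (fun=> tau)) => //; exact: cst_continuous.
exact: exprn_continuous.
Qed.

Lemma ge0_integral_poisson u d tau : 0 < d -> continuous u -> (forall t, 0 <= u t) ->
  (\int[mu]_t (u t * poisson d tau t)%:E =
   \int[mu]_s (u (tau + d * s) * cauchy s)%:E)%E.
Proof.
move=> d0 cu u0; pose F s := tau + d * s.
have dF (s : R) : is_derive s 1 F d.
  by apply: is_derive_eq; rewrite /GRing.scale/=; ring.
have F' : derive1 F = cst d by apply/funext => s; rewrite derive1E; case: (dF s).
rewrite (@increasing_ge0_integration_by_substitutionT _ F).
- apply: eq_integral => s _; congr EFin.
  rewrite F' /= -[LHS]mulrA; congr (_ * _).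
  rewrite /poisson /F /cauchy addrAC subrr add0r /cst; field.
  apply/andP; split.
    by rewrite gt_eqF// ltr_pwDl ?sqr_ge0.
  by rewrite gt_eqF// ltr_pwDl ?sqr_ge0// exprn_gt0.
- by move=> s1 s2 s12; rewrite /F ltrD2l ltr_pM2l.
- by rewrite F'; exact: cst_continuous.
- by rewrite F'; exact: is_cvg_cst.
- by rewrite F'; exact: is_cvg_cst.
- by move=> s; case: (dF s).
- apply/cvgrNyPle => A.
  apply: filterS (nbhs_ninfty_le (num_real (d^-1 * (A - tau)))) => s.
  by rewrite /F -lerBrDl ler_pdivlMl.
- apply/cvgryPge => A.
  apply: filterS (nbhs_pinfty_ge (num_real (d^-1 * (A - tau)))) => s.
  by rewrite /F -lerBlDl ler_pdivrMl.
- move=> t; apply: (@continuousM _ _ u (poisson d tau)); first exact: cu.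
  exact: continuous_poisson.
- by move=> t; rewrite mulr_ge0// ltW// poisson_gt0.
Qed.

Lemma rintegrable_poisson d tau : 0 < d -> rintegrable (poisson d tau).
Proof.
move=> d0; apply/integrableP; split.
  apply/measurable_EFinP; apply: continuous_measurable_fun.
  exact: continuous_poisson.
have := @ge0_integral_poisson (fun=> 1) d tau d0 (@cst_continuous _ _ _) (fun=> ler01).
under eq_integral do rewrite mul1r.
under [in X in _ = X -> _]eq_integral do rewrite mul1r.
move=> E; under eq_integral do rewrite /= ger0_norm ?(ltW (poisson_gt0 _ _ d0))//.
rewrite E -ge0_fin_numE; first exact: (integrable_fin_num _ (@rintegrable_cauchy R)).
by apply: integral_ge0 => t _; rewrite lee_fin ltW// cauchy_gt0.
Qed.

Lemma rintegrable_bounded_mul u (k : R -> R) (M : R) : continuous u ->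
  (forall t, `|u t| <= M) -> rintegrable k -> (forall t, 0 <= k t) ->
  rintegrable (fun t => u t * k t).
Proof.
move=> cu uM ik k0; apply: (@le_rintegrable _ _ (fun t => M * k t)).
- apply: measurable_funM; last exact: rintegrable_meas.
  exact: continuous_measurable_fun.
- exact: rintegrableZl.
- by move=> t; rewrite normrM (ger0_norm (k0 t)) ler_wpM2r.
Qed.

(** The substitution t = tau + d s has been made for nonnegative functions; adding the constant [M]
    reduces to that case, and its contribution is subtracted afterwards. *)
Lemma integral_poisson u (M : R) d tau : 0 < d -> continuous u ->
  (forall t, `|u t| <= M) ->
  \int[mu]_t (u t * poisson d tau t) = \int[mu]_s (u (tau + d * s) * cauchy s).
Proof.
move=> d0 cu uM.
have cF : continuous (fun s => u (tau + d * s)).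
  move=> s; apply: (@continuous_comp _ _ _ (fun s => tau + d * s) u); last exact: cu.
  apply: (@continuousD _ _ _ (fun=> tau) (fun s => d * s)); first exact: cst_continuous.
  exact: mulrl_continuous.
have ge0E (v : R -> R) : continuous v -> (forall t, 0 <= v t) ->
    \int[mu]_t (v t * poisson d tau t) = \int[mu]_s (v (tau + d * s) * cauchy s).
  by move=> cv v0; rewrite /Rintegral ge0_integral_poisson.
have p0 t : 0 <= poisson d tau t by rewrite ltW// poisson_gt0.
have c0 (t : R) : 0 <= cauchy t by rewrite ltW// cauchy_gt0.
have ip := rintegrable_poisson tau d0; have ic := @rintegrable_cauchy R.
have M0 : 0 <= M by exact: le_trans (uM 0).
have E1 := @ge0E (fun t => u t + M) _ _.
have E2 := @ge0E (fun=> M) (@cst_continuous _ _ _) (fun=> M0).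
have : \int[mu]_t (u t * poisson d tau t) + \int[mu]_t (M * poisson d tau t) =
       \int[mu]_s (u (tau + d * s) * cauchy s) + \int[mu]_s (M * cauchy s).
  rewrite -!RintegralD//; try exact: rintegrableZl.
  - under eq_Rintegral do rewrite -mulrDl.
    under [RHS]eq_Rintegral do rewrite -mulrDl.
    apply: E1.
      by move=> t; apply: (@continuousD _ _ _ u (fun=> M)); [exact: cu|exact: cst_continuous].
    by move=> t; rewrite -lerBlDr sub0r; have := uM t; rewrite ler_norml => /andP[].
  - exact: (rintegrable_bounded_mul cF (fun s => uM (tau + d * s))).
  - exact: (rintegrable_bounded_mul cu uM).
by rewrite E2 => /addIr.
Qed.

(* Poisson's approximate identity, along the widths [1 / (n + 1)]. *)
Lemma cvg_poisson phi (M : R) tau : (forall t, ccont phi t) ->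
  (forall t, cmod (phi t) <= M) ->
  let I n := cintegral setT (fun t => phi t * (poisson n.+1%:R^-1 tau t)%:C) in
  (Re (I n) @[n --> \oo] --> pi * Re (phi tau)) /\
  (Im (I n) @[n --> \oo] --> pi * Im (phi tau)).
Proof.
move=> cphi phiM I; pose s n : R := n.+1%:R^-1.
have s0 n : 0 < s n by rewrite invr_gt0.
have aux (u : R -> R) : continuous u -> (forall t, `|u t| <= M) ->
    \int[mu]_t (u t * poisson (s n) tau t) @[n --> \oo] --> pi * u tau.
  move=> cu uM.
  rewrite (_ : (fun n => _) = (fun n => \int[mu]_r (u (tau + s n * r) * cauchy r))); last first.
    by apply/funext => n; exact: integral_poisson uM.
  rewrite -integral_cauchy mulrC -RintegralZl//; last exact: rintegrable_cauchy.
  have c0 (t : R) : 0 <= cauchy t by rewrite ltW// cauchy_gt0.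
  have [||||_] := @rintegral_dominated _ (fun n r => u (tau + s n * r) * cauchy r)
    (fun r => u tau * cauchy r) (fun r => M * cauchy r); last by [].
  - move=> n; apply: measurable_funM; last exact: (rintegrable_meas (@rintegrable_cauchy R)).
    apply: continuous_measurable_fun => r.
    apply: (@continuous_comp _ _ _ (fun r => tau + s n * r) u); last exact: cu.
    apply: (@continuousD _ _ _ (fun=> tau) (fun r => s n * r)); first exact: cst_continuous.
    exact: mulrl_continuous.
  - by apply: rintegrableZl; exact: rintegrable_cauchy.
  - by move=> n t; rewrite normrM (ger0_norm (c0 t)) ler_wpM2r.
  - move=> t; apply: cvgMl.
    have c1 : s n * t @[n --> \oo] --> (0 : R).
      by rewrite -[X in _ --> X](mul0r t); apply: cvgMl; exact: cvg_harmonic.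
    have c2 : tau + s n * t @[n --> \oo] --> tau.
      by rewrite -[X in _ --> X](addr0 tau); apply: cvgD; [exact: cvg_cst|exact: c1].
    exact: (cvg_comp _ _ c2 (cu tau)).
split.
  rewrite (_ : (fun n => _) =
    (fun n => \int[mu]_t (Re (phi t) * poisson (s n) tau t))).
    by apply: aux => t; [case: (cphi t)|exact: le_trans (Re_le_cmod _) (phiM t)].
  by apply/funext => n; apply: eq_Rintegral => t _; rewrite ReM ReC ImC mulr0 subr0.
rewrite (_ : (fun n => _) =
  (fun n => \int[mu]_t (Im (phi t) * poisson (s n) tau t))).
  by apply: aux => t; [case: (cphi t)|exact: le_trans (Im_le_cmod _) (phiM t)].
by apply/funext => n; apply: eq_Rintegral => t _; rewrite ImM ReC ImC mulr0 add0r.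
Qed.

End PoissonKernel.

Section ExponentialHalfLine.
Variable R : realType.
Local Notation mu := (@lebesgue_measure R).
Implicit Types (x y t : R) (w : R[i]) (F : R -> R -> R[i]).

Lemma ccont_under_integral F (h : R -> R) (p u v : R) : p \in `]u, v[ ->
  (forall x, x \in `]u, v[ -> cintegrable setT (F x)) ->
  (forall t x, ccont (F ^~ t) x) -> rintegrable h ->
  (forall x t, x \in `]u, v[ -> cmod (F x t) <= h t) ->
  ccont (fun x => cintegral setT (F x)) p.
Proof.
move=> puv iF cF ih Fh; split.
  apply: (@continuity_under_integral _ _ _ mu (fun x t => Re (F x t)) setT
    measurableT u v _ _ h ih) => //.
  - by move=> x xuv; case: (iF x xuv).
  - by apply: aeW => t _ x _; case: (cF t x).
  - by move=> x xuv; apply: aeW => t _; exact: le_trans (Re_le_cmod _) (Fh x t xuv).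
  - exact/mem_set.
apply: (@continuity_under_integral _ _ _ mu (fun x t => Im (F x t)) setT
  measurableT u v _ _ h ih) => //.
- by move=> x xuv; case: (iF x xuv).
- by apply: aeW => t _ x _; case: (cF t x).
- by move=> x xuv; apply: aeW => t _; exact: le_trans (Im_le_cmod _) (Fh x t xuv).
- exact/mem_set.
Qed.

Definition heaviside x : R[i] := if 0 < x then 1 else 0.

Lemma measurable_gt0 : measurable_fun setT (fun x : R => 0 < x).
Proof. exact: measurable_fun_ltr. Qed.

Lemma cmeas_heaviside : cmeas heaviside.
Proof.
rewrite /heaviside; split.
  rewrite (_ : (fun t => _) = (fun t : R => if 0 < t then 1 else 0)).
    apply: measurable_fun_ifT => //; exact: measurable_gt0.
  by apply/funext => t; case: ifP.
rewrite (_ : (fun t => _) = (fun t : R => 0)) //.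
by apply/funext => t; case: ifP.
Qed.

(** Its integral is 1 / w for Re w > 0; it serves to write both halves of the Poisson kernel as
    integrals over x > 0. *)
Definition hexp w x : R[i] := heaviside x * cexp (- (w * x%:C)).

Lemma cmod_hexp w x : cmod (hexp w x) = decay (Re w) x.
Proof.
rewrite /hexp /heaviside /decay; case: ifP => _.
  by rewrite mul1r cmod_cexp ReN ReM ReC ImC mulr0 subr0.
by rewrite mul0r cmodC normr0.
Qed.

Lemma cmeas_hexp w : cmeas (hexp w).
Proof.
apply: cmeasM; first exact: cmeas_heaviside.
apply/cmeas_cexp/cmeasN/cmeasM; first exact: cmeas_cst.
exact: cmeas_real.
Qed.

Lemma cintegrable_hexp w : 0 < Re w -> cintegrable setT (hexp w).
Proof.
move=> w0; apply: (cintegrable_le (cmeas_hexp w) (rintegrable_decay w0)) => t.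
by rewrite cmod_hexp.
Qed.

Let cder_exp w t : cder (fun x => - w^-1 * cexp (- (w * x%:C))) t
  (w^-1 * w * cexp (- (w * t%:C))).
Proof.
have d := cder_cexp (cderN (cderMl w (cder_id t))).
by apply: cder_eq (cderMl (- w^-1) d) _; rewrite mulr1 mulrA mulrNN.
Qed.

Lemma cintegral_hexp w : 0 < Re w -> cintegral setT (hexp w) = w^-1.
Proof.
move=> w0; have wn : w != 0 by apply: contraTneq w0 => ->; rewrite ltxx.
have [i1 i2] := cintegrable_hexp w0.
pose U x := - w^-1 * cexp (- (w * x%:C)).
have dU t : 0 < t -> cder U t (hexp w t).
  move=> tp; apply: cder_eq (cder_exp w t) _.
  by rewrite mulVf// /hexp /heaviside tp.
have cH t : 0 < t -> ccont (hexp w) t.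
  move=> tp.
  have c := cder_ccont (cder_cexp (cderN (cderMl w (cder_id t)))).
  have c1 : ccont heaviside t.
    apply: (@cder_ccont _ _ _ 0); apply: cder_near (cder_cst 1 t).
    by apply: filterS (lt_nbhsr tp) => s; rewrite /heaviside => ->.
  by have := ccontM c1 c.
have U0 : U 0 = - w^-1 by rewrite /U mulr0 oppr0 cexp0 mulr1.
have cU := cder_ccont (cder_exp w 0).
have [la1 la2] := cvg_ccont cU (@cvg_harmonic R).
have Ule n : cmod (U n.+2%:R) <= cmod w^-1 * expR (- (Re w * n.+2%:R)).
  by rewrite /U cmodM cmodN cmod_cexp ReN ReM ReC ImC mulr0 subr0.
have b0 : cmod w^-1 * expR (- (Re w * n.+2%:R)) @[n --> \oo] --> (0 : R).
  rewrite -[X in _ --> X](mulr0 (cmod w^-1)); apply: cvgMr.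
  have c0 : (n.+2%:R : R) @[n --> \oo] --> +oo.
    apply/cvgryPge => A; near=> n.
    rewrite (@le_trans _ _ n%:R)// ?ler_nat//; last by rewrite -addn2 leq_addr.
    by near: n; exact: nbhs_infty_ger.
  have c1 : Re w * n.+2%:R @[n --> \oo] --> +oo.
    apply: (cvg_comp (fun n : nat => n.+2%:R : R) (fun s => Re w * s) c0).
    exact: gt0_cvgMry.
  exact: (cvg_comp _ _ c1 (@cvgr_expR R)).
have to0 (q : R[i] -> R) : (forall z, `|q z| <= cmod z) ->
    q (U n.+2%:R) @[n --> \oo] --> (0 : R).
  move=> qc; apply/norm_cvg0P.
  apply: (squeeze_cvgr _ (cvg_cst 0) b0).
  by apply: nearW => n; rewrite normr_ge0 (le_trans (qc _)).
have gt_inv n (t : R) : n.+1%:R^-1 <= t <= n.+2%:R -> 0 < t.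
  by move=> /andP[h _]; apply: lt_le_trans h; rewrite invr_gt0.
apply: complex_eq.
  apply: (@rintegral_FTC _ (fun t => 0 < t) (fun t => Re (U t)) (fun t => Re (hexp w t))
    (fun n => n.+1%:R^-1) (fun n => n.+2%:R)) => //.
  - exact: inv_lt_itv.
  - exact: near_inv_itv.
  - by move=> t /negbTE; rewrite /hexp /heaviside => ->; rewrite mul0r.
  - by move=> t tp; case: (dU t tp).
  - by move=> n t /gt_inv/cH[].
  - rewrite -[X in _ --> X](_ : 0 - Re (U 0) = _); last by rewrite U0 ReN sub0r opprK.
    by apply: cvgB; [exact: (to0 _ (@Re_le_cmod R))|exact: la1].
apply: (@rintegral_FTC _ (fun t => 0 < t) (fun t => Im (U t)) (fun t => Im (hexp w t))
  (fun n => n.+1%:R^-1) (fun n => n.+2%:R)) => //.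
- exact: inv_lt_itv.
- exact: near_inv_itv.
- by move=> t /negbTE; rewrite /hexp /heaviside => ->; rewrite mul0r.
- by move=> t tp; case: (dU t tp).
- by move=> n t /gt_inv/cH[].
- rewrite -[X in _ --> X](_ : 0 - Im (U 0) = _); last by rewrite U0 ImN sub0r opprK.
  by apply: cvgB; [exact: (to0 _ (@Im_le_cmod R))|exact: la2].
Unshelve. all: by end_near. Qed.

End ExponentialHalfLine.

(** * Fourier inversion on a vertical line *)

Section LaplaceInversion.
Variable R : realType.
Local Notation mu := (@lebesgue_measure R).
Variables (a : R[i]) (alpha : R).
Hypothesis adm : admissible alpha a.
Variables (theta : R[i]) (f : R -> R[i]).
Hypothesis Pf : in_P f.
Implicit Types (x y t sigma rho tau : R).

Local Notation G rho t := (LapQ a alpha theta f (vline rho t)).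

Lemma ccont_LapQ rho t : 0 < rho -> ccont (fun s => G rho s) t.
Proof.
move=> r0; have [n [e [d [C [e0 d0 C0 H]]]]] := Kern_le adm theta 0 r0.
have rz (s : R) : 0 < Re (vline rho s) by [].
rewrite (_ : (fun s => G rho s) =
  (fun s => cintegral setT (Kern a alpha theta f (vline rho s)))); last first.
  by apply/funext => s; rewrite (LapQE adm theta Pf (rz s)).
apply: (@ccont_under_integral _ (fun s => Kern a alpha theta f (vline rho s))
  (fun y => C * seminorm n e f * decay d y) t (t - 1) (t + 1)).
- by rewrite in_itv/= ltrDl ltr01 gtrBl ltr01.
- by move=> s _; apply: (cintegrable_Kern adm theta Pf (rz s)).
- move=> y s; have c th : ccont (fun s => cpow (vline rho s) th) s.
    apply/ccont_cexp/ccontM; first exact: ccont_cst.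
    exact: cder_ccont (cder_clog_ver s r0).
  apply: ccontM => //; apply: ccontM; first exact: ccont_cst.
  apply/ccont_cexp/ccontN/ccontM; last exact: ccont_cst.
  by apply: ccontM => //; exact: ccont_cst.
- exact/rintegrableZl/rintegrable_decay.
- move=> s y _; have := H f (vline rho s) y Pf (lexx _).
  by rewrite expr0 invr1 mulr1.
Qed.

(** 1 / (d + i c (t - tau)) is the integral of exp (- (d + i c (t - tau)) x) over x > 0; for real
    [c] that exponential is dominated by exp (- d x), so Fubini's theorem moves the [t]-integral
    inside. The values c = -1 and c = 1 are used. *)
Let half_transform (c rho tau d : R) : 0 < rho -> 0 < d ->
  cintegrable setT (fun t => G rho t * (vline d (c * (t - tau)))^-1) /\
  cintegrable setT (fun x => cintegral setT (fun t =>
    G rho t * hexp (vline d (c * (t - tau))) x)) /\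
  cintegral setT (fun t => G rho t * (vline d (c * (t - tau)))^-1) =
  cintegral setT (fun x => cintegral setT (fun t =>
    G rho t * hexp (vline d (c * (t - tau))) x)).
Proof.
move=> r0 d0; have [C C0 HC] := LapQ_line_le adm theta Pf r0.
pose F t x := G rho t * hexp (vline d (c * (t - tau))) x.
have mF : cmeas (fun p : R * R => F p.1 p.2).
  apply: cmeasM.
    exact: (cmeas_comp (cmeas_LapQ adm theta Pf r0) measurable_fst).
  apply: cmeasM; first exact: (cmeas_comp (cmeas_heaviside R) measurable_snd).
  apply/cmeas_cexp/cmeasN/cmeasM; last by apply: cmeas_real; exact: measurable_snd.
  apply: (cmeas_comp (cmeas_vline d)); apply: measurable_funM; first exact: measurable_cst.
  by apply: measurable_funB; [exact: measurable_fst|exact: measurable_cst].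
have Fg t x : cmod (F t x) <= (C * cauchy t) * decay d x.
  by rewrite /F cmodM cmod_hexp ler_wpM2r ?decay_ge0.
have ic : rintegrable (fun t => C * cauchy t).
  by apply: rintegrableZl; exact: rintegrable_cauchy.
have [J E] := cintegral_exchange mF ic (rintegrable_decay d0) Fg.
have F1 : (fun t => cintegral setT (F t)) =
    (fun t => G rho t * (vline d (c * (t - tau)))^-1).
  apply/funext => t; have dz : 0 < Re (vline d (c * (t - tau))) by [].
  by rewrite (cintegralZ _ (cintegrable_hexp dz)) (cintegral_hexp dz).
have J' := eq_ind _ (fun h => cintegrable setT h) J _ F1.
have E' := etrans (esym (congr1 (cintegral setT) F1)) E.
have ms : measurable_fun setT (fun p : R * R => (p.2, p.1)).
  by apply: measurable_fun_pair; [exact: measurable_snd|exact: measurable_fst].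
have mF' : cmeas (fun p : R * R => F p.2 p.1) by have := cmeas_comp mF ms.
have Fg' x t : cmod (F t x) <= decay d x * (C * cauchy t) by rewrite mulrC.
have [I _] := @cintegral_exchange _ (fun x t => F t x) _ _ mF' (rintegrable_decay d0) ic Fg'.
by split; [exact: J'|split; [exact: I|exact: E']].
Qed.

Let Hop1 rho x : 0 < rho ->
  cintegral setT (fun t => G rho t * cexp (vline rho t * x%:C)) =
  (2 * pi)%:C * Hop a alpha theta f rho x.
Proof.
move=> r0; rewrite /Hop mulrA -rmorphM/= divff ?mul1r//.
by rewrite mulf_neq0// gt_eqF// pi_gt0.
Qed.

(** For c = -1 and x > 0 the inner integral is 2 pi times the Bromwich integral at [x], weighted by
    exp (- (rho + d + i tau) x). *)
Let right_half rho tau d : 0 < rho -> 0 < d ->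
  cintegral setT (fun t => G rho t * (vline d (-1 * (t - tau)))^-1) =
  (2 * pi)%:C * cintegral setT (fun x => Hop a alpha theta f rho x *
    cexp (- (vline (rho + d) tau * x%:C))) /\
  cintegrable setT (fun x => Hop a alpha theta f rho x *
    cexp (- (vline (rho + d) tau * x%:C))).
Proof.
move=> r0 d0; have [_ [I ->]] := half_transform (-1) tau r0 d0.
have pin : (2 * pi)%:C != 0 :> R[i].
  by rewrite -cmod_eq0 cmodC normr_eq0 mulf_neq0// gt_eqF// pi_gt0.
have E : (fun x => cintegral setT (fun t => G rho t * hexp (vline d (-1 * (t - tau))) x)) =
    (fun x => (2 * pi)%:C * (Hop a alpha theta f rho x *
      cexp (- (vline (rho + d) tau * x%:C)))).
  apply/funext => x; rewrite mulrA -(Hop1 x r0).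
  have [x0|x0] := leP x 0.
    rewrite (Hop1 x r0) (Hop_le0 adm theta Pf r0 x0) mulr0 mul0r.
    rewrite -[RHS](cintegral0 R); apply: eq_cintegral => t _.
    by rewrite /hexp /heaviside ltNge x0/= mul0r mulr0.
  rewrite mulrC -(cintegralZ _ (cintegrable_Hop adm theta x Pf r0)).
  apply: eq_cintegral => t _; rewrite /hexp /heaviside x0 mul1r [RHS]mulrCA -cexpD.
  apply: (congr1 (fun z => _ * cexp z)).
  by apply: complex_eq; rewrite /vline !reimE; ring.
have {}I := eq_ind _ (fun h => cintegrable setT h) I _ E.
rewrite (congr1 (cintegral setT) E).
have I' : cintegrable setT (fun x => Hop a alpha theta f rho x *
    cexp (- (vline (rho + d) tau * x%:C))).
  have := cintegrableZ ((2 * pi)%:C^-1) I; congr cintegrable; apply/funext => x.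
  by rewrite mulKf.
by split=> //; rewrite cintegralZ.
Qed.

(** For c = 1 and x > 0 the inner integral is a multiple of the Bromwich integral at - x, which is
    0. *)
Let left_half rho tau d : 0 < rho -> 0 < d ->
  cintegral setT (fun t => G rho t * (vline d (1 * (t - tau)))^-1) = 0.
Proof.
move=> r0 d0; have [_ [_ ->]] := half_transform 1 tau r0 d0.
rewrite -[RHS](cintegral0 R); apply: eq_cintegral => x _.
have [x0|x0] := leP x 0.
  rewrite -[RHS](cintegral0 R); apply: eq_cintegral => t _.
  by rewrite /hexp /heaviside ltNge x0/= mul0r mulr0.
have nx0 : - x <= 0 by rewrite oppr_le0 ltW.
transitivity (cexp (vline (rho - d) tau * x%:C) *
    cintegral setT (fun t => G rho t * cexp (vline rho t * (- x)%:C))).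
  rewrite -(cintegralZ _ (cintegrable_Hop adm theta (- x) Pf r0)).
  apply: eq_cintegral => t _; rewrite /hexp /heaviside x0 mul1r [RHS]mulrCA -cexpD.
  apply: (congr1 (fun z => _ * cexp z)).
  by apply: complex_eq; rewrite /vline !reimE; ring.
by rewrite (Hop1 (- x) r0) (Hop_le0 adm theta Pf r0 nx0) !mulr0.
Qed.

(** With s = t - tau, 1 / (d - i s) + 1 / (d + i s) = 2 d / (d^2 + s^2): the Poisson integral is
    half the sum of the two halves, of which only the right one contributes. *)
Lemma cintegral_LapQ_poisson rho tau d : 0 < rho -> 0 < d ->
  cintegral setT (fun t => G rho t * (poisson d tau t)%:C) =
  pi%:C * cintegral setT (fun x => Hop a alpha theta f rho x *
    cexp (- (vline (rho + d) tau * x%:C))).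
Proof.
move=> r0 d0; have i c := (half_transform c tau r0 d0).1.
have := congr2 +%R (right_half tau r0 d0).1 (left_half tau r0 d0).
rewrite addr0 -(cintegralD (i _) (i _)).
have P2 t : (vline d (-1 * (t - tau)))^-1 + (vline d (1 * (t - tau)))^-1 =
    2%:C * (poisson d tau t)%:C.
  have n0 : d ^+ 2 + (t - tau) ^+ 2 != 0.
    by rewrite gt_eqF// ltr_pwDl ?sqr_ge0// exprn_gt0.
  rewrite mulN1r mul1r; apply: complex_eq.
    by rewrite ReD !ReV ReM !ReC !ImC /vline !ImX sqrrN /poisson; field.
  by rewrite ImD !ImV ImM !ReC !ImC /vline !ImX sqrrN; field.
have ip : cintegrable setT (fun t => G rho t * (poisson d tau t)%:C).
  have := cintegrableZ (2^-1%:C) (cintegrableD (i (-1)) (i 1)).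
  congr cintegrable; apply/funext => t; rewrite -mulrDr P2 (mulrCA (2^-1%:C)).
  have P3 : 2^-1%:C * 2%:C = 1 :> R[i] by rewrite -rmorphM/= mulVf.
  by rewrite (mulrA (2^-1%:C)) P3 mul1r.
rewrite (_ : (fun t => _) = (fun t => 2%:C * (G rho t * (poisson d tau t)%:C))); last first.
  by apply/funext => t; rewrite -mulrDr P2 mulrCA.
rewrite (cintegralZ _ ip) rmorphM/= -mulrA => /mulfI; apply.
by rewrite -cmod_eq0 cmodC normr_eq0.
Qed.

(* Fourier inversion along the line [Re z = Re w], by Abel summation. *)
Lemma Lap_Hop sigma w : 0 < sigma -> 0 < Re w ->
  Lap (Hop a alpha theta f sigma) w = LapQ a alpha theta f w.
Proof.
move=> s0; case: w => rho tau /= r0; set w := rho +i* tau.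
pose d n : R := n.+1%:R^-1.
have d0 n : 0 < d n by rewrite invr_gt0.
have -> : Hop a alpha theta f sigma = Hop a alpha theta f rho.
  by apply/funext => x; exact: Hop_indep.
have [C C0 HC] := LapQ_line_le adm theta Pf r0.
have GC t : cmod (G rho t) <= C.
  rewrite (le_trans (HC t))// ler_piMr// invf_le1 ?lerDl ?sqr_ge0//.
  by rewrite ltr_pwDl// sqr_ge0.
have [p1 p2] := cvg_poisson tau (fun t => ccont_LapQ t r0) GC.
pose u n x := Hop a alpha theta f rho x * cexp (- (vline (rho + d n) tau * x%:C)).
pose v x := Hop a alpha theta f rho x * cexp (- (w * x%:C)).
have r20 : 0 < rho / 2 by rewrite divr_gt0.
(* Growth at rate rho / 2 against a weight at most exp (- rho x) leaves the majorant exp (- rho x /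
   2), the same for all [n]. *)
have [m [e [D [e0 D0 HD]]]] := Hop_le adm theta r20.
have PH := in_P_Hop adm theta Pf r0.
have mu_ n : cmeas (u n) by exact/cintegrable_cmeas/(right_half tau r0 (d0 n)).2.
have uh n x : cmod (u n x) <= (D * seminorm m e f) * decay (rho / 2) x.
  rewrite /decay; have [x0|x0] := leP x 0.
    by rewrite /u (Hop_le0 adm theta Pf r0 x0) mul0r cmodC normr0 mulr0.
  rewrite /u cmodM (Hop_indep adm theta x Pf r0 r20) cmod_cexp.
  apply: (@le_trans _ _ (D * seminorm m e f * expR (rho / 2 * x) *
      expR (Re (- (vline (rho + d n) tau * x%:C))))).
    by rewrite ler_wpM2r ?expR_ge0// HD.
  rewrite -(mulrA (D * _)) ler_wpM2l ?mulr_ge0 ?seminorm_ge0//.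
  have Rv : Re (- (vline (rho + d n) tau * x%:C)) = - ((rho + d n) * x).
    by rewrite ReN ReM ImC mulr0 subr0.
  rewrite Rv -expRD ler_expR.
  rewrite -subr_ge0 (_ : _ - _ = d n * x); last by field.
  by rewrite mulr_ge0// ltW.
have ih : rintegrable (fun x => (D * seminorm m e f) * decay (rho / 2) x).
  exact/rintegrableZl/rintegrable_decay.
have cv x : (Re (u n x) @[n --> \oo] --> Re (v x)) /\ (Im (u n x) @[n --> \oo] --> Im (v x)).
  pose U s := Hop a alpha theta f rho x * cexp (- (vline (rho + s) tau * x%:C)).
  have -> : v x = U 0 by rewrite /U addr0.
  apply: (@cvg_ccont _ U d); last exact: cvg_harmonic.
  apply: ccontM; first exact: ccont_cst.
  apply/ccont_cexp/ccontN/ccontM; last exact: ccont_cst.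
  split; last exact: cst_continuous.
  apply: (@continuousD _ _ _ (fun=> rho) id) => //; exact: cst_continuous.
have [iv l1 l2] := cintegral_dominated mu_ ih uh (fun x => (cv x).1) (fun x => (cv x).2).
have E n : cintegral setT (fun t => G rho t * (poisson n.+1%:R^-1 tau t)%:C) =
    pi%:C * cintegral setT (u n) by exact: cintegral_LapQ_poisson.
have pi0 : (pi : R) != 0 by rewrite gt_eqF// pi_gt0.
have R1 : Re (pi%:C * cintegral setT (u n)) @[n --> \oo] --> pi * Re (cintegral setT v).
  rewrite (_ : (fun n => _) = (fun n => pi * Re (cintegral setT (u n)))).
    exact: cvgMr.
  by apply/funext => n; rewrite ReM ReC ImC mul0r subr0.
have R2 : Im (pi%:C * cintegral setT (u n)) @[n --> \oo] --> pi * Im (cintegral setT v).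
  rewrite (_ : (fun n => _) = (fun n => pi * Im (cintegral setT (u n)))).
    exact: cvgMr.
  by apply/funext => n; rewrite ImM ReC ImC mul0r addr0.
(* The Poisson integrals have two limits, one by the approximate identity and one by dominated
   convergence; pi cancels. *)
rewrite /Lap; apply: complex_eq.
  apply: (mulfI pi0); apply: (cvg_unique _ R1) => //.
  apply: cvg_trans p1; apply: near_eq_cvg; apply: nearW => n.
  by rewrite -E.
apply: (mulfI pi0); apply: (cvg_unique _ R2) => //.
apply: cvg_trans p2; apply: near_eq_cvg; apply: nearW => n.
by rewrite -E.
Qed.

End LaplaceInversion.

(** * Composition and continuity *)

Section Composition.
Variable R : realType.
Implicit Types (theta z a : R[i]) (alpha : R) (f : R -> R[i]).

(** Inversion applies at w = a' z^alpha', which has positive real part. Since log w = log a' +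
    alpha' log z, the factor w^theta yields the constant a'^theta and adds theta alpha' to the
    exponent of z, while a w^alpha becomes a a'^alpha z^(alpha alpha'). *)
Lemma LapQ_Hop theta theta' a a' alpha alpha' f z :
  admissible alpha a -> admissible alpha' a' -> in_P f -> 0 < Re z ->
  LapQ a' alpha' theta' (Hop a alpha theta f 1) z =
  cpow a' theta * LapQ (a * cpow a' alpha%:C) (alpha * alpha')
    (theta' + theta * alpha'%:C) f z.
Proof.
move=> adm adm' Pf rz.
have z0 : z != 0 by apply: contraTneq rz => ->; rewrite ltxx.
have [_ a0 _ _] := adm; have [_ a'0 _ _] := adm'.
rewrite /LapQ; set w := a' * cpow z alpha'%:C.
have rw : 0 < Re w.
  have [k k0 hk] := admissible_sector adm'.
  apply: lt_le_trans (hk z z0 (ltW rz)).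
  by rewrite mulr_gt0// powR_gt0// cmod_gt0.
rewrite (Lap_Hop adm theta Pf ltr01 rw) /LapQ.
have lw : clog w = clog a' + alpha'%:C * clog z by exact: clog_mul_cpow adm' z0 (ltW rz).
have -> : a * cpow w alpha%:C =
    a * cpow a' alpha%:C * cpow z (alpha * alpha')%:C.
  by rewrite -mulrA; congr (_ * _); rewrite !cpowE lw mulrDr cexpD rmorphM mulrA.
have wE : cpow w theta = cpow a' theta * cpow z (theta * alpha'%:C).
  by rewrite !cpowE lw mulrDr cexpD mulrA.
by rewrite wE cpowD; ring.
Qed.

End Composition.

Section Continuity.
Variable R : realType.
Variables (a theta : R[i]) (alpha : R).
Hypothesis adm : admissible alpha a.
Implicit Types (f g : Pspace R).

Definition Qop f : Pspace R := MkP (in_P_Hop adm theta (PfunP f) ltr01).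

(** The m-th derivative replaces theta by theta + m, and moving the line to Re z = e gives exactly
    the growth that the seminorm allows. *)
Lemma seminorm_Qop m (e : R) : 0 < e -> exists n (e' : {posnum R}) C,
  0 <= C /\ forall f g, seminorm m e (fun x => Qop g x - Qop f x) <=
    C * seminorm n e'%:num (fun x => g x - f x).
Proof.
move=> e0; have [n [e' [C [e'0 C0 H]]]] := Hop_le adm (theta + m%:R) e0.
exists n, (PosNum e'0), C; split=> // f g; apply: seminorm_le => x x0.
have Ph := in_PB (PfunP g) (PfunP f).
rewrite (_ : (fun x => _) = Hop a alpha theta (fun y => g y - f y) 1); last first.
  by apply/funext => y; exact: (HopB adm theta y (PfunP g) (PfunP f) ltr01).
rewrite (hderivn_Hop adm theta m Ph ltr01 x0).
by rewrite (Hop_indep adm _ x Ph ltr01 e0) H.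
Qed.

Lemma continuous_Qop : continuous Qop.
Proof.
apply/continuousP => U oU.
have {}oU : Popen U by exact: oU.
suff : Popen (Qop @^-1` U) by [].
move=> f Uf; have [s [d [d0 sU]]] := oU (Qop f) Uf.
suff [s' [d' [d'0 H]]] : exists (s' : seq (nat * {posnum R})) (d' : R), 0 < d' /\
    forall g, (forall p, p \in s' ->
      seminorm p.1 (p.2)%:num (fun x => g x - f x) < d') ->
    forall p, p \in s ->
      seminorm p.1 (p.2)%:num (fun x => Qop g x - Qop f x) < d.
  by exists s', d'; split=> // g /H; exact: sU.
elim: s {sU} => [|[m e] s [s' [d' [d'0 H]]]]; first by exists [::], 1; split.
have [n [e' [C [C0 HC]]]] := seminorm_Qop m (gt0 e).
have C1 : 0 < C + 1 by rewrite ltr_wpDl.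
(* Dividing by C + 1 covers C = 0 and makes C d / (C + 1) < d strict. *)
exists ((n, e') :: s'), (Num.min d' (d / (C + 1))); split.
  by rewrite lt_min d'0 divr_gt0.
move=> g Hg p; rewrite inE => /orP[/eqP ->|ps].
  have := Hg (n, e'); rewrite mem_head lt_min => /(_ isT)/andP[_ /= h].
  rewrite (le_lt_trans (HC f g))//.
  apply: (@le_lt_trans _ _ (C * (d / (C + 1)))); first by rewrite ler_wpM2l// ltW.
  by rewrite mulrA ltr_pdivrMr// mulrDr mulr1 mulrC ltrDl.
apply: H ps => q qs; have := Hg q; rewrite inE qs orbT lt_min => /(_ isT)/andP[h _].
exact: h.
Qed.

End Continuity.

Theorem theorem4p1 (R : realType) :
  (forall (theta a : R[i]) (alpha : R), admissible alpha a ->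
    [/\ (* the integrals in the definition converge *)
        -1 < complex.Re theta -> forall (f : Pspace R) (x : R), 0 < x ->
          (forall y : R, 0 < y ->
             cintegrable setT
               (on_imag_axis (Nker_integrand theta alpha a x y))) /\
          cintegrable `[0, +oo[ (fun y => Nker theta alpha a x y * f y),
        (* the choice of n is immaterial *)
        complex.Re theta <= -1 -> forall n : nat, (0 < n)%N ->
          -1 < complex.Re theta + n%:R -> forall f : Pspace R,
          Qtilde theta alpha a f = Jint n (Qint (theta + n%:R) alpha a f)
      & (* boundedness in P *)
        exists T : Pspace R -> Pspace R,
          (forall f : Pspace R, T f = Qtilde theta alpha a f :> (R -> R[i]))
          /\ continuous T]) /\
  (forall (theta theta' a a' : R[i]) (alpha alpha' : R),
    admissible alpha a -> admissible alpha' a' ->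
    forall f : Pspace R,
      Qtilde theta' alpha' a' (Qtilde theta alpha a f) =
      (fun x => cpow a' theta *
         Qtilde (theta' + theta * alpha'%:C) (alpha * alpha')
                (a * cpow a' alpha%:C) f x)).
Proof.
split=> [theta a alpha adm|theta theta' a a' alpha alpha' adm adm' f].
  split=> [th f x _|_ n n0 th f|].
  - split=> [y y0|]; first exact: cintegrable_Nker.
    apply: cintegrable_subset; first exact: measurable_itv.
    exact: (Hop_Nker adm x (PfunP f) ltr01 th).1.
  - by rewrite (QtildeE adm theta (PfunP f)) (Jint_Qint adm n0 th (PfunP f)).
  - exists (Qop theta adm); split; last exact: continuous_Qop.
    by move=> f; rewrite (QtildeE adm theta (PfunP f)).
have Pf := PfunP f; have adm'' := admissible_comp adm adm'.
(* All operators become Bromwich integrals on the line Re z = 1, so that it remains to compare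
   integrands pointwise. *)
rewrite (QtildeE adm theta Pf) (QtildeE adm' theta' (in_P_Hop adm theta Pf ltr01)).
rewrite (QtildeE adm'' _ Pf); apply/funext => x; rewrite /Hop mulrCA.
apply: (congr1 ( *%R _)).
apply: etrans; last first.
  exact: (cintegralZ (cpow a' theta) (cintegrable_Hop adm'' _ x Pf ltr01)).
apply: eq_cintegral => t _; have rz : 0 < complex.Re (vline 1 t) by exact: ltr01.
by rewrite (LapQ_Hop theta theta' adm adm' Pf rz) mulrA.
Qed.
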